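(* Let $\lambda\in(1/2,1)$ be such that $\lambda^{-1}$ is a Salem number, and let $\nu_\lambda$ be the Bernoulli convolution with parameter $\lambda$. Write $\tau_{\nu_\lambda}$ for its $L^q$ spectrum, $\tau'_{\nu_\lambda}(+\infty):=\lim_{q\to+\infty}\tau_{\nu_\lambda}(q)/q$, and $\tau'_{\nu_\lambda}(0+)$ for the right derivative of $\tau_{\nu_\lambda}$ at $0$. Then: (i) $E_{\nu_\lambda}(\alpha)\neq\emptyset$ if $\alpha\in[\tau'_{\nu_\lambda}(+\infty),\tau'_{\nu_\lambda}(0+)]$. (ii) For any $\alpha\in[\tau'_{\nu_\lambda}(+\infty),\tau'_{\nu_\lambda}(0+)]$, $$\dim_H E_{\nu_\lambda}(\alpha)=\tau^*_{\nu_\lambda}(\alpha):=\inf\{\alpha q-\tau_{\nu_\lambda}(q):\ q\in\mathbb{R}\}.$$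
   Context: A positive number $\beta$ is a Salem number if it is an algebraic integer all of whose algebraic conjugates (other than $\beta$ itself) have modulus no greater than $1$, with at least one of them on the unit circle. For $\lambda\in(0,1)$, the Bernoulli convolution $\nu_\lambda$ is the distribution of $\sum_{n=0}^\infty\epsilon_n\lambda^n$, where the $\epsilon_n\in\{-1,1\}$ are chosen independently with probability $1/2$ each. Equivalently, it is the unique Borel probability measure with $\nu_\lambda=\frac12\nu_\lambda\circ S_1^{-1}+\frac12\nu_\lambda\circ S_2^{-1}$, where $S_1(x)=\lambda x-1$, $S_2(x)=\lambda x+1$. Let $\mu$ be a finite Borel measure on $\mathbb{R}$ with compact support, and let $B_r(x)$ denote the closed ball of radius $r$ centered at $x$. For $q\in\mathbb{R}$ the $L^q$ spectrum of $\mu$ is $$\tau_\mu(q)=\liminf_{r\to0}\frac{\log\Theta_\mu(q;r)}{\log r},\qquad \Theta_\mu(q;r)=\sup\sum_i\mu(B_r(x_i))^q,$$ where the supremum is over all families of disjoint balls $\{B_r(x_i)\}_i$ with $x_i\in\mathrm{supp}(\mu)$; $\tau_\mu$ is concave in $q$. For $\alpha\in\mathbb{R}$ the level set is $$E_\mu(\alpha)=\left\{x\in\mathbb{R}:\ \lim_{r\to0}\frac{\log\mu(B_r(x))}{\log r}\text{ exists and equals }\alpha\right\}.$$ $\dim_H$ denotes Hausdorff dimension. *)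

(* Defs.v *)
From HB Require Import structures.
From mathcomp Require Import all_boot all_order all_algebra finmap.
From mathcomp Require Import mxpoly complex.
From mathcomp Require Import all_classical all_reals all_analysis.

Set Implicit Arguments.
Unset Strict Implicit.
Unset Printing Implicit Defensive.

Import Order.TTheory GRing.Theory Num.Theory.
Import numFieldNormedType.Exports.

Local Open Scope classical_set_scope.
Local Open Scope ring_scope.

(* [p] is the minimal polynomial over the rationals of each of its roots. *)
Definition rat_conjugate (R : realType) (x z : R[i]) : Prop :=
  exists p : {poly rat},
    [/\ p \is monic, irreducible_poly p,
        root (map_poly ratr p) x & root (map_poly ratr p) z].

Definition salem_number (R : realType) (beta : R) : Prop :=
  [/\ 0 < beta,
      integralOver (intr : int -> R) beta,
      forall z : R[i], rat_conjugate (beta%:C)%C z -> z != (beta%:C)%C ->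
        `|z| <= 1
    & exists z : R[i],
        [/\ rat_conjugate (beta%:C)%C z, z != (beta%:C)%C & `|z| = 1]].

Definition mutually_independent (d : measure_display) (T : measurableType d)
    (R : realType) (P : probability T R) (X : nat -> {RV P >-> R}) : Prop :=
  forall (J : {fset nat}) (A : nat -> set R),
    (forall i, i \in J -> measurable (A i)) ->
    P (\bigcap_(i in [set` J]) X i @^-1` A i) =
      (\prod_(i <- J) P (X i @^-1` A i))%E.

Definition fair_sign (d : measure_display) (T : measurableType d)
    (R : realType) (P : probability T R) (X : {RV P >-> R}) : Prop :=
  [/\ forall w, X w = -1 \/ X w = 1,
      P (X @^-1` [set -1]) = (2^-1)%:E
    & P (X @^-1` [set 1]) = (2^-1)%:E].

Definition bernoulli_convolution (R : realType) (lambda : R)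
    (nu : probability (measurableTypeR R) R) : Prop :=
  exists (d : measure_display) (T : measurableType d) (P : probability T R)
      (eps : nat -> {RV P >-> R}),
    [/\ mutually_independent eps,
        forall n, fair_sign (eps n)
      & forall A : set R, measurable A ->
          nu A = P [set w | A (limn (series (fun n => eps n w * lambda ^+ n)))]].

Section Multifractal.
Context (R : realType).
Implicit Types (mu : {measure set (measurableTypeR R) -> \bar R}).

Definition msupport mu : set R :=
  \bigcap_(F in [set F : set R | closed F /\ mu (~` F) = 0%E]) F.

(* A disjoint family of balls of a common radius r > 0 is determined by its set
   D of centers, because nonempty disjoint balls have distinct centers. *)
Definition Theta mu (q r : R) : \bar R :=
  ereal_sup [set \esum_(x in D) (mu (closed_ball x r) `^ q)%E
            | D in [set D : set R |
                D `<=` msupport mu /\ trivIset D (fun x => closed_ball x r)]].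

Definition Lq_spectrum mu (q : R) : \bar R :=
  limf_einf (fun r : R => (lne (Theta mu q r) * ((ln r)^-1)%:E)%E) (0^'+).

Definition Lq_slope_infty mu : \bar R :=
  lim ((Lq_spectrum mu q * (q^-1)%:E)%E @[q --> +oo]).

Definition Lq_rderiv0 mu : \bar R :=
  lim (((Lq_spectrum mu q - Lq_spectrum mu 0) * (q^-1)%:E)%E @[q --> 0^'+]).

Definition Lq_legendre mu (alpha : R) : \bar R :=
  ereal_inf [set ((alpha * q)%:E - Lq_spectrum mu q)%E | q in [set: R]].

(* Outside the support the quotient tends to +oo, since lne 0 = -oo. *)
Definition level_set mu (alpha : R) : set R :=
  [set x | (lne (mu (closed_ball x r)) * ((ln r)^-1)%:E)%E @[r --> 0^'+]
             --> alpha%:E].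

End Multifractal.

Section Hausdorff.
Context (R : realType).
Implicit Types (A U : set R) (s delta : R).

(* The supremum over the empty set would be -oo. *)
Definition diam U : \bar R :=
  if U == set0 then 0%E
  else ereal_sup [set `|p.1 - p.2|%:E | p in U `*` U].

(* The empty set has weight 0 also for s = 0, where 0 `^ 0 = 1. *)
Definition diam_pow s U : \bar R :=
  if U == set0 then 0%E else (diam U `^ s)%E.

Definition hausdorff_premeasure s delta A : \bar R :=
  ereal_inf [set (\sum_(0 <= n <oo) diam_pow s (U n))%E
            | U in [set U : nat -> set R | A `<=` \bigcup_n U n /\
                     forall n, (diam (U n) <= delta%:E)%E]].

Definition hausdorff_measure s A : \bar R :=
  ereal_sup [set hausdorff_premeasure s delta A
            | delta in [set delta : R | 0 < delta]].

Definition hausdorff_dim A : \bar R :=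
  ereal_inf [set s%:E
            | s in [set s : R | 0 <= s /\ hausdorff_measure s A = 0%E]].

End Hausdorff.

(* Main.v *)
(* Let L = 1/(1-lambda).  The n-th partial sums of the random series live in a
   finite set [bpts n], and nu at scale lambda^n is comparable to their law
   [bmass n].  By a Garsia-type norm estimate, distinct points of [bpts n] are
   lambda^n / poly(n) apart when 1/lambda is a Salem number, so only
   polynomially many lie in a ball of radius O(lambda^n).

   Concatenating words, the number of points of mass at least exp(-n a) is
   supermultiplicative up to polynomial factors, so its exponential growth rate
   is a concave function of a.  By Legendre duality it is determined by the
   growth rates of the moments, which for q >= 0 are the spectrum up to the
   factor ln lambda.  Given alpha in the range, one
   concatenates blocks of length 1, 2, 3, ... made of typical points for alpha
   and prunes the points that are close to a point of too large mass, which are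
   few by Chebyshev's inequality because the growth rate is strictly smaller to
   the left of alpha.  The limit set lies in the level set and carries enough
   separated points for the lower bound on the dimension.  The upper bound is
   a covering argument valid for every measure. *)
Require Import Defs.
From mathcomp Require Import all_boot all_order all_algebra finmap.
From mathcomp Require Import mxpoly complex.
From mathcomp Require Import all_classical all_reals all_analysis.
From mathcomp Require Import measurable_realfun ring lra zify.
Set Implicit Arguments.
Unset Strict Implicit.
Unset Printing Implicit Defensive.
Import Order.TTheory GRing.Theory Num.Theory.
Import numFieldNormedType.Exports.
Local Open Scope classical_set_scope.
Local Open Scope ring_scope.

(** * Separation of the points of level n *)

(** The obstacle is overlap: many words may give the same point and many points may lie in one ball,
    so concatenation bounds masses only from below and counts only up to a window factor. Pruning
    recovers the missing upper bound on the mass of a ball. Growing blocks keep the losses harmless: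
    after k blocks the length is about k^2/2, while the product of the k polynomial window factors
    is exp(O(k log k)), and the next block changes the scale exponent by only k+1. With blocks of
    bounded length the bounds on these factors would be at least exponential. The lower end of the
    range of alpha guarantees that words of mass at least about lambda^(n alpha) exist; the upper
    end gives the strictness that pruning needs. The spectrum is compared with moments for q >= 0
    only. This suffices: the construction bounds the dimension below by the infimum over q >= 0, the
    covering argument bounds it above by the infimum over all real q, and the latter infimum is the
    smaller one, so all three agree. *)

Lemma det_scalar_sub (F : fieldType) n (A : 'M[F]_n) (a : F) :
  \det (A - a%:M) = (-1) ^+ n * (char_poly A).[a].
Proof.
rewrite -[A - _]opprB -scaleN1r detZ; congr (_ * _).
rewrite /char_poly -[_.[a]]/(horner_eval a _) -det_map_mx; congr (\det _).
by apply/matrixP => i j; rewrite !mxE /= /horner_eval !hornerE hornerMn hornerX.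
Qed.

(** Both polynomials split into linear factors, and each side is the double product of the
    differences of their roots, times the same power of the leading coefficient of [Q]. *)
Lemma det_horner_mx (F : closedFieldType) n (A : 'M[F]_n.+1) (Q : {poly F})
    (rs : seq F) :
  char_poly A = \prod_(z <- rs) ('X - z%:P) ->
  \det (horner_mx A Q) = \prod_(z <- rs) Q.[z].
Proof.
move=> cA.
have srs : size rs = n.+1.
  have := size_char_poly A; rewrite cA size_prod_XsubC => /eqP.
  by rewrite eqSS => /eqP.
have [qs ->] := closed_field_poly_normal Q.
set c := lead_coef Q.
have constE (x : F) : \prod_(z <- rs) x = x ^+ n.+1.
  by rewrite big_const_seq count_predT iter_mulr_1 srs.
rewrite linearZ /= detZ rmorph_prod /=.
rewrite (big_morph _ (@det_mulmx _ _) (det1 _ _)).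
under eq_bigr => a _.
  rewrite rmorphB /= horner_mx_X horner_mx_C det_scalar_sub cA horner_prod.
  rewrite -constE -big_split /=.
  over.
under [RHS]eq_bigr => z _ do rewrite hornerZ horner_prod.
rewrite big_split /= constE; congr (_ * _).
rewrite exchange_big /=; apply: eq_bigr => z _; apply: eq_bigr => a _.
by rewrite !hornerE; ring.
Qed.

(* The product is the determinant of [Q] at the companion matrix of [P]. *)
Lemma prod_root_int (F : closedFieldType) (P Q : {poly int}) (rs : seq F) :
  P \is monic -> (1 < size P)%N ->
  map_poly intr P = \prod_(z <- rs) ('X - z%:P) ->
  exists m : int, \prod_(z <- rs) (map_poly intr Q).[z] = m%:~R.
Proof.
move=> Pm sP PE.
have: char_poly (map_mx (intr : int -> F) (companionmx P)) =
    \prod_(z <- rs) ('X - z%:P).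
  by rewrite -map_char_poly companionmxK.
have: (0 < (size P).-1)%N by case: (size P) sP => [|[]].
move: (companionmx P) => A; case: (size P).-1 A => // n A _ cA.
exists (\det (horner_mx A Q)).
by rewrite -det_map_mx map_horner_mx (det_horner_mx _ cA).
Qed.

(** [rat_conjugate] speaks of rational polynomials, while the norm estimate needs integer
    coefficients. By Gauss's lemma the rational polynomial of least degree vanishing at [x], a
    divisor of the monic [q], is proportional to an integer factor of [q]. The leading coefficient
    of that factor divides 1, and multiplying by this sign makes it monic. *)
Lemma integral_min_poly (R : realType) (x : R) :
  integralOver (intr : int -> R) x ->
  exists P : {poly int}, [/\ P \is monic,
    irreducible_poly (map_poly (intr : int -> rat) P)
    & root (map_poly (intr : int -> R) P) x].
Proof.
case=> q qm qx.
pose zq := map_poly (intr : int -> rat).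
pose pr := map_poly (ratr : rat -> R).
have prZ (p : {poly int}) : pr (zq p) = map_poly intr p.
  by rewrite /pr -map_poly_comp; apply: eq_map_poly => a /=; rewrite ratr_int.
pose ok n := `[< exists p : {poly rat}, [/\ p != 0, root (pr p) x & size p = n] >].
have exok : exists n, ok n.
  exists (size (zq q)); apply/asboolP; exists (zq q); split => //.
    by rewrite monic_neq0// monic_map.
  by rewrite prZ.
case: (ex_minnP exok) => n /asboolP[p [p0 px sp]] minp.
have min_p (r : {poly rat}) : r != 0 -> root (pr r) x -> (size p <= size r)%N.
  by move=> r0 rx; rewrite sp; apply: minp; apply/asboolP; exists r.
have pdiv : p %| zq q.
  apply: contraT => /negP pNq.
  have r0 : zq q %% p != 0 by apply/negP => ?; apply: pNq.
  have := min_p _ r0; rewrite leqNgt ltn_modp p0 /= => /(_ _)/negP; case=> //.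
  move: qx; rewrite -prZ {1}(divp_eq (zq q) p) /pr rmorphD rmorphM /=.
  by rewrite /root hornerD hornerM (rootP px) mulr0 add0r.
have pirr : irreducible_poly p.
  split.
    rewrite ltnNge; apply/negP => /size1_polyC pE; move: px p0; rewrite pE.
    rewrite /pr map_polyC rootC fmorph_eq0 => /eqP->.
    by rewrite polyC0 eqxx.
  move=> r r1 rp; have /dvdpP[t pE] := rp.
  have t0 : t != 0 by apply: contraNneq p0 => t0; rewrite pE t0 mul0r.
  have r0 : r != 0 by apply: contraNneq p0 => r0; rewrite pE r0 mulr0.
  move: (px); rewrite pE /pr rmorphM /= rootM => /orP[tx|rx].
    have := min_p _ t0 tx; rewrite pE size_mul// => le_t; exfalso.
    move: r1 le_t; rewrite -!size_poly_gt0 in t0 r0 *.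
    by move/eqP; move: t0 r0; move: (size t) (size r) => ? ?; lia.
  by rewrite -pE -dvdp_size_eqp// eqn_leq dvdp_leq// min_p.
have [p1 [a a0 pE] [r qE]] := dvdpP_rat_int pdiv.
have l1 : lead_coef p1 * lead_coef r = 1.
  by rewrite -lead_coefM -qE; apply/monicP.
have u1 : lead_coef p1 \is a GRing.unit.
  by apply/unitrPr; exists (lead_coef r).
have lN0 : lead_coef p1 != 0 by apply: contraTneq u1 => ->; rewrite unitr0.
have l2 : lead_coef p1 * lead_coef p1 = 1.
  by move: u1; rewrite unfold_in => /orP[]/eqP->.
pose P := lead_coef p1 *: p1.
have PE : zq P = ((lead_coef p1)%:~R / a) *: p.
  by rewrite /P /zq map_polyZ /= pE scalerA mulfVK.
have c0 : (lead_coef p1)%:~R / a != 0 by rewrite mulf_neq0 ?invr_eq0// intr_eq0.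
exists P; split.
- by rewrite monicE lead_coefZ l2.
- rewrite -/zq PE; case: pirr => sp1 pirr; split; first by rewrite size_scale.
  move=> t t1; rewrite dvdpZr// => tp.
  by apply: (eqp_trans (pirr t t1 tp)); rewrite eqp_sym eqp_scale.
- rewrite -prZ PE /pr map_polyZ /= rootZ// fmorph_eq0//.
Qed.

(** The product of the values of [Q] over the roots of the minimal polynomial is a nonzero integer,
    hence of modulus at least 1. At a root other than [beta] the [n] terms of [Q] have modulus at
    most 1 each, so [Q] is at most [n] there; [D] is the number of remaining roots. *)
Lemma salem_garsia (R : realType) (beta : R) : salem_number beta ->
  exists D, forall n (Q : {poly int}), (size Q <= n)%N ->
    (forall i, `|Q`_i| <= 1) -> (map_poly intr Q).[beta] != 0 ->
    1 <= `|(map_poly intr Q).[beta]| * n%:R ^+ D.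
Proof.
case=> _ /integral_min_poly[P [Pm Pirr Px]] conj_le1 _.
pose fC := (intr : int -> R[i]).
have [rs] := closed_field_poly_normal (map_poly fC P).
rewrite (monicP _) ?monic_map// scale1r => PE.
have ratE (p : {poly int}) :
    map_poly (ratr : rat -> R[i]) (map_poly intr p) = map_poly fC p.
  by rewrite -map_poly_comp; apply: eq_map_poly => a /=; rewrite ratr_int.
have realE (p : {poly int}) :
    (map_poly fC p).[(beta%:C)%C] = ((map_poly intr p).[beta]%:C)%C.
  rewrite -horner_map -map_poly_comp; congr (_.[_]).
  by apply: eq_map_poly => a /=; rewrite rmorph_int.
have rs_root z : (z \in rs) = root (map_poly fC P) z by rewrite PE root_prod_XsubC.
have beta_rs : (beta%:C)%C \in rs.
  by rewrite rs_root /root realE (rootP Px).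
have conj z : z \in rs -> rat_conjugate (beta%:C)%C z.
  move=> zrs; exists (map_poly intr P).
  by split; rewrite ?monic_map// ratE -rs_root.
exists (size (rem (beta%:C)%C rs)) => n Q sQ cQ Qb0.
(* A zero of [Q] at one root would make the irreducible [P] divide [Q], and [Q] would vanish at
   [beta] too. *)
have QN0 z : z \in rs -> (map_poly fC Q).[z] != 0.
  move=> zrs; apply: contra_neq Qb0 => Qz.
  have := irreducible_poly_coprime (map_poly intr Q) Pirr.
  have [PQ _|_ /= cPQ] := boolP (map_poly intr P %| map_poly intr Q).
    move: PQ; rewrite -(dvdp_map (ratr : {rmorphism rat -> R[i]})) !ratE => PQ.
    have /rootP : root (map_poly fC Q) (beta%:C)%C.
      by rewrite -dvdp_XsubCl (dvdp_trans _ PQ)// dvdp_XsubCl -rs_root.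
    by rewrite realE => /complexI.
  have : coprimep (map_poly fC P) (map_poly fC Q).
    by rewrite -!ratE coprimep_map.
  by move/coprimep_root => /(_ z); rewrite -rs_root zrs Qz eqxx => /(_ isT).
have normR (x : R) : `|(x%:C)%C| = (`|x|%:C)%C.
  by rewrite normc_def /= expr0n /= addr0 sqrtr_sqr.
have Q0 : Q != 0 by apply: contraNneq Qb0 => ->; rewrite rmorph0 horner0.
have n_gt0 : (0 < n)%N by rewrite (leq_trans _ sQ) // size_poly_gt0.
have n_ge1 : 1 <= n%:R :> R by rewrite ler1n.
(* The roots are not shown to be simple, so [beta] may occur again in [rem]. Once its value is at
   most 1, the bound [n] holds for such a copy as well. *)
have [Qb_ge1|/ltW Qb_le1] := leP 1 `|(map_poly intr Q).[beta]|.
  by rewrite (le_trans Qb_ge1)// ler_peMr// exprn_ege1.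
have Qle z : z \in rs -> `|(map_poly fC Q).[z]| <= n%:R.
  move=> zrs; have [->|zb] := eqVneq z (beta%:C)%C.
    rewrite realE normR -[n%:R](rmorph_nat (real_complex R)) lecR.
    exact: le_trans Qb_le1 n_ge1.
  have z_le1 := conj_le1 z (conj z zrs) zb.
  rewrite (@horner_coef_wide _ n) ?(leq_trans (size_poly _ _))//.
  rewrite (le_trans (ler_norm_sum _ _ _))//.
  have -> : n%:R = \sum_(i < n) 1 :> R[i] by rewrite sumr_const card_ord.
  rewrite ler_sum// => i _.
  rewrite normrM normrX coef_map /= mulr_ile1 ?exprn_ile1 ?exprn_ge0//.
  by rewrite -intr_norm lerz1.
have sP : (1 < size P)%N.
  by case: Pirr; rewrite size_map_inj_poly//; exact: intr_inj.
have [m mE] := prod_root_int Q Pm sP PE.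
have m0 : m != 0.
  rewrite -(intr_eq0 R[i]) -mE prodf_seq_neq0; apply/allP => z zrs.
  by rewrite QN0.
have : (1 : R[i]) <= `|m%:~R| by rewrite -intr_norm ler1z -gtz0_ge1 normr_gt0.
rewrite -mE normr_prod (perm_big _ (perm_to_rem beta_rs)) big_cons /=.
rewrite realE normR => h1; rewrite -lecR rmorphM rmorphXn rmorph_nat /=.
apply: (le_trans h1); rewrite ler_wpM2l ?ler0c//.
have -> : n%:R ^+ size (rem (beta%:C)%C rs) = \prod_(z <- rem (beta%:C)%C rs) n%:R :> R[i].
  by rewrite big_const_seq count_predT iter_mulr_1.
rewrite big_seq [leLHS]big_seq ler_prod// => z /mem_rem zrs.
by rewrite normr_ge0 Qle.
Qed.

(** Each cell of length [e], counted from [a], holds at most one point. *)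
Lemma size_separated_le (R : realType) (s : seq R) (a b e : R) :
  uniq s -> 0 < e -> {in s &, forall x y, x != y -> e <= `|x - y|} ->
  {in s, forall x, a <= x <= b} -> a <= b ->
  (size s)%:R <= (b - a) / e + 1.
Proof.
move=> us e0 sep sab ab.
pose f x := Num.truncn ((x - a) / e).
have f_inj : {in s &, injective f}.
  move=> x y xs ys fxy; apply/eqP; apply: contraT => xy.
  suff: `|x - y| < e by rewrite ltNge sep.
  have /andP[ax xb] := sab _ xs; have /andP[ay yb] := sab _ ys.
  have hx : 0 <= (x - a) / e by rewrite divr_ge0 ?subr_ge0// ltW.
  have hy : 0 <= (y - a) / e by rewrite divr_ge0 ?subr_ge0// ltW.
  have /andP[x1 x2] := truncn_itv hx; have /andP[y1 y2] := truncn_itv hy.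
  rewrite -/(f x) -/(f y) fxy in x1 x2 y1 y2.
  rewrite ler_pdivlMr // in x1; rewrite ler_pdivlMr// in y1.
  rewrite ltr_pdivrMr // in x2; rewrite ltr_pdivrMr// in y2.
  rewrite -natr1 mulrDl mul1r in x2 y2.
  by rewrite ltr_norml; apply/andP; split; lra.
set N := Num.truncn ((b - a) / e).
have : (size s <= N.+1)%N.
  rewrite -(size_map f) -(size_iota 0 N.+1); apply: uniq_leq_size.
    by rewrite map_inj_in_uniq.
  move=> _ /mapP[x xs ->]; rewrite mem_iota /= add0n ltnS le_truncn//.
  by have /andP[_ xb] := sab _ xs; rewrite ler_pM2r ?invr_gt0// lerB.
have hN : N%:R <= (b - a) / e by rewrite truncn_le divr_ge0 ?subr_ge0// ltW.
move=> hs; apply: le_trans (_ : N.+1%:R <= _); first by rewrite ler_nat.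
by rewrite -natr1 lerD2r.
Qed.

Section BernoulliPoints.
Context (R : realType) (lam : R).
Hypotheses (lam_gt0 : 0 < lam) (lam_lt1 : lam < 1).
Let L : R := (1 - lam)^-1.

Fixpoint bpts n : seq R :=
  if n is m.+1 then
    undup ([seq x + lam ^+ m | x <- bpts m] ++ [seq x - lam ^+ m | x <- bpts m])
  else [:: 0].

Fixpoint bmass n (x : R) : R :=
  if n is m.+1 then (bmass m (x - lam ^+ m) + bmass m (x + lam ^+ m)) / 2
  else (x == 0)%:R.

Lemma bpts_uniq n : uniq (bpts n).
Proof. by case: n => [|n] //=; rewrite undup_uniq. Qed.

Lemma mem_bptsS n d :
  (d \in bpts n.+1) = (d - lam ^+ n \in bpts n) || (d + lam ^+ n \in bpts n).
Proof.
rewrite /= mem_undup mem_cat; congr (_ || _).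
- by rewrite -{1}(subrK (lam ^+ n) d) (mem_map (addIr _)).
- by rewrite -{1}(addrK (lam ^+ n) d) (mem_map (addIr _)).
Qed.

Lemma bmass_ge0 n x : 0 <= bmass n x.
Proof.
elim: n x => [|n IH] x /=; first exact: ler0n.
by rewrite divr_ge0// addr_ge0.
Qed.

Lemma bmass_notin n x : x \notin bpts n -> bmass n x = 0.
Proof.
elim: n x => [|n IH] x; first by rewrite inE /= => /negPf ->.
by rewrite mem_bptsS negb_or => /andP[/IH h1 /IH h2] /=; rewrite h1 h2 addr0 mul0r.
Qed.

Lemma bmass_ge n x : x \in bpts n -> 2^-1 ^+ n <= bmass n x.
Proof.
elim: n x => [|n IH] x; first by rewrite inE /= => /eqP ->; rewrite eqxx.
rewrite mem_bptsS /= exprS mulrC => /orP[] /IH h; rewrite ler_pM2r//.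
- by rewrite -[leLHS]addr0 lerD// bmass_ge0.
- by rewrite -[leLHS]add0r lerD// bmass_ge0.
Qed.

Lemma bmass_gt0 n x : (0 < bmass n x) = (x \in bpts n).
Proof.
have [h|/bmass_notin ->] := boolP (x \in bpts n); last by rewrite ltxx.
by rewrite (lt_le_trans _ (bmass_ge h))// exprn_gt0.
Qed.

Lemma bmass_le1 n x : bmass n x <= 1.
Proof.
elim: n x => [|n IH] x /=; first by rewrite lern1 leq_b1.
by rewrite ler_pdivrMr// mul1r (_ : 2 = 1 + 1)// lerD.
Qed.

(** Only an inequality, since a point of level [n + m] may split as [c + lam ^+ n * d] in several
    ways. *)
Lemma bmass_mul n m c d :
  bmass n c * bmass m d <= bmass (n + m) (c + lam ^+ n * d).
Proof.
elim: m d => [|m IH] d.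
  rewrite addn0 /=; have [->|_] := eqVneq d 0; first by rewrite mulr0 addr0 mulr1.
  by rewrite mulr0 bmass_ge0.
rewrite addnS /= mulrA ler_pM2r// mulrDr.
have E s : c + lam ^+ n * d + s * lam ^+ (n + m) = c + lam ^+ n * (d + s * lam ^+ m).
  by rewrite exprD; ring.
have := E (-1); have := E 1; rewrite !mulN1r !mul1r => -> ->.
exact: lerD.
Qed.

Lemma bpts_add n m c d : c \in bpts n -> d \in bpts m ->
  c + lam ^+ n * d \in bpts (n + m).
Proof.
rewrite -!bmass_gt0 => c0 d0.
by rewrite (lt_le_trans _ (bmass_mul _ _ _ _))// mulr_gt0.
Qed.

Lemma bpts_norm n d : d \in bpts n -> `|d| <= L * (1 - lam ^+ n).
Proof.
have LE m : L * (1 - lam ^+ m.+1) = L * (1 - lam ^+ m) + lam ^+ m.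
  by rewrite /L exprS; field; rewrite subr_eq0 gt_eqF.
elim: n d => [|n IH] d; first by rewrite inE => /eqP ->; rewrite expr0 subrr mulr0 normr0.
have l0 : 0 < lam ^+ n by rewrite exprn_gt0.
rewrite mem_bptsS LE => /orP[]/IH; rewrite !ler_norml => /andP[h1 h2];
  apply/andP; split; lra.
Qed.

Lemma bpts_normL n d : d \in bpts n -> `|d| <= L.
Proof.
move=> /bpts_norm /le_trans; apply.
rewrite ler_piMr ?invr_ge0 ?subr_ge0 ?ltW//.
by rewrite gtrBl exprn_gt0.
Qed.

(** Each sign is written as [2 * e - 1] with a digit [e] in {0, 1}, and the digits are read
    backwards as a polynomial in [lam^-1]. The shift by the geometric sum is common to all points,
    so a difference of two points is [2 * lam ^+ n * lam^-1] times a polynomial with coefficients in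
    {-1, 0, 1}, as [salem_garsia] requires. *)
Lemma bpts_poly n d : d \in bpts n -> exists Q : {poly int},
  [/\ (size Q <= n)%N, forall i, Q`_i = 0 \/ Q`_i = 1
   & d = 2 * lam ^+ n * lam^-1 * (map_poly intr Q).[lam^-1] - \sum_(i < n) lam ^+ i].
Proof.
have lN0 : lam != 0 by rewrite gt_eqF.
elim: n d => [|n IH] d.
  rewrite inE => /eqP ->; exists 0; rewrite size_poly0; split => //.
    by move=> i; rewrite coef0; left.
  by rewrite rmorph0 horner0 mulr0 big_ord0 subr0.
rewrite mem_bptsS => /orP[]/IH[Q [sQ cQ dE]].
  exists (Q * 'X + 1%:P); split.
  - by rewrite size_MXaddC; case: ifP => // _; rewrite ltnS.
  - by move=> [|i]; rewrite coefD coefMX coefC /= ?add0r ?addr0; [right|exact: cQ].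
  - rewrite rmorphD rmorphM /= map_polyX map_polyC /= !hornerE big_ord_recr /=.
    move/eqP: dE; rewrite subr_eq => /eqP ->; rewrite exprS; field.
    exact: lN0.
exists (Q * 'X + 0%:P); split.
- by rewrite size_MXaddC; case: ifP => // _; rewrite ltnS.
- by move=> [|i]; rewrite coefD coefMX coefC /= ?add0r ?addr0; [left|exact: cQ].
- rewrite rmorphD rmorphM /= map_polyX map_polyC /= !hornerE big_ord_recr /=.
  rewrite -[LHS](addrK (lam ^+ n)) dE exprS; field.
  exact: lN0.
Qed.

Lemma bpts_separated : salem_number lam^-1 -> exists D, forall n c d,
  c \in bpts n -> d \in bpts n -> c != d -> lam ^+ n <= `|c - d| * n%:R ^+ D.
Proof.
move=> /salem_garsia[D HD]; exists D => n c d.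
move=> /bpts_poly[P [sP cP ->]] /bpts_poly[Q [sQ cQ ->]] cd.
have sPQ : (size (P - Q)%R <= n)%N.
  by rewrite (leq_trans (size_polyD _ _))// geq_max sP size_polyN sQ.
have cPQ i : `|(P - Q)`_i| <= 1.
  by rewrite coefB; case: (cP i) => ->; case: (cQ i) => ->.
have E : (map_poly intr P).[lam^-1] - (map_poly intr Q).[lam^-1] =
   (map_poly intr (P - Q)).[lam^-1] :> R by rewrite rmorphB /= !hornerE.
have PQ0 : (map_poly intr (P - Q)).[lam^-1] != 0 :> R.
  by rewrite -E subr_eq0; apply: contra_neq cd => ->.
have := HD n _ sPQ cPQ PQ0; rewrite -E.
have AE (a p q t : R) : a * p - t - (a * q - t) = a * (p - q) by ring.
rewrite AE normrM => h; rewrite -[leRHS]mulrA.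
have l0 : 0 < lam ^+ n by rewrite exprn_gt0.
have lV : 1 <= lam^-1 by rewrite invf_ge1 ?ltW.
apply: le_trans (ler_wpM2l (normr_ge0 _) h).
have a0 : 0 <= 2 * lam ^+ n / lam by rewrite !mulr_ge0 ?invr_ge0// ltW.
rewrite mulr1 (ger0_norm a0).
rewrite mulrAC; apply: ler_peMl; first exact: ltW.
by rewrite mulr_ege1// ler1n.
Qed.

(** The form in which the Salem property enters all later estimates. With [n.+1] in place of [n] the
    factor is at least 1 even at level 0. *)
Definition bounded_overlap (D : nat) := forall C, 0 <= C -> forall n x,
  (count (fun d => `|d - x| <= C * lam ^+ n) (bpts n))%:R
     <= (2 * C + 1) * n.+1%:R ^+ D :> R.

Lemma bpts_window : salem_number lam^-1 -> exists D, bounded_overlap D.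
Proof.
move=> /bpts_separated[D HD]; exists D => C C0 n x.
have l0 : 0 < lam ^+ n by rewrite exprn_gt0.
have n0 : 0 < (n.+1%:R : R) ^+ D by rewrite exprn_gt0// ltr0n.
rewrite -size_filter; set s := (X in size X).
have ss : {subset s <= bpts n} by move=> d; rewrite mem_filter => /andP[].
apply: le_trans (@size_separated_le _ s (x - C * lam ^+ n) (x + C * lam ^+ n)
   (lam ^+ n / n.+1%:R ^+ D) _ _ _ _ _) _.
- by rewrite filter_uniq// bpts_uniq.
- by rewrite divr_gt0.
- move=> c d /ss cs /ss ds cd; rewrite ler_pdivrMr//.
  rewrite (le_trans (HD n _ _ cs ds cd))// ler_wpM2l// lerXn2r ?nnegrE ?ler0n//.
  by rewrite ler_nat.
- by move=> d; rewrite mem_filter ler_distl => /andP[].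
- by have := mulr_ge0 C0 (ltW l0); lra.
- rewrite (_ : _ / _ = 2 * C * n.+1%:R ^+ D); last first.
    by field; rewrite !gt_eqF.
  by rewrite [leRHS]mulrDl mul1r lerD2l exprn_ege1// ler1n.
Qed.

End BernoulliPoints.

(** * The law of the partial sums and the measure of balls *)

Section BernoulliMeasure.
Context (R : realType) (lam : R).
Hypotheses (lam_gt0 : 0 < lam) (lam_lt1 : lam < 1).
Let L : R := (1 - lam)^-1.

Section Sample.
Context (d : measure_display) (T : measurableType d) (P : probability T R)
  (eps : nat -> {RV P >-> R}).
Hypotheses (eps_ind : mutually_independent eps) (eps_fair : forall n, fair_sign (eps n)).

Let X n (w : T) : R := series (fun k => eps k w * lam ^+ k) n.
Let Y (w : T) : R := limn (series (fun k => eps k w * lam ^+ k)).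

Lemma psumS n w : X n.+1 w = X n w + eps n w * lam ^+ n.
Proof. by rewrite /X /series /= big_nat_recr. Qed.

Lemma norm_sign n w : `|eps n w| = 1.
Proof. by have [+ _ _] := eps_fair n => /(_ w)[] ->; rewrite ?normrN normr1. Qed.

Lemma psum_bpts n w : X n w \in bpts lam n.
Proof.
elim: n => [|n IH]; first by rewrite inE /X /series /= big_geq.
rewrite mem_bptsS psumS; have [+ _ _] := eps_fair n => /(_ w)[] ->.
- by rewrite mulN1r subrK IH orbT.
- by rewrite mul1r addrK IH.
Qed.

Lemma measurable_psum n : measurable_fun setT (X n).
Proof.
elim: n => [|n IH].
  rewrite (_ : X 0 = cst 0); first exact: measurable_cst.
  by apply/funext => w; rewrite /X /series /= big_geq.
rewrite (_ : X n.+1 = X n \+ (eps n \* cst (lam ^+ n))).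
  by apply: measurable_funD => //; apply: measurable_funM.
by apply/funext => w; rewrite psumS.
Qed.

Lemma measurable_psum_eq n x : measurable [set w | X n w = x].
Proof.
have := @measurable_psum n measurableT _ (measurable_set1 x).
by rewrite setTI.
Qed.

Lemma psum_cvg w : X ^~ w @ \oo --> Y w.
Proof.
suff : cvgn (series (fun k => eps k w * lam ^+ k)) by [].
apply: normed_cvg.
rewrite (_ : [normed _] = series (geometric 1 lam)).
  by apply: is_cvg_geometric_series; rewrite gtr0_norm.
apply/funext => n; rewrite /series /=; apply: eq_bigr => k _.
by rewrite normrM norm_sign !mul1r normrX gtr0_norm.
Qed.

Lemma measurable_sum : measurable_fun setT Y.
Proof.
apply: (@measurable_fun_cvg _ _ _ _ X) => [|w _]; first exact: measurable_psum.
exact: psum_cvg.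
Qed.

Lemma psum_near n m w : `|X (n + m) w - X n w| <= L * lam ^+ n.
Proof.
have -> : X (n + m) w - X n w = lam ^+ n * series (fun k => eps (n + k) w * lam ^+ k) m.
  elim: m => [|m IH]; first by rewrite addn0 subrr /series /= big_geq ?mulr0.
  rewrite addnS psumS addrAC IH /series /= big_nat_recr//= mulrDr exprD; ring.
rewrite normrM gtr0_norm ?exprn_gt0// mulrC ler_pM2r ?exprn_gt0//.
apply: le_trans (ler_norm_sum _ _ _) _.
apply: le_trans (_ : series (geometric 1 lam) m <= _).
  rewrite /series /= ler_sum// => k _.
  by rewrite normrM norm_sign !mul1r normrX gtr0_norm.
by have := @geometric_le_lim R m 1 lam ler01 lam_gt0; rewrite mul1r gtr0_norm//; exact.
Qed.

Lemma sum_near n w : `|Y w - X n w| <= L * lam ^+ n.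
Proof.
have c : (fun m => `|X m w - X n w|) @ \oo --> `|Y w - X n w|.
  by apply: cvg_norm; apply: cvgB; [exact: psum_cvg|exact: cvg_cst].
apply: (cvgr_to_le c); near=> m.
rewrite -(@subnKC n m); first exact: psum_near.
by near: m; exact: nbhs_infty_ge.
Unshelve. all: by end_near. Qed.

(** Events on the later signs are carried along for the sake of the induction: the step conditions
    on sign [n], which then joins the family [J] as a singleton event, and independence is used only
    at level 0. The law itself is the case of empty [J]. *)
Lemma psum_joint_law n x (J : {fset nat}) (A : nat -> set R) :
  (forall k, k \in J -> (n <= k)%N) -> (forall k, k \in J -> measurable (A k)) ->
  P ([set w | X n w = x] `&` \bigcap_(k in [set` J]) eps k @^-1` A k) =
  ((bmass lam n x)%:E * \prod_(k <- J) P (eps k @^-1` A k))%E.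
Proof.
elim: n x J A => [|n IH] x J A nJ mA.
  have X0 w : X 0 w = 0 by rewrite /X /series /= big_geq.
  have [->|x0] := eqVneq x 0.
    rewrite /= eqxx mul1e -eps_ind//; congr (P _).
    by apply/seteqP; split => w /=; [case|split].
  rewrite /= (negPf x0) mul0e (_ : _ `&` _ = set0) ?measure0//.
  by rewrite -subset0 => w [/= + _]; rewrite X0 => /esym/eqP; rewrite (negPf x0).
have nJn : n \notin J by apply/negP => /nJ; rewrite ltnn.
pose B s k := if k == n then [set s] : set R else A k.
have mB s k : k \in (n |` J)%fset -> measurable (B s k).
  by rewrite !inE /B; case: (k == n) => [_|/mA]; first exact: measurable_set1.
have nB k : k \in (n |` J)%fset -> (n <= k)%N.
  by rewrite !inE => /orP[/eqP->//|/nJ/ltnW].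
pose E s := [set w | X n w = x - s * lam ^+ n] `&`
   \bigcap_(k in [set` (n |` J)%fset]) eps k @^-1` B s k.
have PE s : P (eps n @^-1` [set s]) = (2^-1)%:E ->
    P (E s) = ((bmass lam n (x - s * lam ^+ n) / 2)%:E * \prod_(k <- J) P (eps k @^-1` A k))%E.
  move=> h; rewrite /E (IH _ _ _ nB (mB s)) big_fsetU1//= {1}/B eqxx h muleA -EFinM; congr (_ * _)%E.
  rewrite big_seq [RHS]big_seq; apply: eq_bigr => k kJ; rewrite /B; case: eqP => // kn.
  by rewrite kn (negPf nJn) in kJ.
have mE s : measurable (E s).
  apply: measurableI.
    exact: measurable_psum_eq.
  apply: fin_bigcap_measurable => // k kJ.
  rewrite -[X in measurable X]setTI; apply: (measurable_funPT (eps k)) => //.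
  exact: mB.
have EE : [set w | X n.+1 w = x] `&` \bigcap_(k in [set` J]) eps k @^-1` A k =
   E 1 `|` E (-1).
  apply/seteqP; split => w.
    move=> [/= Xw Aw].
    have e : X n w = x - eps n w * lam ^+ n by rewrite -Xw psumS addrK.
    have [+ _ _] := eps_fair n => /(_ w)[] ew; [right|left]; split; rewrite /= -?ew//;
      move=> k /=; rewrite !inE /B; case: eqP => [->//=|_ /= kJ]; exact: Aw.
  by move=> []; move=> [/= Xw Bw]; (have := Bw n; rewrite /B eqxx /= !inE eqxx => /(_ isT) en;
    split; [rewrite /= psumS en Xw subrK|move=> k /= kJ; have := Bw k; rewrite /= !inE kJ orbT /B;
      case: eqP => [kn|_ /(_ isT)//]; rewrite kn (negPf nJn) in kJ]).
rewrite EE.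
have -> : P (E 1 `|` E (-1)) = (P (E 1%R) + P (E (-1)%R))%E.
  rewrite measureU//.
  rewrite -subset0 => w [[_ /(_ n) h1] [_ /(_ n) h2]].
  move: h1 h2; rewrite /B /= eqxx !inE eqxx => /(_ isT) -> /(_ isT) /= h; have : (1 : R) = -1 by []; lra.
have [_ eN e1] := eps_fair n.
rewrite !PE// mul1r mulN1r opprK -ge0_muleDl ?lee_fin ?divr_ge0 ?bmass_ge0//.
by rewrite -EFinD /= -mulrDl.
Qed.

Lemma psum_law n x : P [set w | X n w = x] = (bmass lam n x)%:E.
Proof.
have := @psum_joint_law n x fset0 (fun=> setT); rewrite big_seq_fset0 mule1 => <- //.
congr (P _); apply/seteqP; split => w //=; last by case.
Qed.

(** The signs from index [n] on move the sum by at most [L * lam ^+ n], so the whole event that the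
    partial sum equals [y] ends up in the ball. *)
Lemma bmass_le_preimage n x r y : 0 < r -> `|x - y| + L * lam ^+ n <= r ->
  ((bmass lam n y)%:E <= P (Y @^-1` closed_ball x r))%E.
Proof.
move=> r0 xy; rewrite -psum_law; apply: le_measure; rewrite ?inE.
- exact: measurable_psum_eq.
- by rewrite -[X in measurable X]setTI; apply: measurable_sum => //; exact: measurable_closed_ball.
- move=> w /= Xw; rewrite closed_ballE// /closed_ball_ /=.
  apply: le_trans xy; rewrite -Xw.
  rewrite (_ : x - Y w = (x - X n w) - (Y w - X n w)); last by ring.
  by rewrite (le_trans (ler_normB _ _))// lerD2l sum_near.
Qed.

Lemma preimage_le_bmass n x r : 0 < r -> (P (Y @^-1` closed_ball x r) <=
  (\sum_(y <- bpts lam n | `|y - x| <= r + L * lam ^+ n) bmass lam n y)%:E)%E.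
Proof.
move=> r0; rewrite -sumEFin -big_filter.
have mX y : measurable [set w | X n w = y].
  exact: measurable_psum_eq.
have mXs (s : seq R) : measurable [set w | X n w \in s].
  elim: s => [|y s IH]; first by rewrite (_ : mkset _ = set0)// -subset0.
  have -> : [set w | X n w \in y :: s] = [set w | X n w = y] `|` [set w | X n w \in s].
    by apply/seteqP; split=> w /=; rewrite inE => /predU1P//; case; auto.
  exact: measurableU.
have subadd (s : seq R) : (P [set w | X n w \in s] <= \sum_(y <- s) (bmass lam n y)%:E)%E.
  elim: s => [|y s IH].
    by rewrite big_nil (_ : mkset _ = set0) ?measure0// -subset0.
  rewrite big_cons -psum_law.
  have -> : [set w | X n w \in y :: s] = [set w | X n w = y] `|` [set w | X n w \in s].
    by apply/seteqP; split=> w /=; rewrite inE => /predU1P//; case; auto.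
  by rewrite (le_trans (measureU2 _ _ _))// leeD2l.
apply: le_trans (subadd _); apply: le_measure; rewrite ?inE.
- by rewrite -[X in measurable X]setTI; apply: measurable_sum => //; exact: measurable_closed_ball.
- exact: mXs.
- move=> w /=; rewrite closed_ballE// /closed_ball_ /= => xY.
  rewrite mem_filter psum_bpts andbT.
  rewrite (_ : X n w - x = (Y w - x) - (Y w - X n w)); last by ring.
  by rewrite (le_trans (ler_normB _ _))// lerD ?sum_near// distrC.
Qed.
End Sample.

Variable nu : probability (measurableTypeR R) R.
Hypothesis nuE : bernoulli_convolution lam nu.

Lemma bmass_le_ball n x r y : 0 < r -> `|x - y| + L * lam ^+ n <= r ->
  ((bmass lam n y)%:E <= nu (closed_ball x r))%E.
Proof.
have [d [T [P [eps [ind fair nuP]]]]] := nuE => r0 xy.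
rewrite nuP; first exact: bmass_le_preimage ind fair _ _ _ _ r0 xy.
exact: measurable_closed_ball.
Qed.

Lemma ball_le_bmass n x r : 0 < r -> (nu (closed_ball x r) <=
  (\sum_(y <- bpts lam n | `|y - x| <= r + L * lam ^+ n) bmass lam n y)%:E)%E.
Proof.
have [d [T [P [eps [ind fair nuP]]]]] := nuE => r0.
rewrite nuP; first exact: preimage_le_bmass ind fair _ _ _ r0.
exact: measurable_closed_ball.
Qed.

End BernoulliMeasure.

(** * Counting the points of large mass *)

Lemma count_sum_mem (T : eqType) (s u : seq T) (P : pred T) :
  uniq u -> {subset s <= u} -> count P s = (\sum_(x <- u | P x) count_mem x s)%N.
Proof.
move=> uu; elim: s => [|a s IH] su.
  by rewrite /= big1.
rewrite /= IH => [|x xs]; last by rewrite su// inE xs orbT.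
rewrite big_split /=; congr (_ + _)%N.
rewrite -big_mkcondr /= sum1_count.
rewrite (eq_count (a2 := fun x => (x == a) && P a)); last first.
  by move=> x /=; rewrite eq_sym andbC; case: eqP => // ->.
have [Pa|_] := boolP (P a); last by rewrite (eq_count (a2 := pred0)) ?count_pred0// => x; rewrite andbF.
rewrite (eq_count (a2 := pred1 a)); last by move=> x /=; rewrite andbT.
by rewrite count_uniq_mem// su// mem_head.
Qed.

Lemma size_sum_mem (T : eqType) (s u : seq T) :
  uniq u -> {subset s <= u} -> size s = (\sum_(x <- u) count_mem x s)%N.
Proof. by move=> uu su; rewrite -count_predT (count_sum_mem _ uu su). Qed.

Lemma count_allpairs (S T U : eqType) (f : S -> T -> U) (s : seq S) (t : seq T) z :
  count_mem z [seq f x y | x <- s, y <- t] =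
    (\sum_(x <- s) count (fun y => f x y == z) t)%N.
Proof.
elim: s => [|x s IH]; first by rewrite big_nil.
by rewrite big_cons /= count_cat IH count_map.
Qed.

(** The exponential is a power of order [D.+1] of something at least [b * n.+1]; the one factor
    [n.+1] in excess of [D] absorbs every constant. *)
Lemma pow_le_expR (R : realType) (K : R) D (e : R) : 0 < e ->
  \forall n \near \oo, K * n.+1%:R ^+ D <= expR (n%:R * e).
Proof.
move=> e0.
set b := Num.min 1 (e / D.+1%:R).
have b0 : 0 < b by rewrite lt_min ltr01 divr_gt0// ltr0Sn.
near=> n.
have n1 : 0 < (n.+1)%:R :> R by rewrite ltr0Sn.
have h : b * n.+1%:R <= expR (n%:R * e / D.+1%:R).
  rewrite (le_trans _ (expR_ge1Dx _))// -natr1 mulrDr mulr1 addrC lerD//.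
    by rewrite ge_min lexx.
  by rewrite -mulrA mulrC ler_wpM2l// ge_min lexx orbT.
have -> : expR (n%:R * e) = expR (n%:R * e / D.+1%:R) ^+ D.+1.
  by rewrite -expRM_natl [X in _ = expR X]mulrC divfK.
apply: le_trans (_ : (b * n.+1%:R) ^+ D.+1 <= _).
  rewrite exprMn [n.+1%:R ^+ D.+1]exprS mulrA ler_pM2r ?exprn_gt0//.
  rewrite mulrC.
  have : K / b ^+ D.+1 <= n%:R by near: n; exact: nbhs_infty_ger.
  rewrite ler_pdivrMr ?exprn_gt0// => /le_trans; apply.
  by rewrite ler_pM2r ?exprn_gt0// ler_nat.
by rewrite lerXn2r ?nnegrE ?mulr_ge0 ?expR_ge0// ltW.
Unshelve. all: by end_near. Qed.

Section Counting.
Context (R : realType) (lam : R).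
Hypotheses (lam_gt0 : 0 < lam) (lam_lt1 : lam < 1).
Let L : R := (1 - lam)^-1.
Variable D : nat.
Hypothesis window : bounded_overlap lam D.

Let W n : R := (2 * L + 1) * n.+1%:R ^+ D.

Let L_gt0 : 0 < L. Proof. by rewrite invr_gt0 subr_gt0. Qed.

Let W_ge1 n : 1 <= W n.
Proof.
rewrite /W mulr_ege1 ?exprn_ege1 ?ler1n//.
by have := L_gt0; lra.
Qed.

Definition heavy n th := [seq d <- bpts lam n | th <= bmass lam n d].

Lemma heavy_uniq n th : uniq (heavy n th).
Proof. by rewrite filter_uniq// bpts_uniq. Qed.

Lemma heavy_sub n th : {subset heavy n th <= bpts lam n}.
Proof. by move=> d; rewrite mem_filter => /andP[]. Qed.

(** If [c + lam ^+ n * c' = d], then [c] is within [L * lam ^+ n] of [d], and it determines [c'].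
    The fiber thus injects into a window of level [n]. *)
Lemma heavy_fiber n m (s t : seq R) d :
  {subset s <= bpts lam n} -> uniq s -> {subset t <= bpts lam m} -> uniq t ->
  (count_mem d [seq c + lam ^+ n * c' | c <- s, c' <- t])%:R <= W n.
Proof.
move=> sn us tm ut; have l0 : 0 < lam ^+ n by rewrite exprn_gt0.
rewrite count_allpairs.
apply: le_trans (window (ltW L_gt0) n d); rewrite ler_nat.
apply: (@leq_trans (\sum_(c <- s) (`|c - d| <= L * lam ^+ n)%R)).
  rewrite big_seq [leqRHS]big_seq; apply: leq_sum => c cs.
  have [/hasP[c' c't /eqP cd]|hN] := boolP (has (fun y => c + lam ^+ n * y == d) t).
    rewrite (eq_count (a2 := pred1 c')) => [|y /=]; last first.
      by rewrite -cd (inj_eq (addrI _)) (inj_eq (mulfI (lt0r_neq0 l0))).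
    rewrite count_uniq_mem// c't lt0b -cd opprD addNKr normrN normrM gtr0_norm//.
    by rewrite mulrC ler_pM2r// (bpts_normL lam_gt0 lam_lt1 (tm _ c't)).
  by move: hN; rewrite has_count -leqNgt leqn0 => /eqP ->.
rewrite -big_mkcond sum1_count -!size_filter; apply: uniq_leq_size.
  by rewrite filter_uniq.
by move=> c; rewrite !mem_filter => /andP[-> /sn ->].
Qed.

(** Concatenation at least multiplies the masses and, by [heavy_fiber], is at most [W n] to one. *)
Lemma heavy_mul n m th th' : 0 <= th -> 0 <= th' ->
  (size (heavy n th))%:R * (size (heavy m th'))%:R <=
    W n * (size (heavy (n + m) (th * th')))%:R.
Proof.
move=> th0 th'0; set u := heavy (n + m) _.
rewrite -natrM -(size_allpairs (fun c c' => c + lam ^+ n * c')).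
rewrite (size_sum_mem (u := u)) ?heavy_uniq//.
  rewrite natr_sum; apply: le_trans (_ : \sum_(x <- u) W n <= _).
    rewrite ler_sum// => d _; apply: heavy_fiber; do ?[exact: heavy_sub|exact: heavy_uniq].
  by rewrite big_const_seq count_predT iter_addr_0 mulr_natr.
move=> _ /allpairsP[[c c'] /= [+ + ->]]; rewrite !mem_filter => /andP[h cn] /andP[h' cm].
rewrite (bpts_add cn cm) andbT (le_trans _ (bmass_mul _ _ _ _ _))//.
exact: ler_pM.
Qed.

Lemma heavy_le n th th' : th <= th' -> (size (heavy n th') <= size (heavy n th))%N.
Proof.
move=> tt'; apply: uniq_leq_size; first exact: heavy_uniq.
by move=> d; rewrite !mem_filter => /andP[/(le_trans tt') -> ->].
Qed.

Lemma bpts_sum_mem n : \sum_(i < n) lam ^+ i \in bpts lam n.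
Proof.
elim: n => [|n IH]; first by rewrite big_ord0 inE.
by rewrite mem_bptsS big_ord_recr /= addrK IH.
Qed.

Lemma size_bpts n : (size (bpts lam n) <= 2 ^ n)%N.
Proof.
elim: n => [//|n IH].
by rewrite (leq_trans (size_undup _))// size_cat !size_map expnS mul2n -addnn leq_add.
Qed.

Lemma size_heavy_le n th : (size (heavy n th))%:R <= expR (n%:R * ln 2) :> R.
Proof.
apply: le_trans (_ : 2 ^+ n <= _); last by rewrite expRM_natl lnK ?posrE.
rewrite -natrX ler_nat (leq_trans _ (size_bpts n))//.
by rewrite size_filter count_size.
Qed.

Lemma size_heavy_gt0 n th : th <= 2^-1 ^+ n -> (0 < size (heavy n th))%N.
Proof.
move=> h; rewrite size_filter -has_count; apply/hasP.
exists (\sum_(i < n) lam ^+ i); rewrite ?bpts_sum_mem//.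
by rewrite (le_trans h)// bmass_ge// bpts_sum_mem.
Qed.

(** The growth rate at [a] is the supremum of the [g] with [Phi a g]. A relation is used because the
    rate is minus infinity where no point is heavy enough. *)
Definition Phi (a g : R) := \forall n \near \oo,
  expR (n%:R * g) <= (size (heavy n (expR (- (n%:R * a)))))%:R.

Lemma Phi_le a b g h : Phi a g -> a <= b -> h <= g -> Phi b h.
Proof.
move=> + ab hg; apply: filterS => n H.
apply: le_trans (le_trans H _); first by rewrite ler_expR ler_wpM2l.
by rewrite ler_nat heavy_le// ler_expR lerN2 ler_wpM2l.
Qed.

Lemma Phi_bound a g : Phi a g -> g <= ln 2.
Proof.
move=> H; near \oo => n.
have n0 : 0 < n%:R :> R by near: n; exact: nbhs_infty_gtr.
rewrite -(ler_pM2l n0) -ler_expR (le_trans _ (size_heavy_le n (expR (- (n%:R * a)))))//.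
by near: n.
Unshelve. all: by end_near. Qed.

(** Any rate, even a negative one, forces the list to be nonempty. Its size is then at least 1,
    which is rate 0, and masses are at most 1, so [a] cannot be negative. *)
Lemma Phi_ge0 a g : Phi a g -> 0 <= a /\ Phi a 0.
Proof.
move=> H; split.
  near \oo => n.
  have n0 : 0 < n%:R :> R by near: n; exact: nbhs_infty_gtr.
  have : 0 < (size (heavy n (expR (- (n%:R * a)))))%:R :> R.
    apply: lt_le_trans (expR_gt0 (n%:R * g)) _; near: n; exact: H.
  rewrite ltr0n size_filter -has_count => /hasP[d _ h].
  have := le_trans h (bmass_le1 lam n d).
  by rewrite expR_le1 oppr_le0 pmulr_rge0.
apply: filterS H => n H; rewrite mulr0 expR0 ler1n -(ltr0n R).
exact: lt_le_trans (expR_gt0 _) H.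
Unshelve. all: by end_near. Qed.

(** Blocks of length [n] are repeated [k] times; the remaining [r] letters are arbitrary, and any
    point they give has mass at least [2^-1 ^+ r]. *)
Lemma heavy_pow n r k th : 0 <= th ->
  ((size (heavy n th))%:R / W n) ^+ k <= (size (heavy (k * n + r) (th ^+ k * 2^-1 ^+ r)))%:R.
Proof.
move=> th0; elim: k => [|k IH].
  by rewrite expr0 ler1n mul0n add0n expr0 mul1r size_heavy_gt0.
have W0 : 0 < W n by exact: lt_le_trans ltr01 (W_ge1 n).
rewrite exprS mulrAC ler_pdivrMr// mulrC mulSn -addnA [th ^+ _]exprS -[th * _ * _]mulrA.
rewrite [leRHS]mulrC.
apply: le_trans (heavy_mul _ _ _ _); rewrite ?mulr_ge0 ?exprn_ge0//.
by rewrite mulrC ler_wpM2l.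
Qed.

(** A Fekete argument. One good length [n], taken so large that its window factor is below
    [expR (n%:R * (e / 2))], is repeated and padded, which covers every large length. It turns
    information at infinitely many levels, all that a lower limit such as the spectrum can give,
    into information at all large levels. *)
Lemma Phi_up a g e : 0 < e ->
  (forall N, exists2 n, (N <= n)%N &
     expR (n%:R * g) <= (size (heavy n (expR (- (n%:R * a)))))%:R) ->
  Phi (a + e) (g - e).
Proof.
move=> e0 freq.
have e20 : 0 < e / 2 by rewrite divr_gt0.
have [M _ HM] : \forall n \near \oo, W n <= expR (n%:R * (e / 2)) by exact: pow_le_expR.
have [n nM Hn] := freq (maxn M 1).
have n_gt0 : (0 < n)%N by rewrite (leq_trans _ nM)// leq_max orbT.
have Wn : W n <= expR (n%:R * (e / 2)) by apply: HM; rewrite /= (leq_trans _ nM)// leq_maxl.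
have W0 : 0 < W n by exact: lt_le_trans ltr01 (W_ge1 n).
have a0 : 0 <= a.
  have : 0 < (size (heavy n (expR (- (n%:R * a)))))%:R :> R.
    exact: lt_le_trans (expR_gt0 (n%:R * g)) _.
  rewrite ltr0n size_filter -has_count => /hasP[d _ h].
  have := le_trans h (bmass_le1 lam n d).
  by rewrite expR_le1 oppr_le0 pmulr_rge0// ltr0n.
have Hq : expR (n%:R * (g - e / 2)) <= (size (heavy n (expR (- (n%:R * a)))))%:R / W n.
  rewrite ler_pdivlMr// (le_trans _ Hn)// mulrBr expRD -[leRHS]mulr1 -mulrA ler_wpM2l ?expR_ge0//.
  by rewrite mulrC expRN ler_pdivrMr ?expR_gt0// mul1r.
have e2N : 0 < 2 / e by rewrite divr_gt0.
near=> N.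
set k := (N %/ n)%N; set r := (N %% n)%N.
have NE : N = (k * n + r)%N := divn_eq N n.
have NR : N%:R = k%:R * n%:R + r%:R :> R by rewrite {1}NE natrD natrM.
have rn : r%:R <= n%:R :> R by rewrite ler_nat ltnW// ltn_mod.
have r0 : 0 <= r%:R :> R by [].
apply: le_trans (_ : expR (k%:R * (n%:R * (g - e / 2))) <= _).
  rewrite ler_expR NR.
  have : n%:R * `|g - e / 2| * (2 / e) <= N%:R by near: N; exact: nbhs_infty_ger.
  rewrite -ler_pdivlMr ?divr_gt0// invf_div NR => h.
  have h1 : r%:R * (g - e / 2) <= n%:R * `|g - e / 2|.
    by rewrite (le_trans (ler_wpM2l r0 (ler_norm _)))// ler_wpM2r.
  have re : 0 <= r%:R * (e / 2) by rewrite mulr_ge0// ltW.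
  have -> : (k%:R * n%:R + r%:R) * (g - e) = k%:R * (n%:R * (g - e / 2))
    - ((k%:R * n%:R + r%:R) * (e / 2) - r%:R * (g - e / 2)) by field.
  lra.
rewrite expRM_natl; apply: le_trans (lerXn2r k _ _ Hq) _; rewrite ?nnegrE ?expR_ge0//.
  by rewrite divr_ge0// ltW.
apply: le_trans (heavy_pow n r k (expR_ge0 _)) _; rewrite -NE ler_nat heavy_le//.
rewrite -expRM_natl -[2^-1]lnK ?posrE// -expRM_natl -expRD ler_expR lnV ?posrE//.
have ln2 : 0 < ln 2 :> R by rewrite ln_gt0// ltr1n.
have : n%:R * ln 2 / e <= N%:R by near: N; exact: nbhs_infty_ger.
rewrite ler_pdivrMr// => h.
have : r%:R * ln 2 <= n%:R * ln 2 :> R by rewrite ler_pM2r.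
have : 0 <= r%:R * a by rewrite mulr_ge0.
move: h; rewrite NR !mulrDr !mulrDl !mulrN !mulrA; move: (_ * ln 2) => X.
by move=> *; nra.
Unshelve. all: by end_near. Qed.

(** A word of length about [th * N] for [a] is followed by one of length about [(1 - th) * N] for
    [b]. *)
Lemma Phi_conc a b g h th e : a <= b -> 0 < th < 1 -> 0 < e -> Phi a g -> Phi b h ->
  Phi (th * a + (1 - th) * b) (th * g + (1 - th) * h - e).
Proof.
move=> ab /andP[th0 th1] e0 [M1 _ H1] [M2 _ H2].
have e20 : 0 < e / 2 by rewrite divr_gt0.
have [M _ HM] : \forall n \near \oo, W n <= expR (n%:R * (e / 2)) by exact: pow_le_expR.
have th1' : 0 < 1 - th by rewrite subr_gt0.
near=> N.
have N0 : 0 <= N%:R :> R by [].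
(* Rounding down the share of [b] gives the surplus letter to [a]; since [a <= b], this error in the
   mass has the favourable sign. *)
pose m := Num.truncn ((1 - th) * N%:R).
have /andP[m1 m2] : m%:R <= (1 - th) * N%:R < m.+1%:R.
  by rewrite truncn_itv// mulr_ge0// ltW.
rewrite -natr1 in m2.
have mN : (m <= N)%N.
  by rewrite -(ler_nat R) (le_trans m1)// ler_piMl// gerBl ltW.
pose n := (N - m)%N; have NE : N = (n + m)%N by rewrite subnK.
have NR : N%:R = n%:R + m%:R :> R by rewrite -natrD -NE.
have nM : (maxn M1 M <= n)%N.
  rewrite -(ler_nat R).
  have : (maxn M1 M)%:R / th <= N%:R by near: N; exact: nbhs_infty_ger.
  by rewrite ler_pdivrMr//; lra.
have mM : (M2 <= m)%N.
  rewrite -ltnS -(ltr_nat R) -natr1.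
  have : M2%:R / (1 - th) <= N%:R by near: N; exact: nbhs_infty_ger.
  by rewrite ler_pdivrMr//; lra.
move: nM; rewrite geq_max => /andP[/H1 h1 /HM hM].
have {mM} h2 := H2 _ mM; rewrite /= in h1 h2 hM.
have W0 : 0 < W n by exact: lt_le_trans ltr01 (W_ge1 n).
have := ler_pM (expR_ge0 _) (expR_ge0 _) h1 h2.
move=> /le_trans/(_ (heavy_mul _ _ (expR_ge0 _) (expR_ge0 _))).
rewrite -!expRD -NE => H.
have {}H : expR (n%:R * g + m%:R * h - n%:R * (e / 2)) <=
   (size (heavy N (expR (- (n%:R * a) - m%:R * b))))%:R.
  rewrite expRD expRN ler_pdivrMr ?expR_gt0// (le_trans H)// mulrC.
  by rewrite ler_wpM2l.
apply: le_trans (le_trans H _).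
  rewrite ler_expR.
  have : `|g - h| / (e / 2) <= N%:R by near: N; exact: nbhs_infty_ger.
  rewrite ler_pdivrMr// => hN.
  have := ler_norm (h - g); rewrite distrC => hn.
  have hd : 0 <= n%:R - th * N%:R <= 1 by apply/andP; split; lra.
  have -> : n%:R * g + m%:R * h - n%:R * (e / 2) = N%:R * (th * g + (1 - th) * h)
     + (n%:R - th * N%:R) * (g - h) - n%:R * (e / 2) by rewrite NR; ring.
  have nN : n%:R <= N%:R :> R by rewrite NR lerDl.
  have : - `|g - h| <= (n%:R - th * N%:R) * (g - h).
    case/andP: hd => d0 d1; move: (_ - th * _) d0 d1 => d d0 d1.
    have := ler_norm (- (d * (g - h))); rewrite normrN normrM (ger0_norm d0) => H3.
    have : d * `|g - h| <= `|g - h| by rewrite ler_piMl.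
    lra.
  nra.
rewrite ler_nat heavy_le// ler_expR.
have hd : 0 <= n%:R - th * N%:R by lra.
have -> : - (n%:R * a) - m%:R * b = - (N%:R * (th * a + (1 - th) * b))
     + (n%:R - th * N%:R) * (b - a) by rewrite NR; ring.
by rewrite lerDl mulr_ge0// subr_ge0.
Unshelve. all: by end_near. Qed.

End Counting.

(** * Legendre duality between the moments and the growth rate *)

Section LargeDeviations.
Context (R : realType) (lam : R).
Hypotheses (lam_gt0 : 0 < lam) (lam_lt1 : lam < 1).
Variable D : nat.
Hypothesis window : bounded_overlap lam D.
Local Notation Phi := (Phi lam).
Local Notation heavy := (heavy lam).

Definition pmoment n (q : R) : R := \sum_(d <- bpts lam n) bmass lam n d `^ q.

(** A supporting line of the concave rate at [a]. [F] is the rate there and the slope is the infimum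
    of the slopes of the chords arriving from the left; [a0] provides at least one chord, and
    monotonicity of the rate makes the slopes nonnegative. *)
Lemma Phi_support a0 g0 a : Phi a0 g0 -> a0 < a -> exists F q : R,
  [/\ 0 <= q, forall b g, Phi b g -> g <= F + q * (b - a)
   & forall e, 0 < e -> Phi a (F - e)].
Proof.
move=> P0 a0a.
pose S := [set g | Phi a g].
have Sg0 : S g0 by apply: Phi_le P0 _ _ => //; exact: ltW.
have hS : has_sup S by split; [exists g0|exists (ln 2) => g /Phi_bound].
pose F := sup S.
have leF g : Phi a g -> g <= F by move=> h; apply: sup_upper_bound.
pose Q := [set (F - p.2) / (a - p.1) | p in [set p : R * R | p.1 < a /\ Phi p.1 p.2]].
have Qlb : lbound Q 0.
  move=> _ [[b g] /= [ba Pg] <-]; apply: divr_ge0; rewrite subr_ge0 /=; last exact: ltW.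
  by apply: leF; apply: Phi_le Pg _ _ => //; exact: ltW.
have Q0 : Q !=set0 by exists ((F - g0) / (a - a0)), (a0, g0).
exists F, (inf Q); split.
- exact: lb_le_inf.
- move=> b g Pg; have [ba|ab|ba] := ltgtP b a.
  + have : inf Q <= (F - g) / (a - b).
      by apply: ge_inf; [exists 0|exists (b, g)].
    by rewrite ler_pdivlMr ?subr_gt0//; lra.
  (* To the right of [a], each chord from [b1] to [b] passes over [a], and concavity there compares
     its slope with that of the chord arriving from [b1]. *)
  + rewrite addrC -lerBlDr -ler_pdivrMr ?subr_gt0//; apply: lb_le_inf => // _ [[b1 g1] /= [b1a P1] <-].
    rewrite ler_pdivrMr ?subr_gt0// mulrAC ler_pdivlMr ?subr_gt0//.
    pose th := (b - a) / (b - b1).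
    have bb1 : 0 < b - b1 by lra.
    have thE : 1 - th = (a - b1) / (b - b1) by rewrite /th; field; rewrite gt_eqF.
    have th01 : 0 < th < 1.
      apply/andP; split; first by rewrite divr_gt0// subr_gt0.
      by rewrite /th ltr_pdivrMr// mul1r; lra.
    have aE : th * b1 + (1 - th) * b = a by rewrite thE /th; field; rewrite gt_eqF.
    suff : th * g1 + (1 - th) * g <= F.
      have -> : th * g1 + (1 - th) * g = ((b - a) * g1 + (a - b1) * g) / (b - b1).
        by rewrite thE /th; field; rewrite gt_eqF.
      by rewrite ler_pdivrMr//; lra.
    apply/ler_addgt0Pr => e e0; rewrite -lerBlDr; apply: leF.
    rewrite -aE; apply: (Phi_conc lam_gt0 lam_lt1 window) => //; lra.
  + by rewrite ba subrr mulr0 addr0; apply: leF; rewrite -ba.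
- move=> e e0; have [g Pg /ltW Fg] := sup_adherent e0 hS.
  exact: Phi_le Pg _ _.
Qed.

(** A point of mass [expR (- (n%:R * x))] is charged to the band containing [x]. Masses are at least
    [2^-1 ^+ n], so [x <= ln 2] and [J] bands are enough. *)
Lemma pmoment_bands n q eta J : (0 < n)%N -> 0 < eta -> 0 <= q -> ln 2 < J%:R * eta ->
  pmoment n q <= \sum_(j < J)
    (size (heavy n (expR (- (n%:R * (j.+1%:R * eta))))))%:R *
      expR (- (n%:R * (q * (j%:R * eta)))).
Proof.
move=> n_gt0 eta0 q0 hJ.
have n0 : 0 < n%:R :> R by rewrite ltr0n.
have -> : \sum_(j < J) (size (heavy n (expR (- (n%:R * (j.+1%:R * eta))))))%:R *
      expR (- (n%:R * (q * (j%:R * eta)))) =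
   \sum_(d <- bpts lam n) \sum_(j < J | expR (- (n%:R * (j.+1%:R * eta))) <= bmass lam n d)
      expR (- (n%:R * (q * (j%:R * eta)))).
  under [RHS]eq_bigr do rewrite big_mkcond.
  rewrite exchange_big/=; apply: eq_bigr => j _; rewrite -big_mkcond.
  rewrite -big_filter big_const_seq count_predT iter_addr_0 mulr_natl//.
rewrite /pmoment big_seq [leRHS]big_seq; apply: ler_sum => d dn.
have p0 : 0 < bmass lam n d by rewrite bmass_gt0.
pose x := - ln (bmass lam n d) / n%:R.
have pE : bmass lam n d = expR (- (n%:R * x)).
  by rewrite /x mulrC divfK ?gt_eqF// opprK lnK.
have x0 : 0 <= x by rewrite divr_ge0// oppr_ge0 ln_le0// bmass_le1.
have x2 : x <= ln 2.
  have := bmass_ge dn; rewrite pE -[2^-1]lnK ?posrE// -expRM_natl ler_expR lnV ?posrE//.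
  by rewrite mulrN lerN2 ler_pM2l.
have xe0 : 0 <= x / eta by rewrite divr_ge0// ltW.
have /andP[j1 j2] := truncn_itv xe0.
have jJ : (Num.truncn (x / eta) < J)%N.
  rewrite truncn_lt_nat// ltr_pdivrMr//; exact: le_lt_trans hJ.
rewrite (bigD1 (Ordinal jJ)) /=; last first.
  rewrite pE ler_expR lerN2 ler_pM2l// -ler_pdivrMr//; exact: ltW.
apply: (@le_trans _ _ (expR (- (n%:R * (q * ((Num.truncn (x / eta))%:R * eta)))))).
  rewrite pE /powR gt_eqF ?expR_gt0// expRK ler_expR mulrN lerN2.
  by rewrite mulrCA ler_wpM2l// ler_wpM2l// -ler_pdivlMr.
by rewrite lerDl sumr_ge0// => i _; exact: expR_ge0.
Qed.

(** The moment is taken at the exponent [q] that is the slope of the supporting line at [al + e].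
    With this choice every band contributes at most about [expR (n%:R * (F - q * (al + e)))], so the
    lower bound on the moment forces [F] to be at least [al * q - t q], up to errors. *)
Lemma Phi_legendre (t : R -> R) (al h : R) :
  (forall q, 0 <= q -> forall e, 0 < e -> forall N, exists2 n, (N <= n)%N &
     expR (n%:R * (- t q - e)) <= pmoment n q) ->
  (forall e, 0 < e -> exists g, Phi (al + e) g) ->
  (forall q, 0 <= q -> h <= al * q - t q) ->
  forall e, 0 < e -> Phi (al + e) (h - e).
Proof.
move=> lo exg hq e e0.
have [g0 P0] := exg (e / 2) ltac:(by rewrite divr_gt0).
have [|F [q [q0 sup PF]]] := @Phi_support _ _ (al + e) P0; first by lra.
suff hF : h <= F by apply: Phi_le (PF e e0) _ _ => //; lra.
apply: le_trans (hq q q0) _.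
apply/ler_addgt0Pr => d d0.
(* The width of the bands costs [2 * q * eta] below; the slack in [G], the number of bands and the
   lower bound on the moment cost [4 * eta] together. *)
pose eta := d / (2 * q + 5).
have q5 : 0 < 2 * q + 5 by lra.
have eta0 : 0 < eta by rewrite divr_gt0.
have etaE : eta * (2 * q + 5) = d by rewrite divfK// gt_eqF.
pose J := (Num.truncn (ln 2 / eta)).+1.
have hJ : ln 2 < J%:R * eta by rewrite -ltr_pdivrMr//; exact: truncnS_gt.
pose G (j : nat) := F + q * (j.+2%:R * eta - (al + e)) + 2 * eta.
(* A band exceeding this size infinitely often would, by [Phi_up], yield a pair of [Phi] lying [eta]
   above the supporting line. *)
have rare (j : 'I_J) : \forall n \near \oo,
   (size (heavy n (expR (- (n%:R * (j.+1%:R * eta))))))%:R <= expR (n%:R * G j).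
  apply: contrapT => hN.
  suff : Phi (j.+1%:R * eta + eta) (G j - eta).
    by move=> /sup; rewrite /G -natr1; nra.
  apply: (Phi_up lam_gt0 lam_lt1 window) => // N.
  apply: contrapT => hN'; apply: hN; exists N => // n /= Nn.
  by rewrite leNgt; apply/negP => /ltW hn; apply: hN'; exists n.
have [N1 _ HN1] : \forall n \near \oo, forall j : 'I_J,
   (size (heavy n (expR (- (n%:R * (j.+1%:R * eta))))))%:R <= expR (n%:R * G j).
  exact: filter_forall.
have J0 : 0 < J%:R :> R by rewrite ltr0n.
have [N2 _ HN2] : \forall n \near \oo, ln J%:R / eta <= n%:R :> R by exact: nbhs_infty_ger.
have [n nN hn] := lo q q0 eta eta0 (maxn (maxn N1 N2) 1).
move: nN; rewrite !geq_max => /andP[/andP[/HN1 /= h1 /HN2 /= h2] n_gt0].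
have n0 : 0 < n%:R :> R by rewrite ltr0n.
have := le_trans hn (pmoment_bands n_gt0 eta0 q0 hJ) => hs.
have : expR (n%:R * (- t q - eta)) <= J%:R * expR (n%:R * (F + q * (2 * eta - (al + e)) + 2 * eta)).
  apply: le_trans hs _.
  set X := expR (_ * (F + _ + _)); have -> : J%:R * X = \sum_(j < J) X.
    by rewrite sumr_const card_ord mulr_natl.
  rewrite ler_sum// => j _.
  rewrite -ler_pdivlMr ?expR_gt0// /X -expRN -expRD opprK (le_trans (h1 j))// ler_expR /G.
  rewrite -mulrDr ler_wpM2l// -[j.+2]addn2 natrD.
  lra.
rewrite -[X in X * expR _]lnK ?posrE// -expRD ler_expR.
move: h2; rewrite ler_pdivrMr// => h2 h3.
have : n%:R * (- t q - eta) <= n%:R * (eta + (F + q * (2 * eta - (al + e)) + 2 * eta)).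
  by apply: le_trans h3 _; rewrite [leRHS]mulrDr lerD2r.
rewrite ler_pM2l// => h4.
have : 0 <= q * e by rewrite mulr_ge0// ltW.
lra.
Qed.

(** If all masses were below [expR (- (n%:R * (al + e / 2)))], then the at most [2 ^ n] points could
    not produce so large a moment: for large [q] the gain of [q * e / 4] in the exponent outweighs
    [ln 2]. *)
Lemma Phi_of_slope (t : R -> R) (al : R) :
  (forall q, 0 <= q -> forall e, 0 < e -> forall N, exists2 n, (N <= n)%N &
     expR (n%:R * (- t q - e)) <= pmoment n q) ->
  (forall e M, 0 < e -> exists2 q, M <= q & t q <= q * (al + e)) ->
  forall e, 0 < e -> exists g, Phi (al + e) g.
Proof.
move=> lo slope e e0.
have e4 : 0 < e / 4 by rewrite divr_gt0.
have ln2 : 0 < ln 2 :> R by rewrite ln_gt0// ltr1n.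
have [q qM tq] := slope (e / 4) ((2 + ln 2) / (e / 4)) e4.
have q0 : 0 < q by apply: lt_le_trans qM; rewrite divr_gt0// addr_gt0.
rewrite ler_pdivrMr// in qM.
exists (0 - e / 2); rewrite (_ : al + e = al + e / 2 + e / 2); last by field.
have e2 : 0 < e / 2 by rewrite divr_gt0.
apply: (Phi_up lam_gt0 lam_lt1 window) => // N.
have [n nN hn] := lo q (ltW q0) 1 ltr01 (maxn N 1).
move: nN; rewrite geq_max => /andP[Nn n_gt0]; exists n => //.
have n0 : 0 < n%:R :> R by rewrite ltr0n.
rewrite mulr0 expR0 ler1n size_filter -has_count; apply: contraT => /hasPn hN.
have : pmoment n q <= expR (n%:R * ln 2) * expR (- (n%:R * (q * (al + e / 2)))).
  apply: le_trans (_ : \sum_(d <- bpts lam n) expR (- (n%:R * (q * (al + e / 2)))) <= _).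
    rewrite /pmoment big_seq [leRHS]big_seq ler_sum// => d dn.
    have p0 : 0 < bmass lam n d by rewrite bmass_gt0.
    rewrite /powR gt_eqF// ler_expR.
    have := hN d dn; rewrite -ltNge => /ltW.
    rewrite -[bmass _ _ _]lnK ?posrE// ler_expR expRK => hl.
    by rewrite mulrCA -mulrN ler_pM2l.
  rewrite big_const_seq count_predT iter_addr_0 -[leLHS]mulr_natl ler_wpM2r ?expR_ge0//.
  have := size_heavy_le lam n 0; rewrite /heavy (eq_in_filter (a2 := predT)) ?filter_predT//.
  by move=> d dn; rewrite bmass_ge0.
move=> /(le_trans hn); rewrite -expRD ler_expR => h.
have : n%:R * (- t q - 1) <= n%:R * (ln 2 - q * (al + e / 2)) by rewrite [leRHS]mulrBr.
rewrite ler_pM2l// => h'.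
exfalso; nra.
Qed.

(** A single heavy point already contributes [expR (- (n%:R * (q * (al + e))))] to the moment. *)
Lemma le_of_Phi (t : R -> R) (al : R) q :
  0 <= q ->
  (forall e, 0 < e -> \forall n \near \oo, pmoment n q <= expR (n%:R * (- t q + e))) ->
  (forall e, 0 < e -> exists g, Phi (al + e) g) -> t q <= al * q.
Proof.
move=> q0 up exg; apply/ler_addgt0Pr => d d0.
pose e := d / (q + 1).
have q1 : 0 < q + 1 by lra.
have e0 : 0 < e by rewrite divr_gt0.
have eE : e * (q + 1) = d by rewrite divfK// gt_eqF.
have [g /Phi_ge0[_ P0]] := exg e e0.
near \oo => n.
have n0 : 0 < n%:R :> R by near: n; exact: nbhs_infty_gtr.
have h1 : pmoment n q <= expR (n%:R * (- t q + e)) by near: n; exact: up.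
have : expR (n%:R * 0) <= (size (heavy n (expR (- (n%:R * (al + e))))))%:R :> R.
  by near: n; exact: P0.
rewrite mulr0 expR0 ler1n size_filter -has_count => /hasP[x xn hx].
have : expR (- (n%:R * (q * (al + e)))) <= pmoment n q.
  rewrite /pmoment (big_rem x)//= -[leLHS]addr0 lerD//; last first.
    by rewrite sumr_ge0// => i _; exact: powR_ge0.
  have p0 : 0 < bmass lam n x by rewrite bmass_gt0.
  rewrite /powR gt_eqF// ler_expR.
  move: hx; rewrite -[bmass _ _ _]lnK ?posrE// ler_expR expRK => hl.
  by rewrite mulrCA -mulrN ler_wpM2l.
move=> /le_trans/(_ h1); rewrite ler_expR -mulrN ler_pM2l// => ?; lra.
Unshelve. all: by end_near. Qed.

Lemma heavy_chebyshev (t : R -> R) (al h de q : R) :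
  0 < q ->
  (forall e, 0 < e -> \forall n \near \oo, pmoment n q <= expR (n%:R * (- t q + e))) ->
  (al - de) * q - t q < h ->
  exists2 eta, 0 < eta & \forall n \near \oo,
    (size (heavy n (expR (- (n%:R * (al - de))))))%:R <= expR (n%:R * (h - eta)).
Proof.
move=> q0 up hq.
pose eta := (h - ((al - de) * q - t q)) / 2.
have eta0 : 0 < eta by rewrite divr_gt0// subr_gt0.
exists eta => //; move: (up _ eta0); apply: filterS => n hn.
have : (size (heavy n (expR (- (n%:R * (al - de))))))%:R * expR (- (n%:R * (q * (al - de)))) <= pmoment n q.
  rewrite mulr_natl -iter_addr_0 -count_predT -big_const_seq big_filter.
  rewrite /pmoment [leRHS](bigID (fun d => expR (- (n%:R * (al - de))) <= bmass lam n d))/=.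
  rewrite -[leLHS]addr0 lerD//; last by rewrite sumr_ge0// => i _; exact: powR_ge0.
  rewrite big_seq_cond [leRHS]big_seq_cond ler_sum// => d /andP[dn hx].
  have p0 : 0 < bmass lam n d by rewrite bmass_gt0.
  rewrite /powR gt_eqF// ler_expR.
  move: hx; rewrite -[bmass _ _ _]lnK ?posrE// ler_expR expRK => hl.
  by rewrite mulrCA -mulrN ler_pM2l.
move=> /le_trans/(_ hn); rewrite -ler_pdivlMr ?expR_gt0// => /le_trans; apply.
rewrite -expRN opprK -expRD ler_expR -mulrDr ler_wpM2l// /eta; lra.
Qed.

End LargeDeviations.

(** * The Moran construction *)

(** The total length of the first [k] blocks, the triangular number k(k+1)/2. *)
Fixpoint lev k : nat := if k is j.+1 then (lev j + k)%N else 0%N.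

Lemma lev_ge k : (k <= lev k)%N.
Proof. by case: k => //= k; rewrite leq_addl. Qed.

Lemma lev_le k : ((lev k).+1 <= k.+1 ^ 2)%N.
Proof. by elim: k => // k IH /=; lia. Qed.

Lemma lev_homo m n : (m <= n)%N -> (lev m <= lev n)%N.
Proof.
move=> /subnK <-; elim: (n - m)%N => // k IH.
by rewrite addSn /= (leq_trans IH)// leq_addr.
Qed.

Lemma near_lev (P : nat -> Prop) : (\forall n \near \oo, P n) ->
  \forall k \near \oo, P (lev k).
Proof.
by move=> [N _ H]; exists N => // k /= Nk; apply: H => /=; rewrite (leq_trans Nk)// lev_ge.
Qed.

Lemma near_succ (P : nat -> Prop) : (\forall n \near \oo, P n) ->
  \forall k \near \oo, P k.+1.
Proof. by move=> [N _ H]; exists N => // k /= Nk; apply: H => /=; rewrite ltnW. Qed.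

Lemma lev_small (R : realType) (K e : R) : 0 < e ->
  \forall k \near \oo, k.+1%:R * K <= (lev k)%:R * e.
Proof.
move=> e0.
have levE k : ((lev k)%:R * 2 = k%:R * (k%:R + 1) :> R)%R.
  elim: k => [|k IH]; first by rewrite !mul0r.
  by rewrite [lev _]/= natrD mulrDl IH -natr1; ring.
near=> k.
have k1 : 1 <= k%:R :> R by near: k; exact: nbhs_infty_ger.
have hK : 2 * `|K| / e <= k%:R by near: k; exact: nbhs_infty_ger.
rewrite ler_pdivrMr// in hK.
have := levE k => lE.
have : (k%:R + 1) * K <= (k%:R + 1) * (k%:R * e / 2).
  have k0 : 0 < k%:R + 1 :> R by lra.
  by rewrite ler_pM2l//; have := ler_norm K; lra.
rewrite -[k.+1%:R]natr1 => /le_trans; apply.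
have -> : (lev k)%:R = k%:R * (k%:R + 1) / 2 :> R by rewrite -lE mulfK.
by rewrite le_eqVlt; apply/orP; left; apply/eqP; field.
Unshelve. all: by end_near. Qed.

(** Block [j] has length [j.+1] and these lengths sum to [lev k], so errors that are negligible
    against each block remain negligible in total. *)
Lemma weighted_cesaro (R : realType) (y : nat -> R) :
  (forall e, 0 < e -> \forall j \near \oo, y j <= j.+1%:R * e) ->
  forall e, 0 < e -> \forall k \near \oo, \sum_(j < k) y j <= (lev k)%:R * e.
Proof.
move=> H e e0; have e2 : 0 < e / 2 by rewrite divr_gt0.
have [N _ HN] := H _ e2.
pose C := \sum_(j < N) `|y j|.
have bnd k : \sum_(j < k) y j <= C + (lev k)%:R * (e / 2).
  elim: k => [|k IH]; first by rewrite big_ord0 mul0r addr0 sumr_ge0.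
  have [kN|Nk] := ltnP k N.
    have : \sum_(j < k.+1) y j <= C; last first.
      by move=> /le_trans; apply; rewrite lerDl mulr_ge0// ltW.
    rewrite /C -(big_mkord xpredT y) -(big_mkord xpredT (fun j => `|y j|)).
    rewrite [leRHS](big_cat_nat (n := k.+1))//= -[leLHS]addr0 lerD ?sumr_ge0//.
    by apply: ler_sum => i _; exact: ler_norm.
  rewrite big_ord_recr /= natrD mulrDl addrA lerD//.
  exact: HN.
near=> k; apply: le_trans (bnd k) _.
have : k.+1%:R * C <= (lev k)%:R * (e / 2) by near: k; exact: lev_small.
have : 0 <= C by rewrite sumr_ge0.
have : 1 <= k.+1%:R :> R by rewrite ler1n.
nra.
Unshelve. all: by end_near. Qed.

(** At [n], the smallest admissible tolerance among 1, 1/2, ..., 1/(n+1) is selected. When none is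
    admissible the empty maximum is 0 and the tolerance is 1, which happens for finitely many [n]
    only. *)
Lemma diagonal_eps (R : realType) (Q : R -> nat -> Prop) :
  (forall e, 0 < e -> \forall n \near \oo, Q e n) ->
  exists d : nat -> R, [/\ forall n, 0 < d n,
    forall e, 0 < e -> \forall n \near \oo, d n <= e
    & \forall n \near \oo, Q (d n) n].
Proof.
move=> H.
pose f n := \max_(i < n.+1 | `[< Q i.+1%:R^-1 n >]) (i : nat).
exists (fun n => (f n).+1%:R^-1); split.
- by move=> n; rewrite invr_gt0 ltr0n.
- move=> e e0; pose i := Num.truncn e^-1.
  have ie : (i.+1%:R)^-1 <= e.
    by rewrite -[leRHS]invrK lef_pV2 ?posrE ?invr_gt0// ltW// truncnS_gt.
  near=> n; apply: le_trans ie; rewrite lef_pV2 ?posrE ?ltr0n// ler_nat ltnS.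
  have iN : (i < n.+1)%N by rewrite ltnS; near: n; exact: nbhs_infty_ge.
  apply: (@leq_bigmax_cond _ _ (fun i : 'I_n.+1 => i : nat) (Ordinal iN)).
  by apply/asboolP => /=; near: n; apply: H; rewrite invr_gt0 ltr0n.
- near=> n.
  have h0 : `[< Q (0%N.+1%:R)^-1 n >].
    by apply/asboolP; near: n; apply: H; rewrite invr_gt0 ltr0n.
  rewrite /f (bigop.bigmax_eq_arg (Ordinal (ltn0Sn n)))//.
  by case: arg_maxnP => // j /asboolP.
Unshelve. all: by end_near. Qed.

Section Moran.
Context (R : realType) (lam : R).
Hypotheses (lam_gt0 : 0 < lam) (lam_lt1 : lam < 1).
Let L : R := (1 - lam)^-1.
Variable D : nat.
Hypothesis window : bounded_overlap lam D.
Local Notation Phi := (Phi lam).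
Local Notation heavy := (heavy lam).

Let L_gt0 : 0 < L. Proof. by rewrite invr_gt0 subr_gt0. Qed.

Variable G : nat -> seq R.
Hypotheses (G_uniq : forall j, uniq (G j)) (G_sub : forall j, {subset G j <= bpts lam j.+1})
  (G_gt0 : forall j, (0 < size (G j))%N).
Variable bad : nat -> pred R.

(* A point is listed once for each word leading to it: [tree k] has repetitions. *)
Fixpoint tree k : seq R :=
  if k is j.+1 then [seq d + lam ^+ lev j * c | d <- tree j, c <- G j] else [:: 0].

Fixpoint pruned k : seq R :=
  if k is j.+1 then
    [seq x <- [seq d + lam ^+ lev j * c | d <- pruned j, c <- G j] | ~~ bad k x]
  else [:: 0].

Definition vol k : R := \prod_(j < k) (size (G j))%:R.

Definition mult k : R := \prod_(j < k) ((2 * L + 1) * (lev j).+1%:R ^+ D).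

Lemma volS k : vol k.+1 = vol k * (size (G k))%:R.
Proof. by rewrite /vol big_ord_recr. Qed.

Lemma vol_gt0 k : 0 < vol k.
Proof. by apply: prodr_gt0 => j _; rewrite ltr0n. Qed.

Lemma mult_ge1 k : 1 <= mult k.
Proof.
rewrite /mult; elim: k => [|k IH]; first by rewrite big_ord0.
rewrite big_ord_recr /= mulr_ege1// mulr_ege1 ?exprn_ege1 ?ler1n//.
by have := L_gt0; lra.
Qed.

Lemma tree_sub k : {subset tree k <= bpts lam (lev k)}.
Proof.
elim: k => [|k IH] //= x /allpairsP[[d c] /= [dV cG ->]].
by rewrite bpts_add ?IH// G_sub.
Qed.

(** All prefixes of words leading to [d] lie in one window around [d], so each block costs one
    window factor. Prefixes with the same point are grouped and weighted by their multiplicity, to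
    which the induction applies. *)
Lemma tree_mult k d : (count_mem d (tree k))%:R <= mult k.
Proof.
elim: k d => [|k IH] d; first by rewrite /mult big_ord0 /= addn0 lern1 leq_b1.
rewrite [tree _]/= count_allpairs -big_undup_iterop_count /=.
under eq_bigr do rewrite Monoid.iteropE iter_addn_0.
rewrite natr_sum.
apply: (@le_trans _ _ (\sum_(x <- undup (tree k)) mult k *
    (count (fun y => x + lam ^+ lev k * y == d) (G k))%:R)).
  by apply: ler_sum => x _; rewrite natrM mulrC ler_wpM2r.
rewrite -mulr_sumr -natr_sum -count_allpairs /mult big_ord_recr /= ler_wpM2l//.
  exact: le_trans ler01 (mult_ge1 k).
apply: (heavy_fiber lam_gt0 lam_lt1 window (m := k.+1)); rewrite ?undup_uniq//.
by move=> x; rewrite mem_undup => /tree_sub.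
Qed.

Lemma tree_window C k x : 0 <= C ->
  (count (fun d => `|d - x| <= C * lam ^+ lev k) (tree k))%:R <=
    mult k * ((2 * C + 1) * (lev k).+1%:R ^+ D).
Proof.
move=> C0; rewrite (count_sum_mem _ (bpts_uniq lam (lev k)) (@tree_sub k)) natr_sum.
apply: le_trans (_ : \sum_(d <- bpts lam (lev k) | `|d - x| <= C * lam ^+ lev k) mult k <= _).
  by apply: ler_sum => d _; exact: tree_mult.
rewrite -big_filter big_const_seq count_predT iter_addr_0 size_filter -[leLHS]mulr_natr.
rewrite ler_wpM2l ?window//.
exact: le_trans ler01 (mult_ge1 k).
Qed.

(** The factor [1 - lam ^+ n] in [bpts_norm] is what makes the ball of a child lie in the ball of
    its parent with the same constant [L] at all levels. *)
Lemma block_shrink j c : c \in G j ->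
  `|lam ^+ lev j * c| + L * lam ^+ lev j.+1 <= L * lam ^+ lev j.
Proof.
move=> /G_sub/(bpts_norm lam_gt0 lam_lt1) cL.
rewrite normrM gtr0_norm ?exprn_gt0//= exprD mulrA [L * _]mulrC -!mulrA -mulrDr.
rewrite ler_pM2l ?exprn_gt0//.
by move: cL; rewrite -/L mulrBr mulr1 lerBrDr.
Qed.

(** All words of a level have equally many children, and by [block_shrink] a child close to [x] has
    a parent close to [x]. The proportion of words close to [x] therefore cannot grow with the
    level. *)
Lemma tree_descend rho m n x : (m <= n)%N ->
  (count (fun d => `|d - x| <= rho + L * lam ^+ lev n) (tree n))%:R * vol m <=
  (count (fun d => `|d - x| <= rho + L * lam ^+ lev m) (tree m))%:R * vol n.
Proof.
move=> /subnK <-; elim: (n - m)%N => // k IH.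
rewrite addSn; set j := (k + m)%N in IH *.
rewrite volS [leRHS]mulrA; apply: le_trans (ler_wpM2r _ IH) => //.
rewrite mulrAC ler_wpM2r ?(ltW (vol_gt0 m))// -natrM ler_nat /=.
rewrite -sum1_count big_mkcond big_allpairs_dep /=.
rewrite -sum1_count big_distrl /= [leqRHS]big_mkcond /=; apply: leq_sum => d _.
have [h|hN] := boolP (`|d - x| <= _).
  rewrite mul1n -sum1_size leq_sum// => c _; by case: ifP.
rewrite big_seq big1// => c cG; case: ifP => // h; move: hN; rewrite -ltNge => hN.
exfalso; have := block_shrink cG.
have : `|d - x| <= `|d + lam ^+ lev j * c - x| + `|lam ^+ lev j * c|.
  have -> : d - x = (d + lam ^+ lev j * c - x) - lam ^+ lev j * c by ring.
  exact: ler_normB.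
move: h hN; rewrite /= => *; lra.
Qed.

Lemma pruned_sum_le k (g : R -> nat) : (\sum_(x <- pruned k) g x <= \sum_(x <- tree k) g x)%N.
Proof.
elim: k g => [|k IH] g //=.
rewrite big_filter big_mkcond /= !big_allpairs_dep.
apply: leq_trans (IH _); apply: leq_sum => d _; apply: leq_sum => c _.
by case: ifP.
Qed.

Lemma pruned_count_le k (P : pred R) : (count P (pruned k) <= count P (tree k))%N.
Proof. by rewrite -!sum1_count big_mkcond [leqRHS]big_mkcond; exact: pruned_sum_le. Qed.

(** The root is never tested, and pruning at level k >= 1 removes a proportion of at most 2^-(k+1)
    of all words; these proportions sum to one half. *)
Lemma size_pruned : (forall k, 2 ^+ k.+1 * (count (bad k) (tree k))%:R <= vol k) ->
  forall k, vol k / 2 <= (size (pruned k))%:R.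
Proof.
move=> badle k.
suff : (2^-1 + 2^-1 ^+ k.+1) * vol k <= (size (pruned k))%:R.
  apply: le_trans; rewrite mulrC ler_pM2r ?vol_gt0// lerDl exprn_ge0//.
elim: k => [|k IH]; first by rewrite /vol big_ord0 expr1 mulr1 /=; lra.
set A := [seq d + lam ^+ lev k * c | d <- pruned k, c <- G k].
have sA : (size (pruned k.+1))%:R = (size A)%:R - (count (bad k.+1) A)%:R :> R.
  rewrite /= -/A size_filter -[in RHS](count_predC (bad k.+1) A) natrD addrAC subrr add0r//.
have cA : (count (bad k.+1) A)%:R <= (count (bad k.+1) (tree k.+1))%:R :> R.
  rewrite ler_nat -!sum1_count big_mkcond [leqRHS]big_mkcond /= !big_allpairs_dep.
  exact: pruned_sum_le.
have := badle k.+1; rewrite exprS mulrC -ler_pdivlMr ?mulr_gt0 ?exprn_gt0// => cB.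
rewrite sA lerBrDr; apply: le_trans (_ : (2^-1 + 2^-1 ^+ k.+1) * vol k.+1 <= _); last first.
  by rewrite volS mulrA size_allpairs natrM ler_wpM2r.
rewrite -lerBrDl (le_trans cA)// (le_trans cB)// -mulrBl mulrC ler_pM2r ?vol_gt0//.
by rewrite !exprS invfM exprVn invfM; lra.
Qed.

Lemma pruned_nested k x : x \in pruned k.+1 -> exists2 d, d \in pruned k &
  `|x - d| + L * lam ^+ lev k.+1 <= L * lam ^+ lev k.
Proof.
rewrite /= mem_filter => /andP[_ /allpairsP[[d c] /= [dS cG ->]]].
by exists d => //; rewrite addrAC subrr add0r; have := block_shrink cG.
Qed.

Lemma pruned_sub_tree k : {subset pruned k <= tree k}.
Proof.
elim: k => [|k IH] //= x; rewrite mem_filter => /andP[_ /allpairsP[[d c] /= [/IH dV cG ->]]].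
by apply/allpairsP; exists (d, c).
Qed.

Lemma pruned_good k x : (0 < k)%N -> x \in pruned k -> ~~ bad k x.
Proof. by case: k => //= k _; rewrite mem_filter => /andP[]. Qed.

Lemma tree_mass (th : nat -> R) : (forall j, 0 <= th j) ->
  (forall j c, c \in G j -> th j <= bmass lam j.+1 c) ->
  forall k d, d \in tree k -> \prod_(j < k) th j <= bmass lam (lev k) d.
Proof.
move=> th0 thG; elim=> [|k IH] d.
  by rewrite big_ord0 inE => /eqP -> /=; rewrite eqxx.
move=> /allpairsP[[x c] /= [xV cG ->]]; rewrite big_ord_recr /=.
apply: le_trans (bmass_mul _ _ _ _ _); apply: ler_pM; rewrite ?IH ?thG//.
by rewrite prodr_ge0.
Qed.

Definition shell k := [set x | exists2 d, d \in pruned k & `|x - d| <= L * lam ^+ lev k].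

Definition limit_set := \bigcap_k shell k.

Lemma shell_nested m n : (m <= n)%N -> shell n `<=` shell m.
Proof.
move=> /subnK <-; elim: (n - m)%N => // k IH x; rewrite addSn => -[d dS xd].
apply: IH; have [d' d'pruned dd'] := pruned_nested dS; exists d' => //.
have -> : x - d' = (x - d) + (d - d') by ring.
have := ler_normD (x - d) (d - d'); lra.
Qed.

Lemma shell_closed k : closed (shell k).
Proof.
rewrite (_ : shell k = \bigcup_(d in [set` pruned k]) closed_ball d (L * lam ^+ lev k)).
  by apply: closed_bigcup => [|d _]; [exact: finite_seq|exact: closed_ball_closed].
have Ll : 0 < L * lam ^+ lev k by rewrite mulr_gt0// exprn_gt0.
apply/seteqP; split=> x [d dS xd]; exists d => //; move: xd;
  by rewrite closed_ballE// /closed_ball_ /= distrC.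
Qed.

(** Otherwise the sets [C n] would be nonempty, closed, bounded and decreasing, and a cluster point
    of a selection from them would be an uncovered point of the limit set. Covering a whole shell,
    not just the limit set, is what lets a cover be tested by counting words. *)
Lemma shell_cover (U : nat -> set R) : (forall k, shell k !=set0) ->
  (forall i, open (U i)) -> limit_set `<=` \bigcup_i U i ->
  exists N, forall n, (N <= n)%N -> shell n `<=` \bigcup_(i < N) U i.
Proof.
move=> ne oU KU; apply: contrapT => hN.
pose C n := shell n `&` ~` (\bigcup_(i < n) U i).
have Cne n : exists x, C n x.
  apply: contrapT => Cn; apply: hN; exists n => m nm x xm; apply: contrapT => xU.
  by apply: Cn; exists x; split => //; exact: shell_nested xm.
have [u uC] := choice Cne.
have Cdec m n : (m <= n)%N -> C n `<=` C m.
  move=> mn x [xs xU]; split; first exact: shell_nested xs.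
  by move=> [i /= im Ux]; apply: xU; exists i => //=; exact: leq_trans im mn.
have Ccl n : closed (C n).
  by apply: closedI; [exact: shell_closed|apply: open_closedC; apply: bigcup_open].
have us n : `[- L, L]%classic (u n).
  have [+ _] := Cdec 0%N n (leq0n n) _ (uC n).
  move=> [d]; rewrite inE => /eqP ->; rewrite subr0 mulr1 ler_norml.
  by rewrite /= in_itv.
have [|x [_ xu]] := @segment_compact R (- L) L (u @ \oo) _.
  by exists 0%N => // n _; exact: us.
have xC n : C n x.
  apply: Ccl => B Bx; apply: xu => //.
  by exists n => // m /= nm; exact: Cdec (uC m).
have : limit_set x by move=> k _; have [] := xC k.
move=> /KU[i _ Ux]; have [_ +] := xC i.+1; apply.
by exists i => //=.
Qed.

Lemma shell_nonempty : (forall k, vol k / 2 <= (size (pruned k))%:R) ->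
  forall k, shell k !=set0.
Proof.
move=> hS k.
have : 0 < (size (pruned k))%:R :> R by apply: lt_le_trans (hS k); rewrite divr_gt0// vol_gt0.
rewrite ltr0n; case E : (pruned k) => [//|d s] _; exists d; exists d.
  by rewrite E mem_head.
by rewrite subrr normr0 mulr_ge0 ?exprn_ge0// ltW.
Qed.

(** An empty limit set would be covered by empty open sets, and then some nonempty shell would be as
    well. *)
Lemma limit_set_nonempty : (forall k, vol k / 2 <= (size (pruned k))%:R) ->
  limit_set !=set0.
Proof.
move=> hS; apply/set0P/negP => /eqP K0.
have [|N HN] := @shell_cover (fun=> set0) (shell_nonempty hS) (fun=> open0).
  by rewrite K0; exact: sub0set.
have [x xN] := shell_nonempty hS N.
by have [i _] := HN N (leqnn N) x xN.
Qed.

(** An upper bound for the proportion of words of level [k] whose point lies within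
    [(1 + L) * lam ^+ lev k] of a given point: one unit for the radius of a covering ball, [L] for
    the continuations. *)
Definition psi k : R := mult k * ((2 * (1 + L) + 1) * (lev k).+1%:R ^+ D) / vol k.

(** The mass distribution principle with counts of words in place of a measure. Finitely many of the
    balls cover a shell; at least half of all words survive there, and ball [i] catches at most the
    proportion [psi (m i)]. *)
Lemma cover_mass (m : nat -> nat) (x : nat -> R) :
  (forall k, vol k / 2 <= (size (pruned k))%:R) ->
  limit_set `<=` \bigcup_i ball (x i) (lam ^+ lev (m i)) ->
  exists N, 2^-1 <= \sum_(i < N) psi (m i).
Proof.
move=> hS KU.
have [N HN] := shell_cover (shell_nonempty hS) (fun i => ball_open (x i) _) KU.
exists N.
(* Words are counted at a level beyond those of all the balls, so that [tree_descend] can bring each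
   count back to the level [m i]. *)
pose n := maxn N (\max_(i < N) m i).
have nm (i : 'I_N) : (m i <= n)%N.
  by rewrite leq_max (@bigop.leq_bigmax _ (fun i : 'I_N => m i) i) orbT.
have v0 := vol_gt0 n.
rewrite -(ler_pM2r v0) mulrC (le_trans (hS n))// mulr_suml.
apply: le_trans (_ : (\sum_(i < N) count (fun d => `|d - x i| <= lam ^+ lev (m i) + L * lam ^+ lev n)%R (tree n))%N%:R <= _).
  rewrite ler_nat.
  apply: (@leq_trans (\sum_(i < N) count (fun d => `|d - x i| <= lam ^+ lev (m i) + L * lam ^+ lev n)%R (pruned n))).
    rewrite -sum1_size.
    under [leqRHS]eq_bigr do rewrite -sum1_count big_mkcond.
    rewrite [leqRHS]exchange_big /= big_seq [leqRHS]big_seq; apply: leq_sum => d dS.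
    have [|i /= iN dU] := HN n (leq_maxl _ _) d.
      by exists d => //; rewrite subrr normr0 mulr_ge0 ?exprn_ge0// ltW.
    rewrite (bigD1 (Ordinal iN)) //=; case: ifP => // /negP[].
    move: dU; rewrite /ball /= distrC => /ltW/le_trans; apply.
    by rewrite lerDl mulr_ge0 ?exprn_ge0// ltW.
  by apply: leq_sum => i _; exact: pruned_count_le.
rewrite natr_sum; apply: ler_sum => i _.
rewrite /psi mulrAC ler_pdivlMr ?vol_gt0//.
apply: le_trans (tree_descend _ _ (nm i)) _; rewrite ler_wpM2r ?(ltW v0)//.
have -> : (fun d => `|d - x i| <= lam ^+ lev (m i) + L * lam ^+ lev (m i)) =
  (fun d => `|d - x i| <= (1 + L) * lam ^+ lev (m i)).
  by apply/funext => d; rewrite mulrDl mul1r.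
by apply: tree_window; have := L_gt0; lra.
Qed.

Lemma bad_count C th k (P : pred R) : 0 <= C ->
  (forall x, P x -> exists2 d, d \in heavy (lev k) th & `|x - d| <= C * lam ^+ lev k) ->
  (count P (tree k))%:R <= (size (heavy (lev k) th))%:R *
     (mult k * ((2 * C + 1) * (lev k).+1%:R ^+ D)).
Proof.
move=> C0 HP.
apply: le_trans (_ : (\sum_(d <- heavy (lev k) th) count (fun x => `|x - d| <= C * lam ^+ lev k)%R (tree k))%N%:R <= _).
  rewrite ler_nat -sum1_count.
  under [leqRHS]eq_bigr do rewrite -sum1_count big_mkcond.
  rewrite [leqRHS]exchange_big /= big_mkcond; apply: leq_sum => x _; case: ifP => // /HP[d dh xd].
  by rewrite (big_rem d)//= xd.
rewrite natr_sum; apply: le_trans (_ : \sum_(d <- heavy (lev k) th) mult k * ((2 * C + 1) * (lev k).+1%:R ^+ D) <= _).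
  by apply: ler_sum => d _; exact: tree_window.
by rewrite big_const_seq count_predT iter_addr_0 [leRHS]mulr_natl.
Qed.

End Moran.

Section MoranSet.
Context (R : realType) (lam : R).
Hypotheses (lam_gt0 : 0 < lam) (lam_lt1 : lam < 1).
Let L : R := (1 - lam)^-1.
Variable D : nat.
Hypothesis window : bounded_overlap lam D.
Local Notation Phi := (Phi lam).
Local Notation heavy := (heavy lam).

Let L_gt0 : 0 < L. Proof. by rewrite invr_gt0 subr_gt0. Qed.

Lemma good_blocks (al h : R) : (forall e, 0 < e -> Phi (al + e) (h - e)) ->
  exists th : nat -> R, [/\ forall j, 0 < th j,
    forall j, (0 < size (heavy j.+1 (th j)))%N,
    forall e, 0 < e -> \forall j \near \oo, - ln (th j) <= j.+1%:R * (al + e)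
    & forall e, 0 < e -> \forall j \near \oo,
        j.+1%:R * (h - e) <= ln (size (heavy j.+1 (th j)))%:R].
Proof.
move=> H.
pose Q e j := expR (j.+1%:R * (h - e)) <=
  (size (heavy j.+1 (expR (- (j.+1%:R * (al + e))))))%:R.
have [d [d0 dcvg dQ]] : exists d : nat -> R, [/\ forall n, 0 < d n,
    forall e, 0 < e -> \forall n \near \oo, d n <= e
    & \forall n \near \oo, Q (d n) n].
  by apply: (@diagonal_eps R Q) => e e0; exact: (@near_succ (fun n => expR (n%:R * (h - e)) <=
    (size (heavy n (expR (- (n%:R * (al + e))))))%:R) (H e e0)).
pose t j := expR (- (j.+1%:R * (al + d j))).
(* The default threshold is reached by every point, so early blocks are nonempty too. *)
pose th j := if (0 < size (heavy j.+1 (t j)))%N then t j else 2^-1 ^+ j.+1.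
have thE : \forall j \near \oo, th j = t j /\ expR (j.+1%:R * (h - d j)) <= (size (heavy j.+1 (t j)))%:R.
  apply: filterS dQ => j dQj; split => //; rewrite /th ifT// -(ltr0n R).
  exact: lt_le_trans (expR_gt0 _) dQj.
exists th; split.
- by move=> j; rewrite /th; case: ifP => // _; rewrite ?expR_gt0// exprn_gt0.
- by move=> j; rewrite /th; case: ifP => // _; exact: size_heavy_gt0.
- move=> e e0; near=> j; have [-> _] : th j = t j /\ expR (j.+1%:R * (h - d j)) <= (size (heavy j.+1 (t j)))%:R.
    by near: j.
  rewrite expRK opprK ler_wpM2l// lerD2l; near: j; exact: dcvg.
- move=> e e0; near=> j; have [-> hj] : th j = t j /\ expR (j.+1%:R * (h - d j)) <= (size (heavy j.+1 (t j)))%:R.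
    by near: j.
  rewrite -ler_expR lnK ?posrE; last exact: lt_le_trans (expR_gt0 _) hj.
  apply: le_trans hj; rewrite ler_expR ler_wpM2l// lerB//; near: j; exact: dcvg.
Unshelve. all: by end_near. Qed.

Lemma lev_sum k : \sum_(j < k) j.+1%:R = (lev k)%:R :> R.
Proof.
elim: k => [|k IH]; first by rewrite big_ord0.
by rewrite big_ord_recr /= IH -natrD.
Qed.

Lemma near_window C e : 0 <= C -> 0 < e -> \forall k \near \oo,
  (2 * C + 1) * (lev k).+1%:R ^+ D <= expR ((lev k)%:R * e) :> R.
Proof.
move=> C0 e0.
exact: (@near_lev (fun n => (2 * C + 1) * n.+1%:R ^+ D <= expR (n%:R * e)) (pow_le_expR _ _ e0)).
Qed.

(** By [lev_le] the factor of block [j] is polynomial in [j], of degree [2 * D], so its logarithm is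
    negligible against the length [j.+1] of the block. *)
Lemma near_mult e : 0 < e -> \forall k \near \oo, mult lam D k <= expR ((lev k)%:R * e).
Proof.
move=> e0; pose y j : R := ln ((2 * L + 1) * (lev j).+1%:R ^+ D).
have y0 j : 0 < (2 * L + 1) * (lev j).+1%:R ^+ D.
  by rewrite mulr_gt0 ?exprn_gt0 ?ltr0n//; have := L_gt0; lra.
have ysmall e' : 0 < e' -> \forall j \near \oo, y j <= j.+1%:R * e'.
  move=> e'0; apply: filterS (pow_le_expR (2 * L + 1) (2 * D) e'0) => j hj.
  rewrite -ler_expR lnK ?posrE// (le_trans _ (le_trans hj _))//.
    rewrite ler_wpM2l//; first by have := L_gt0; lra.
    by rewrite exprM lerXn2r ?nnegrE ?exprn_ge0// -natrX ler_nat lev_le.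
  by rewrite ler_expR ler_pM2r// ler_nat.
apply: filterS (weighted_cesaro ysmall e0) => k.
move=> H; have -> : mult lam D k = expR (\sum_(j < k) y j).
  by rewrite expR_sum; apply: eq_bigr => j _; rewrite /y lnK ?posrE.
by rewrite ler_expR.
Qed.

Lemma near_vol (G : nat -> seq R) (h e : R) : (forall j, (0 < size (G j))%N) ->
  (forall e, 0 < e -> \forall j \near \oo, j.+1%:R * (h - e) <= ln (size (G j))%:R) ->
  0 < e -> \forall k \near \oo, expR ((lev k)%:R * (h - e)) <= vol G k.
Proof.
move=> G0 Gh e0; pose y j : R := j.+1%:R * h - ln (size (G j))%:R.
have ysmall e' : 0 < e' -> \forall j \near \oo, y j <= j.+1%:R * e'.
  by move=> e'0; apply: filterS (Gh _ e'0) => j; rewrite /y; lra.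
apply: filterS (weighted_cesaro ysmall e0) => k.
rewrite /y sumrB -mulr_suml lev_sum => H.
have -> : vol G k = expR (\sum_(j < k) ln (size (G j))%:R).
  by rewrite expR_sum; apply: eq_bigr => j _; rewrite lnK// posrE ltr0n.
by rewrite ler_expR; lra.
Qed.

Lemma near_prod (th : nat -> R) (al e : R) : (forall j, 0 < th j) ->
  (forall e, 0 < e -> \forall j \near \oo, - ln (th j) <= j.+1%:R * (al + e)) ->
  0 < e -> \forall k \near \oo, expR (- ((lev k)%:R * (al + e))) <= \prod_(j < k) th j.
Proof.
move=> th0 thal e0; pose y j : R := - ln (th j) - j.+1%:R * al.
have ysmall e' : 0 < e' -> \forall j \near \oo, y j <= j.+1%:R * e'.
  by move=> e'0; apply: filterS (thal _ e'0) => j; rewrite /y; lra.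
apply: filterS (weighted_cesaro ysmall e0) => k.
rewrite /y sumrB -mulr_suml lev_sum sumrN => H.
have -> : \prod_(j < k) th j = expR (\sum_(j < k) ln (th j)).
  by rewrite expR_sum; apply: eq_bigr => j _; rewrite lnK// posrE.
by rewrite ler_expR; lra.
Qed.

(** The first growth hypothesis fills the blocks with points that are heavy enough; the second says
    that points which are too heavy are exponentially rarer, so that the words near them form a
    summable proportion. The covering property with [psi] stands in for a measure on [K]. *)
Lemma moran_set (al h C : R) : 0 <= C ->
  (forall e, 0 < e -> Phi (al + e) (h - e)) ->
  (forall de, 0 < de -> exists2 eta, 0 < eta & \forall n \near \oo,
    (size (heavy n (expR (- (n%:R * (al - de))))))%:R <= expR (n%:R * (h - eta))) ->
  exists (K : set R) (psi : nat -> R),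
  [/\ K !=set0,
    forall x, K x -> forall e, 0 < e -> \forall k \near \oo,
      (exists d, [/\ d \in bpts lam (lev k), `|x - d| <= L * lam ^+ lev k
          & expR (- ((lev k)%:R * (al + e))) <= bmass lam (lev k) d]) /\
      (forall d, d \in bpts lam (lev k) -> `|x - d| <= C * lam ^+ lev k ->
         bmass lam (lev k) d <= expR (- ((lev k)%:R * (al - e)))),
    forall (m : nat -> nat) (x : nat -> R),
      K `<=` \bigcup_i ball (x i) (lam ^+ lev (m i)) ->
      exists N, 2^-1 <= \sum_(i < N) psi (m i)
    & forall s, s < h -> \forall k \near \oo, psi k <= expR (- ((lev k)%:R * s))].
Proof.
move=> C0 HA HB.
have [th [th0 thG thal thh]] := good_blocks HA.
pose G j := heavy j.+1 (th j).
have G_uniq j : uniq (G j) by exact: heavy_uniq.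
have G_sub j : {subset G j <= bpts lam j.+1} by exact: heavy_sub.
(* A limit point is within [L * lam ^+ lev k] of its tree point, so controlling radius [C] around
   the former requires pruning at radius [C + L] around the latter. *)
pose C1 := C + L.
have C10 : 0 <= C1 by rewrite addr_ge0// ltW.
pose W1 k : R := (2 * C1 + 1) * (lev k).+1%:R ^+ D.
pose Q e k := 2 ^+ k.+1 * ((size (heavy (lev k) (expR (- ((lev k)%:R * (al - e))))))%:R *
   (mult lam D k * W1 k)) <= vol G k.
have W10 k : 0 <= W1 k by rewrite mulr_ge0 ?exprn_ge0// addr_ge0// mulr_ge0.
have m1 k : 1 <= mult lam D k by exact: mult_ge1.
have m0 k : 0 <= mult lam D k by exact: le_trans ler01 (m1 k).
have HQ e : 0 < e -> \forall k \near \oo, Q e k.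
  move=> e0; have [eta eta0 Heta] := HB _ e0.
  (* One quarter each for the power of 2, the multiplicity, the window and the lower bound on
     [vol]. *)
  have e4 : 0 < eta / 4 by rewrite divr_gt0.
  near=> k.
  have h1 : (size (heavy (lev k) (expR (- ((lev k)%:R * (al - e))))))%:R <=
      expR ((lev k)%:R * (h - eta)) by near: k; exact: near_lev Heta.
  have h2 : mult lam D k <= expR ((lev k)%:R * (eta / 4)) by near: k; exact: near_mult.
  have h3 : W1 k <= expR ((lev k)%:R * (eta / 4)) by near: k; exact: near_window.
  have h4 : k.+1%:R * ln 2 <= (lev k)%:R * (eta / 4) :> R by near: k; exact: lev_small.
  have h5 : expR ((lev k)%:R * (h - eta / 4)) <= vol G k.
    by near: k; exact: near_vol.
  have h6 : 2 ^+ k.+1 <= expR ((lev k)%:R * (eta / 4)) :> R.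
    by rewrite -[2 in leLHS]lnK ?posrE// -expRM_natl ler_expR.
  apply: le_trans h5.
  apply: (@le_trans _ _ (expR ((lev k)%:R * (eta / 4)) * (expR ((lev k)%:R * (h - eta)) *
     (expR ((lev k)%:R * (eta / 4)) * expR ((lev k)%:R * (eta / 4)))))).
    apply: ler_pM => //; first by rewrite mulr_ge0// mulr_ge0.
    apply: ler_pM => //; first by rewrite mulr_ge0.
    exact: ler_pM.
  by rewrite -!expRD ler_expR; rewrite le_eqVlt; apply/orP; left; apply/eqP; field.
have [de [de0 decvg [k0 _ deQ]]] := diagonal_eps HQ.
(* Pruning starts at the level [k0] from which the estimates hold, with a tolerance [de k] tending
   to 0, so that one set works for every [e]. *)
pose bad k x := (k0 <= k)%N && has (fun d => `|x - d| <= C1 * lam ^+ lev k)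
   (heavy (lev k) (expR (- ((lev k)%:R * (al - de k))))).
have badle k : 2 ^+ k.+1 * (count (bad k) (tree lam G k))%:R <= vol G k.
  have [kk0|k0k] := ltnP k k0.
    rewrite (eq_count (a2 := pred0)) ?count_pred0 ?mulr0 ?ltW ?vol_gt0// => x.
    by rewrite /bad leqNgt kk0.
  apply: le_trans (deQ k k0k); rewrite ler_wpM2l ?exprn_ge0//.
  apply: (bad_count lam_gt0 lam_lt1 window) => // x.
  by move=> /andP[_ /hasP[d dh xd]]; exists d.
have hS := size_pruned thG badle.
have psiE := cover_mass lam_gt0 lam_lt1 window G_uniq G_sub thG hS.
exists (limit_set lam G bad), (psi lam D G); split.
- exact: limit_set_nonempty.
- move=> x Kx e e0; near=> k.
  have [d dS xd] := Kx k I.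
  have dV := pruned_sub_tree dS.
  split.
    exists d; split => //; first exact: tree_sub dV.
    apply: le_trans (tree_mass _ _ dV) => [|j|j c]; last 2 first.
    + exact: ltW (th0 j).
    + by rewrite mem_filter => /andP[].
    by near: k; exact: near_prod.
  have [k1 kk0] : (0 < k)%N /\ (k0 <= k)%N by split; near: k; exact: nbhs_infty_ge.
  have := pruned_good k1 dS; rewrite /bad kk0 /= => /hasPn nobad d' d'b xd'.
  have {}nobad : d' \notin heavy (lev k) (expR (- ((lev k)%:R * (al - de k)))).
    apply/negP => /nobad; rewrite -ltNge ltNge => /negP[].
    have -> : d - d' = (x - d') - (x - d) by ring.
    by rewrite (le_trans (ler_normB _ _))// mulrDl lerD.
  move: nobad; rewrite mem_filter d'b andbT -ltNge => /ltW /le_trans; apply.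
  by rewrite ler_expR lerN2 ler_wpM2l// lerB//; near: k; exact: decvg.
- move=> m x; exact: psiE.
- move=> s sh.
  pose e := (h - s) / 3.
  have e0 : 0 < e by rewrite divr_gt0// subr_gt0.
  near=> k.
  have h2 : mult lam D k <= expR ((lev k)%:R * e) by near: k; exact: near_mult.
  have h3 : (2 * (1 + L) + 1) * (lev k).+1%:R ^+ D <= expR ((lev k)%:R * e).
    by near: k; apply: near_window => //; have := L_gt0; lra.
  have h5 : expR ((lev k)%:R * (h - e)) <= vol G k by near: k; exact: near_vol.
  rewrite /psi ler_pdivrMr ?vol_gt0//.
  apply: le_trans (ler_wpM2l (expR_ge0 _) h5).
  apply: le_trans (ler_pM (m0 k) _ h2 h3) _.
    by rewrite mulr_ge0 ?exprn_ge0//; have := L_gt0; lra.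
  by rewrite -!expRD ler_expR /e; rewrite le_eqVlt; apply/orP; left; apply/eqP; field.
Unshelve. all: by end_near. Qed.
End MoranSet.

(** * Hausdorff measure of level sets *)

Lemma near_right0P (R : realType) (P : R -> Prop) :
  (\forall r \near 0^'+, P r) <-> exists2 d, 0 < d & forall r, 0 < r < d -> P r.
Proof.
split.
  move=> [d /= d0 H]; exists d => // r /andP[r0 rd]; apply: H => //=.
  by rewrite /ball_ /= sub0r normrN gtr0_norm.
move=> [d d0 H]; exists d => //= r; rewrite /ball_ /= sub0r normrN => rd r0.
by apply: H; rewrite r0 (le_lt_trans (ler_norm _)).
Qed.

Section LogQuotient.
Context (R : realType).
Implicit Types (m : \bar R) (r a : R).

Lemma lne_le m a : (0 <= m)%E -> (lne m <= a%:E)%E = (m <= (expR a)%:E)%E.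
Proof.
move=> m0; rewrite -lee_expeR lneK//= in_itv/= m0 leey//.
Qed.

Lemma lne_ge m a : (0 <= m)%E -> (a%:E <= lne m)%E = ((expR a)%:E <= m)%E.
Proof.
move=> m0; rewrite -lee_expeR lneK//= in_itv/= m0 leey//.
Qed.

Lemma log_quot_ge m r a : (0 <= m)%E -> 0 < r < 1 ->
  (a%:E <= lne m * ((ln r)^-1)%:E)%E = (m <= (expR (a * ln r))%:E)%E.
Proof.
move=> m0 r01; have l0 : ln r < 0 by rewrite ln_lt0.
by rewrite lee_ndivlMr// -EFinM lne_le.
Qed.

Lemma log_quot_le m r a : (0 <= m)%E -> 0 < r < 1 ->
  (lne m * ((ln r)^-1)%:E <= a%:E)%E = ((expR (a * ln r))%:E <= m)%E.
Proof.
move=> m0 r01; have l0 : ln r < 0 by rewrite ln_lt0.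
by rewrite lee_ndivrMr// -EFinM lne_ge.
Qed.

Lemma level_setP (mu : {measure set (measurableTypeR R) -> \bar R}) (al x : R) :
  level_set mu al x <-> forall e, 0 < e -> exists2 d, 0 < d & forall r, 0 < r < d ->
    ((expR ((al + e) * ln r))%:E <= mu (closed_ball x r) <= (expR ((al - e) * ln r))%:E)%E.
Proof.
split.
  move=> /fine_cvgP[fin cv] e e0.
  move: cv => /cvgrPdist_le/(_ e e0)/(filterI fin)/near_right0P[d d0 H].
  exists (Num.min d 1); first by rewrite lt_min d0 ltr01.
  move=> r; rewrite lt_min => /andP[r0 /andP[rd r1]].
  have r01 : 0 < r < 1 by rewrite r0.
  have [|fr /=] := H r; first by rewrite r0.
  rewrite ler_distlC => /andP[h1 h2].
  rewrite -log_quot_le// -log_quot_ge//.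
  by rewrite -(fineK fr) !lee_fin h1 h2.
move=> H; apply/fine_cvgP.
have bnd e : 0 < e -> \forall r \near 0^'+,
   ((al - e)%:E <= lne (mu (closed_ball x r)) * ((ln r)^-1)%:E <= (al + e)%:E)%E.
  move=> e0; have [d d0 Hd] := H e e0; apply/near_right0P.
  exists (Num.min d 1); first by rewrite lt_min d0 ltr01.
  move=> r; rewrite lt_min => /andP[r0 /andP[rd r1]].
  have r01 : 0 < r < 1 by rewrite r0.
  have := Hd r; rewrite r0 rd => /(_ isT) /andP[h1 h2].
  by rewrite log_quot_le// log_quot_ge// h1 h2.
have fin : \forall r \near 0^'+,
    (lne (mu (closed_ball x r)) * ((ln r)^-1)%:E)%E \is a fin_num.
  have := bnd 1 ltr01; apply: filterS => r /andP[h1 h2].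
  by rewrite fin_numE -ltNye -ltey (lt_le_trans _ h1) ?ltNyr//= (le_lt_trans h2)// ltry.
split; first exact: fin.
apply/cvgrPdist_le => e e0.
have := fin; have := bnd e e0; apply: filterS2 => r h fr.
by move: h; rewrite -(fineK fr) !lee_fin /= ler_distlC.
Qed.

(** Off the support small balls are null, whereas in the level set they have positive lower bounds.
    This makes points of the level set admissible as centres in [Theta]. *)
Lemma level_set_msupport (mu : {measure set (measurableTypeR R) -> \bar R}) al :
  level_set mu al `<=` msupport mu.
Proof.
move=> x /level_setP/(_ _ ltr01)[d d0 H] F [Fc F0]; apply: contrapT => xF.
have oF : open (~` F) by exact: closed_openC.
have [e /= e0 He] := open_subball oF xF.
pose r := Num.min (e / 2) d / 2.
have m0 : 0 < Num.min (e / 2) d by rewrite lt_min d0 divr_gt0.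
have r0 : 0 < r by rewrite divr_gt0.
have rd : r < d.
  have : Num.min (e / 2) d <= d by rewrite ge_min lexx orbT.
  by rewrite /r; lra.
have re : r < e.
  have : Num.min (e / 2) d <= e / 2 by rewrite ge_min lexx.
  by rewrite /r; lra.
have := H r; rewrite r0 rd => /(_ isT)/andP[+ _].
apply/negP; rewrite -ltNge (le_lt_trans (_ : _ <= 0)%E) ?lte_fin ?expR_gt0//.
rewrite -F0 le_measure ?inE//; first exact: measurable_closed_ball.
  by apply: measurableC; exact: closed_measurable.
have r2 : 0 < 2 * r by rewrite mulr_gt0.
apply: subset_trans (He (2 * r) _ r2); last first.
  rewrite /ball_ /= sub0r normrN gtr0_norm//.
  have : Num.min (e / 2) d <= e / 2 by rewrite ge_min lexx.
  by rewrite /r; lra.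
by apply: closed_ball_subset => //; lra.
Qed.

End LogQuotient.

(** * Positive Hausdorff measure from a mass distribution *)

Section HausdorffLower.
Context (R : realType).

Lemma diam_ge (U : set R) x y : U x -> U y -> (`|x - y|%:E <= diam U)%E.
Proof.
move=> Ux Uy; rewrite /diam ifF; last by apply/negbTE/set0P; exists x.
by apply: ereal_sup_ubound; exists (x, y).
Qed.

Lemma diam_ge0 (U : set R) : (0 <= diam U)%E.
Proof.
have [->|/set0P[x Ux]] := eqVneq U set0; first by rewrite /diam eqxx.
by apply: le_trans (diam_ge Ux Ux); rewrite lee_fin.
Qed.

Lemma diam_pow_ge0 s (U : set R) : (0 <= diam_pow s U)%E.
Proof. by rewrite /diam_pow; case: ifP => // _; exact: poweR_ge0. Qed.

(** Each covering set of diameter [r] is replaced by a ball of radius [rho n] with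
    [rho n.+1 <= r < rho n], whose weight [psi n] is at most [rho n.+1]^ s[, hence at most]r [^ s].
    Sets of diameter 0 get tiny balls of total weight at most 1/4, which leaves 1/4 of the one half
    that [psi] must reach. *)
Lemma hausdorff_measure_gt0 (E K : set R) (rho psi : nat -> R) (s : R) :
  0 <= s -> K `<=` E ->
  (forall (m : nat -> nat) (x : nat -> R),
      K `<=` \bigcup_i ball (x i) (rho (m i)) ->
      exists N, 2^-1 <= \sum_(i < N) psi (m i)) ->
  (forall m, 0 < rho m) -> (forall m n, (m <= n)%N -> rho n <= rho m) ->
  (forall e, 0 < e -> \forall m \near \oo, rho m <= e) ->
  (forall e, 0 < e -> \forall m \near \oo, psi m <= e) ->
  (\forall m \near \oo, psi m <= rho m.+1 `^ s) ->
  (0 < hausdorff_measure s E)%E.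
Proof.
move=> s0 KE cov rho0 rhodec rhocvg psicvg [m1 _ psile].
(* Sets this small are finer than scale [m1], so the index found below exceeds [m1] and its
   predecessor is still in the range of [psile]. *)
pose de := rho m1 / 2.
have de0 : 0 < de by rewrite divr_gt0.
have dem1 : de < rho m1 by rewrite /de; have := rho0 m1; lra.
apply: (@lt_le_trans _ _ (4^-1)%:E); first by rewrite lte_fin.
apply: le_trans (ereal_sup_ubound _) => /=; last by exists de.
apply: le_ereal_inf_tmp => _ [U [EU dU] <-].
have pick i : exists p : nat * R, U i `<=` ball p.2 (rho p.1) /\
    ((psi p.1)%:E <= diam_pow s (U i) + (2^-1 ^+ i.+3)%:E)%E.
  have e0 : 0 < 2^-1 ^+ i.+3 :> R by rewrite exprn_gt0.
  have [m2 _ psim2] := psicvg _ e0.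
  have pm2 : ((psi m2)%:E <= diam_pow s (U i) + (2^-1 ^+ i.+3)%:E)%E.
    rewrite -[leLHS]add0e leeD ?diam_pow_ge0// lee_fin.
    by apply: psim2 => /=.
  have [U0|/set0P[x Ux]] := eqVneq (U i) set0.
    by exists (m2, 0) => /=; split => //; rewrite U0.
  have := dU i; case dE : (diam (U i)) => [r| |] //; last first.
    by have := diam_ge0 (U i); rewrite dE.
  rewrite lee_fin => rde.
  have r0 : 0 <= r by rewrite -lee_fin -dE diam_ge0.
  have Ur y : U i y -> `|x - y| <= r.
    by move=> Uy; rewrite -lee_fin -dE diam_ge.
  have [r00|rN0] := eqVneq r 0.
    exists (m2, x); split => //= y /Ur; rewrite r00 normr_le0 subr_eq0 => /eqP <-.
    exact: ballxx.
  have r_gt0 : 0 < r by rewrite lt_neqAle eq_sym rN0.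
  have ex : exists n, rho n <= r.
    by have [n _ /(_ n (leqnn n))] := rhocvg r r_gt0; exists n.
  case: (ex_minnP ex) => n rn minn.
  have m1n : (m1 < n)%N.
    rewrite ltnNge; apply/negP => /rhodec; apply/negP; rewrite -ltNge.
    exact: le_lt_trans rn (le_lt_trans rde dem1).
  case: n m1n rn minn => // n m1n rn minn.
  exists (n, x); split => /=.
    move=> y /Ur xy; rewrite /ball /= (le_lt_trans xy)// ltNge; apply/negP => /minn.
    by rewrite ltnn.
  rewrite /diam_pow ifF; last by apply/negbTE/set0P; exists x.
  rewrite dE -[leLHS]adde0 leeD ?lee_fin ?(ltW e0)//.
  apply: le_trans (psile n _) _ => //.
  by rewrite ge0_ler_powR ?nnegrE// ltW.
have [p pP] := choice pick.
have [|N hN] := cov (fun i => (p i).1) (fun i => (p i).2).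
  by move=> x /KE/EU[i _ Ui]; exists i => //; exact: (pP i).1.
have half (M : nat) : \sum_(i < M) 2^-1 ^+ i.+3 <= 4^-1 :> R.
  have -> : \sum_(i < M) 2^-1 ^+ i.+3 = 4^-1 - 4^-1 * 2^-1 ^+ M :> R.
    elim: M => [|M IH]; first by rewrite big_ord0 expr0 mulr1 subrr.
    by rewrite big_ord_recr /= IH !exprS; field.
  by rewrite gerBl mulr_ge0// exprn_ge0.
have : ((2^-1)%:E <= \sum_(0 <= i <oo) diam_pow s (U i) + (4^-1)%:E)%E.
  apply: (@le_trans _ _ (\sum_(i < N) (diam_pow s (U i) + (2^-1 ^+ i.+3)%:E))%E).
    apply: le_trans (_ : ((\sum_(i < N) psi (p i).1)%:E <= _)%E); first by rewrite lee_fin.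
    by rewrite -sumEFin; apply: lee_sum => i _; exact: (pP i).2.
  rewrite big_split /= leeD//; last by rewrite sumEFin lee_fin half.
  rewrite -(big_mkord xpredT (fun i => diam_pow s (U i))).
  by apply: nneseries_lim_ge => i _ _; exact: diam_pow_ge0.
rewrite -leeBlDr// -EFinB; apply: le_trans; rewrite lee_fin; lra.
Qed.

End HausdorffLower.

(** * Covers and packings for the upper bound on the dimension *)

Section HausdorffUpper.
Context (R : realType).
Implicit Types (mu : {measure set (measurableTypeR R) -> \bar R}) (A E : set R).

Lemma hausdorff_premeasure_ge0 s de A : (0 <= hausdorff_premeasure s de A)%E.
Proof.
apply: le_ereal_inf_tmp => _ [U _ <-]; apply: nneseries_ge0 => i _ _.
exact: diam_pow_ge0.
Qed.

(** Countable subadditivity: piece [k] is covered at cost [eta / 2 ^ k.+1], and the covers are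
    merged into one sequence along a bijection between [nat] and [nat * nat]. *)
Lemma hausdorff_measure_eq0 (s : R) E (A : nat -> set R) : E `<=` \bigcup_k A k ->
  (forall k de eta, 0 < de -> 0 < eta -> exists U : nat -> set R,
    [/\ A k `<=` \bigcup_i U i, forall i, (diam (U i) <= de%:E)%E
      & (\sum_(0 <= i <oo) diam_pow s (U i) <= eta%:E)%E]) ->
  hausdorff_measure s E = 0%E.
Proof.
move=> EA cov; apply/eqP; rewrite eq_le; apply/andP; split; last first.
  apply: le_trans (hausdorff_premeasure_ge0 s 1 E) _.
  by apply: ereal_sup_ubound; exists 1 => /=.
apply: ge_ereal_sup => _ [de /= de0 <-].
apply/lee_addgt0Pr => eta eta0; rewrite add0e.
have cov' k : exists U : nat -> set R,
    [/\ A k `<=` \bigcup_i U i, forall i, (diam (U i) <= de%:E)%E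
      & (\sum_(0 <= i <oo) diam_pow s (U i) <= (eta / (2 ^ k.+1)%:R)%:E)%E].
  by apply: cov => //; rewrite divr_gt0// ltr0n expn_gt0.
have [U HU] := choice cov'.
have /card_esym/ppcard_eqP[f] := card_nat2.
apply: (@le_trans _ _ (\sum_(0 <= i <oo) diam_pow s (uncurry U (f i)))%E).
  apply: ereal_inf_lbound; exists (uncurry U \o f) => //; split.
    move=> x /EA[k _ /(let: And3 h _ _ := HU k in h)[i _ Ux]].
    exists (f^-1%FUN (k, i)) => //=.
    by rewrite invK ?inE.
  by move=> i /=; case: (f i) => k j /=; have [_ h _] := HU k.
rewrite nneseries_esumT; last by move=> i; exact: diam_pow_ge0.
rewrite -(@reindex_esum _ _ _ setT setT f (fun p => diam_pow s (uncurry U p)))//.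
have -> : (\esum_(p in [set: nat * nat]) diam_pow s (uncurry U p) =
    \esum_(k in [set: nat]) \esum_(i in [set: nat]) diam_pow s (U k i))%E.
  rewrite esum_esum//=; last by move=> *; exact: diam_pow_ge0.
  rewrite (_ : [set: nat] `*`` _ = setT); last by apply/seteqP; split.
  by apply: eq_esum => -[].
apply: le_trans (_ : \esum_(k in [set: nat]) (eta / (2 ^ k.+1)%:R)%:E <= _)%E.
  apply: le_esum => k _; rewrite -nneseries_esumT; last by move=> i; exact: diam_pow_ge0.
  by have [] := HU k.
rewrite -nneseries_esumT; last by move=> k; rewrite lee_fin divr_ge0// ltW.
have := @epsilon_trick R (fun=> 0%E) eta xpredT (fun=> lexx _) (ltW eta0).
move=> H; apply: le_trans (le_trans _ H) _; last by rewrite eseries0// add0e.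
rewrite le_eqVlt; apply/orP; left; apply/eqP.
by apply: eq_eseriesr => k _; rewrite add0e.
Qed.

Lemma finite_cover_series (s : R) (t : seq R) (r : R) : 0 <= s -> 0 < r ->
  exists U : nat -> set R, [/\ [set x | exists2 d, d \in t & `|x - d| <= 2 * r] `<=` \bigcup_i U i,
    forall i, (diam (U i) <= (4 * r)%:E)%E
    & (\sum_(0 <= i <oo) diam_pow s (U i) <= ((size t)%:R * (4 * r) `^ s)%:E)%E].
Proof.
move=> s0 r0.
(* The finite cover is continued by empty sets, to which [diam_pow] gives weight 0 even when
   [s = 0]. *)
pose U i : set R := if (i < size t)%N then closed_ball (nth 0 t i) (2 * r) else set0.
have r2 : 0 < 2 * r by rewrite mulr_gt0.
have dU (d : R) : (diam (closed_ball d (2 * r)) <= (4 * r)%:E)%E.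
  rewrite /diam; case: ifP => _; first by rewrite lee_fin mulr_ge0// ltW.
  apply: ge_ereal_sup => _ [[x y] /= [+ +] <-].
  rewrite closed_ballE// /closed_ball_ /= => dx dy; rewrite lee_fin.
  have -> : x - y = (d - y) - (d - x) by ring.
  by rewrite (le_trans (ler_normB _ _))//; lra.
exists U; split.
- move=> x [d dt xd]; exists (index d t) => //; rewrite /U index_mem dt nth_index//.
  by rewrite closed_ballE// /closed_ball_ /= distrC.
- by move=> i; rewrite /U; case: ifP => _ //; rewrite /diam eqxx lee_fin mulr_ge0// ltW.
- rewrite (nneseries_split _ (size t)); last by move=> *; exact: diam_pow_ge0.
  rewrite [X in (_ + X)%E]eseries0 ?adde0; last first.
    by move=> i /= ti _; rewrite /U ltnNge ti /= /diam_pow eqxx.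
  rewrite add0n big_nat; apply: le_trans (_ : (\sum_(0 <= i < size t) ((4 * r) `^ s)%:E <= _)%E).
    rewrite [leRHS]big_nat; apply: lee_sum => i /andP[_ it].
    rewrite /U it /diam_pow; case: ifP => _; first by rewrite lee_fin powR_ge0.
    have := dU (nth 0 t i); have := diam_ge0 (closed_ball (nth 0 t i) (2 * r)).
    case: (diam _) => [x| |]//; rewrite !lee_fin => x0 x4.
    by rewrite ge0_ler_powR ?nnegrE// mulr_ge0// ltW.
  by rewrite sumEFin lee_fin big_const_nat iter_addr_0 subn0 [leRHS]mulr_natl.
Qed.

(** The strict inequality makes the closed balls of radius [r] disjoint. *)
Definition spaced (r : R) (s : seq R) :=
  uniq s /\ {in s &, forall x y, x != y -> 2 * r < `|x - y|}.

Lemma maximal_packing A (r M : R) : 0 < r ->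
  (forall s, (forall x, x \in s -> A x) -> spaced r s -> (size s)%:R <= M) ->
  exists s, [/\ forall x, x \in s -> A x, spaced r s
    & A `<=` [set x | exists2 d, d \in s & `|x - d| <= 2 * r]].
Proof.
move=> r0 bnd.
pose P n := `[< exists s, [/\ forall x, x \in s -> A x, spaced r s & size s = n] >].
have exP : exists n, P n by exists 0%N; apply/asboolP; exists [::]; split.
have Pb n : P n -> (n <= Num.truncn M)%N.
  move=> /asboolP[s [sA ss <-]]; have := bnd _ sA ss => h.
  by rewrite truncn_ge_nat// (le_trans _ h).
case: (ex_maxnP exP Pb) => n /asboolP[s [sA ss sn]] nmax.
exists s; split => // x Ax; apply: contrapT => hN.
have far d : d \in s -> 2 * r < `|x - d|.
  by move=> ds; rewrite ltNge; apply/negP => h; apply: hN; exists d.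
have xs : x \notin s.
  by apply/negP => /far; rewrite subrr normr0; apply/negP; rewrite -leNgt mulr_ge0// ltW.
suff /nmax : P n.+1 by rewrite ltnn.
apply/asboolP; exists (x :: s); split; last by rewrite /= sn.
  by move=> y; rewrite inE => /predU1P[->//|]; exact: sA.
split; first by rewrite /= xs ss.1.
move=> y z; rewrite !inE => /predU1P[->|ys] /predU1P[->|zs]; rewrite ?eqxx//.
- by move=> _; exact: far.
- by move=> _; rewrite distrC; exact: far.
- exact: ss.2.
Qed.

Lemma Theta_ge mu (q r : R) (s : seq R) : 0 < r ->
  (forall x, x \in s -> msupport mu x) -> spaced r s ->
  (\sum_(x <- s) (mu (closed_ball x r) `^ q)%E <= Theta mu q r)%E.
Proof.
move=> r0 ssup [us sep].
have -> : (\sum_(x <- s) (mu (closed_ball x r) `^ q) = \esum_(x in [set` s]) (mu (closed_ball x r) `^ q))%E.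
  rewrite (fsbig_seq _ _ us).
  by rewrite esum_fset => [//||x _]; [exact: finite_seq|exact: poweR_ge0].
apply: ereal_sup_ubound; exists [set` s] => //; split => //.
apply/trivIsetP => x y /= xs ys xy; rewrite -subset0 => z [].
rewrite !closed_ballE// /closed_ball_ /= => xz yz.
have := sep x y xs ys xy; apply/negP; rewrite -leNgt.
have -> : x - y = (x - z) - (y - z) by ring.
by rewrite (le_trans (ler_normB _ _))//; lra.
Qed.

End HausdorffUpper.

(** * The dimension of a level set is bounded by the spectrum *)

Section SpectrumUpper.
Context (R : realType) (mu : {measure set (measurableTypeR R) -> \bar R}).

Lemma Theta_ge0 (q r : R) : (0 <= Theta mu q r)%E.
Proof.
apply: ereal_sup_ubound; exists set0; first by split => //; exact: trivIset_set0.
by rewrite esum_set0.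
Qed.

Lemma Lq_spectrum_lt (q a : R) : (a%:E < Lq_spectrum mu q)%E ->
  exists2 d, 0 < d & forall r, 0 < r < d -> (Theta mu q r <= (expR (a * ln r))%:E)%E.
Proof.
rewrite /Lq_spectrum limf_einfE => /ereal_sup_gt[_ [V V0 <-] aV].
move: V0 => /near_right0P[d d0 HV]; exists (Num.min d 1); first by rewrite lt_min d0 ltr01.
move=> r; rewrite lt_min => /andP[r0 /andP[rd r1]].
rewrite -log_quot_ge ?Theta_ge0 ?r0//.
apply: le_trans (ltW aV) _; apply: ereal_inf_lbound; exists r => //.
by apply: HV; rewrite r0.
Qed.

Lemma Lq_spectrum_ge (q a d : R) : 0 < d ->
  (forall r, 0 < r < d -> (Theta mu q r <= (expR (a * ln r))%:E)%E) ->
  (a%:E <= Lq_spectrum mu q)%E.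
Proof.
move=> d0 H; rewrite /Lq_spectrum limf_einfE.
pose V := [set r | 0 < r < Num.min d 1].
apply: le_trans (ereal_sup_ubound _) => /=; last first.
  exists V => //; apply/near_right0P; exists (Num.min d 1); last by [].
  by rewrite lt_min d0 ltr01.
apply: le_ereal_inf_tmp => _ [r + <-]; rewrite /V /= lt_min => /andP[r0 /andP[rd r1]].
by rewrite log_quot_ge ?Theta_ge0 ?r0// H// r0.
Qed.

Lemma Lq_spectrum_le (q a : R) :
  (forall d, 0 < d -> exists2 r, 0 < r < d & ((expR (a * ln r))%:E <= Theta mu q r)%E) ->
  (Lq_spectrum mu q <= a%:E)%E.
Proof.
move=> H; rewrite /Lq_spectrum limf_einfE; apply: ge_ereal_sup => _ [V V0 <-].
move: V0 => /near_right0P[d d0 HV].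
have [|r] := H (Num.min d 1); first by rewrite lt_min d0 ltr01.
rewrite lt_min => /andP[r0 /andP[rd r1]] Hr.
apply: le_trans (ereal_inf_lbound _) _; first by exists r => //; apply: HV; rewrite r0.
by rewrite log_quot_le ?Theta_ge0 ?r0.
Qed.

(** The sign of [q] decides which of the two bounds on [m] is used; the error [|q| * e] serves both
    cases. *)
Lemma poweR_bound (m : \bar R) (al e l q : R) : l <= 0 -> 0 <= e ->
  ((expR ((al + e) * l))%:E <= m <= (expR ((al - e) * l))%:E)%E ->
  ((expR ((al * q + `|q| * e) * l))%:E <= m `^ q)%E.
Proof.
move=> l0 e0; case: m => [m| |] //=; rewrite ?andbF// !lee_fin => /andP[h1 h2].
have m0 : 0 < m by rewrite (lt_le_trans _ h1)// expR_gt0.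
rewrite -[m]lnK ?posrE// ler_expR in h1; rewrite -[m]lnK ?posrE// ler_expR in h2.
rewrite /powR gt_eqF// ler_expR.
have [q0|q0] := lerP 0 q.
  by rewrite (ger0_norm q0) (_ : _ * l = q * ((al + e) * l)); [exact: ler_wpM2l|ring].
by rewrite (ltr0_norm q0) (_ : _ * l = q * ((al - e) * l)); [apply: ler_wnM2l => //; exact: ltW|ring].
Qed.

Lemma hausdorff_dim_level_set_le (al q : R) : level_set mu al !=set0 ->
  (hausdorff_dim (level_set mu al) <= (al * q)%:E - Lq_spectrum mu q)%E.
Proof.
move=> [x0 Ex0].
have q1 : 0 < `|q| + 1 by rewrite ltr_wpDl.
have qe (e : R) : 0 < e -> 0 < e / (`|q| + 1) /\ `|q| * (e / (`|q| + 1)) <= e.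
  move=> e0; split; first by rewrite divr_gt0.
  by rewrite mulrA ler_pdivrMr// mulrC ler_wpM2l ?ltW//; lra.
(* A single ball around [x0] gives this. It excludes the value [+oo] and makes the exponent [s]
   below nonnegative, as [hausdorff_dim] requires. *)
have Lle : (Lq_spectrum mu q <= (al * q)%:E)%E.
  apply/lee_addgt0Pr => e e0; rewrite -EFinD; apply: Lq_spectrum_le => d d0.
  have [e'0 e'le] := qe e e0.
  have [d1 d10 Hd1] := (level_setP mu al x0).1 Ex0 _ e'0.
  pose r := Num.min (Num.min d d1) 1 / 2.
  have m0 : 0 < Num.min (Num.min d d1) 1 by rewrite !lt_min d0 d10 ltr01.
  have [rd rd1 r1] : [/\ r < d, r < d1 & r < 1].
    have h1 : Num.min (Num.min d d1) 1 <= d by rewrite !ge_min lexx.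
    have h2 : Num.min (Num.min d d1) 1 <= d1 by rewrite !ge_min lexx orbT.
    have h3 : Num.min (Num.min d d1) 1 <= 1 by rewrite !ge_min lexx orbT.
    by split; rewrite /r; lra.
  have r0 : 0 < r by rewrite divr_gt0.
  exists r; first by rewrite r0.
  have l0 : ln r <= 0 by rewrite ln_le0// ltW.
  apply: (@le_trans _ _ (mu (closed_ball x0 r) `^ q)%E); last first.
    have := @Theta_ge _ mu q r [:: x0] r0; rewrite big_seq1; apply.
      by move=> x; rewrite inE => /eqP ->; exact: level_set_msupport Ex0.
    by split => // x y; rewrite !inE => /eqP -> /eqP ->; rewrite eqxx.
  apply: le_trans (poweR_bound _ l0 (ltW e'0) (Hd1 r _)); last by rewrite r0.
  by rewrite lee_fin ler_expR ler_wnM2r// lerD2l.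
case E : (Lq_spectrum mu q) Lle => [t| |] // tle; last by rewrite /= addey ?leey.
rewrite lee_fin in tle.
rewrite -EFinB; apply/lee_addgt0Pr => e e0; rewrite -EFinD.
set s := al * q - t + e.
have s0 : 0 <= s by rewrite /s; lra.
apply: ereal_inf_lbound; exists s => //; split => //.
have e3 : 0 < e / 3 by rewrite divr_gt0.
have [e'0 e'le] := qe _ e3; set e' := e / 3 / _ in e'0 e'le.
have [|d1 d10 HTheta] := @Lq_spectrum_lt q (t - e / 3).
  by rewrite E lte_fin; lra.
(* The scale below which the mass estimate holds varies with the point; on each of these countably
   many pieces it is uniform. *)
pose A k := [set x | level_set mu al x /\ forall r, 0 < r < k.+1%:R^-1 ->
  ((expR ((al + e') * ln r))%:E <= mu (closed_ball x r) <= (expR ((al - e') * ln r))%:E)%E].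
apply: (@hausdorff_measure_eq0 _ _ _ A).
  move=> x Ex; have [d d0 Hd] := (level_setP mu al x).1 Ex _ e'0.
  exists (Num.truncn d^-1) => //; split => // r /andP[r0 rk]; apply: Hd; rewrite r0/=.
  apply: lt_le_trans rk _; rewrite -[leRHS]invrK lef_pV2 ?posrE ?invr_gt0//.
  by rewrite ltW// truncnS_gt.
move=> k de eta de0 eta0.
have e30 : 0 < e / 3 by [].
pose c := ln eta - s * ln 4.
have [r [r0 r1 [rd1 rk] rde rc]] : exists r : R, [/\ 0 < r, r < 1, r < d1 /\ r < k.+1%:R^-1,
    4 * r <= de & e / 3 * ln r <= c].
  pose M := Num.min (Num.min d1 k.+1%:R^-1) (Num.min (Num.min (de / 4) 1) (expR (c / (e / 3)))).
  have M0 : 0 < M by rewrite !lt_min d10 invr_gt0 ltr0n divr_gt0// ltr01 expR_gt0.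
  have h1 : M <= d1 by rewrite !ge_min lexx.
  have h2 : M <= k.+1%:R^-1 by rewrite !ge_min lexx orbT.
  have h3 : M <= de / 4 by rewrite !ge_min lexx !orbT.
  have h4 : M <= 1 by rewrite !ge_min lexx !orbT.
  have h5 : M <= expR (c / (e / 3)) by rewrite !ge_min lexx !orbT.
  exists (M / 2); split; [lra|lra| |lra|].
    by split; [lra|apply: lt_le_trans h2; lra].
  rewrite mulrC -ler_pdivlMr// -ler_expR lnK ?posrE ?divr_gt0//.
  by apply: le_trans h5; lra.
have l0 : ln r <= 0 by rewrite ln_le0// ltW.
have bnd u : (forall x, x \in u -> A k x) -> spaced r u ->
    (size u)%:R <= expR ((t - e / 3 - (al * q + `|q| * e')) * ln r).
  move=> uA usep.
  have h1 : (\sum_(x <- u) (mu (closed_ball x r) `^ q)%E <= (expR ((t - e / 3) * ln r))%:E)%E.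
    apply: le_trans (Theta_ge q r0 _ usep) (HTheta r _); last by rewrite r0.
    by move=> x /uA[/level_set_msupport].
  have h2 : (\sum_(x <- u) (expR ((al * q + `|q| * e') * ln r))%:E <=
      \sum_(x <- u) (mu (closed_ball x r) `^ q))%E.
    rewrite big_seq [leRHS]big_seq; apply: lee_sum => x /uA[_ Hx].
    by apply: (poweR_bound _ l0 (ltW e'0)); apply: Hx; rewrite r0.
  have h3 : (size u)%:R * expR ((al * q + `|q| * e') * ln r) <= expR ((t - e / 3) * ln r).
    have := le_trans h2 h1.
    by rewrite sumEFin lee_fin big_const_seq count_predT iter_addr_0 -[leLHS]mulr_natl.
  by rewrite mulrBl expRD expRN ler_pdivlMr ?expR_gt0.
have [u [uA usep cov]] := maximal_packing r0 bnd.
have [U [AU dU sU]] := finite_cover_series u s0 r0.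
exists U; split.
- by apply: subset_trans AU.
- by move=> i; apply: le_trans (dU i) _; rewrite lee_fin.
- apply: le_trans sU _; rewrite lee_fin.
  apply: le_trans (ler_wpM2r (powR_ge0 _ _) (bnd u uA usep)) _.
  rewrite /powR gt_eqF ?mulr_gt0// lnM ?posrE// -expRD -[leRHS]lnK ?posrE// ler_expR.
  move: rc; rewrite /c -lerBlDr opprK => rc.
  apply: le_trans rc; rewrite mulrDr addrCA addrC lerD2r -mulrDl /s.
  rewrite [leLHS](_ : _ = (e / 3 + (e / 3 - `|q| * e')) * ln r); last by field.
  by rewrite mulrDl gerDl mulr_ge0_le0// subr_ge0.
Qed.

End SpectrumUpper.

(** * The L^q spectrum *)

(** The heaviest point is kept and everything within [rho] of it is deleted: at most [K] points,
    none heavier. The rest is treated in the same way. *)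
Lemma greedy_separated (R : realType) (X : seq R) (w : R -> R) (rho K : R) :
  0 <= rho -> 0 <= K -> (forall x, 0 <= w x) -> uniq X ->
  (forall x, x \in X -> (count (fun y => `|y - x| <= rho)%R X)%:R <= K) ->
  exists Y, [/\ {subset Y <= X}, uniq Y,
    {in Y &, forall x y, x != y -> rho < `|x - y|}
    & \sum_(x <- X) w x <= K * \sum_(y <- Y) w y].
Proof.
move=> rho0 K0 w0; have [n] := ubnP (size X); elim: n X => // n IH X sX uX cX.
have [->|XN0] := eqVneq X [::].
  by exists [::]; split => //; rewrite !big_nil mulr0.
have [x xX xmax] : exists2 x, x \in X & forall y, y \in X -> w y <= w x.
  case: X XN0 {sX uX cX} => // a X _; elim: X a => [|b X IHX] a.
    by exists a; rewrite ?mem_head// => y; rewrite inE => /eqP ->.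
  have [x xb xm] := IHX b; have [wab|wba] := leP (w a) (w x).
    exists x; first by rewrite inE xb orbT.
    by move=> y; rewrite inE => /predU1P[->//|]; exact: xm.
  exists a; first by rewrite mem_head.
  move=> y; rewrite inE => /predU1P[->//|/xm yx]; exact: le_trans yx (ltW wba).
pose near y := `|y - x| <= rho.
pose X' := [seq y <- X | ~~ near y].
have nx : near x by rewrite /near subrr normr0.
have sX' : (size X' < n)%N.
  rewrite -ltnS (leq_trans _ sX)// ltnS size_filter -(count_predC near X) -[ltnLHS]add0n ltn_add2r.
  by rewrite -has_count; apply/hasP; exists x.
have [|y|Y [YX' uY sepY sumY]] := IH X' sX'.
- exact: filter_uniq.
- rewrite mem_filter => /andP[_ /cX]; apply: le_trans; rewrite ler_nat.
  by rewrite count_filter; apply: sub_count => z /andP[].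
have YX : {subset Y <= X} by move=> y /YX'; rewrite mem_filter => /andP[].
have Yfar y : y \in Y -> rho < `|y - x|.
  by move=> /YX'; rewrite mem_filter -ltNge => /andP[].
exists (x :: Y); split.
- by move=> y; rewrite inE => /predU1P[->|/YX].
- by rewrite /= uY andbT; apply/negP => /Yfar; rewrite subrr normr0 ltNge rho0.
- move=> y z; rewrite !inE => /predU1P[->|yY] /predU1P[->|zY]; rewrite ?eqxx//.
  + by move=> _; rewrite distrC; exact: Yfar.
  + by move=> _; exact: Yfar.
  + exact: sepY.
- rewrite big_cons mulrDr (bigID near)/= lerD//.
    apply: le_trans (_ : \sum_(y <- X | near y) w x <= _).
      by rewrite big_seq_cond [leRHS]big_seq_cond; apply: ler_sum => y /andP[/xmax].
    rewrite -big_filter big_const_seq count_predT iter_addr_0 size_filter -[leLHS]mulr_natl.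
    by rewrite ler_wpM2r// cX.
  by rewrite -big_filter.
Qed.

(** A sum of at most [W] terms is at most [W] times the largest one, for every [q >= 0]. The
    assumption [has P s] matters at [q = 0], where an empty sum would have power 1. *)
Lemma powR_sum_le (R : realType) (I : eqType) (s : seq I) (P : pred I) (p : I -> R) (W q : R) :
  0 <= q -> 1 <= W -> (forall i, 0 <= p i) -> (count P s)%:R <= W -> has P s ->
  (\sum_(i <- s | P i) p i) `^ q <= W `^ q * \sum_(i <- s | P i) p i `^ q.
Proof.
move=> q0 W1 p0 cW hasP'.
rewrite -big_filter -[X in _ <= _ * X]big_filter; rewrite -size_filter in cW.
move: hasP'; rewrite has_filter; move: cW; move: [seq i <- s | P i] => {}s cW sN0.
have [x xs xmax] : exists2 x, x \in s & forall y, y \in s -> p y <= p x.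
  case: s sN0 {cW} => // a X _; elim: X a => [|b X IHX] a.
    by exists a; rewrite ?mem_head// => y; rewrite inE => /eqP ->.
  have [x xb xm] := IHX b; have [wab|wba] := leP (p a) (p x).
    exists x; first by rewrite inE xb orbT.
    by move=> y; rewrite inE => /predU1P[->//|]; exact: xm.
  exists a; first by rewrite mem_head.
  move=> y; rewrite inE => /predU1P[->//|/xm yx]; exact: le_trans yx (ltW wba).
have W0 : 0 <= W by exact: le_trans ler01 W1.
apply: (@le_trans _ _ ((W * p x) `^ q)).
  rewrite ge0_ler_powR ?nnegrE ?mulr_ge0 ?sumr_ge0//.
  apply: le_trans (_ : \sum_(i <- s) p x <= _).
    by rewrite big_seq [leRHS]big_seq; apply: ler_sum.
  by rewrite big_const_seq count_predT iter_addr_0 -[leLHS]mulr_natl ler_wpM2r.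
rewrite powRM// ler_wpM2l ?powR_ge0// (big_rem x)//= lerDl sumr_ge0// => i _.
exact: powR_ge0.
Qed.

Lemma fin_le_poweR (R : realType) (b q : R) (m : \bar R) : 0 <= q -> 0 <= b ->
  (b%:E <= m)%E -> ((b `^ q)%:E <= m `^ q)%E.
Proof.
move=> q0 b0; case: m => [m| |]//=.
  by rewrite !lee_fin => bm; rewrite ge0_ler_powR ?nnegrE// (le_trans b0).
by case: eqP => [->|_ _]; rewrite ?powRr0 ?lexx// leey.
Qed.

Lemma poweR_le_fin (R : realType) (b q : R) (m : \bar R) : 0 <= q -> (0 <= m)%E ->
  (m <= b%:E)%E -> (m `^ q <= (b `^ q)%:E)%E.
Proof.
move=> q0; case: m => [m| |]//=; rewrite !lee_fin => m0 mb.
by rewrite ge0_ler_powR ?nnegrE// (le_trans m0).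
Qed.

Section Spectrum.
Context (R : realType) (lam : R) (nu : probability (measurableTypeR R) R).
Hypotheses (lam_gt0 : 0 < lam) (lam_lt1 : lam < 1).
Hypothesis nuE : bernoulli_convolution lam nu.
Let L : R := (1 - lam)^-1.
Variable D : nat.
Hypothesis window : bounded_overlap lam D.

Let L_gt0 : 0 < L. Proof. by rewrite invr_gt0 subr_gt0. Qed.
Let l : R := - ln lam.
Let l_gt0 : 0 < l. Proof. by rewrite oppr_gt0 ln_lt0// lam_gt0. Qed.
Let lamE n : lam ^+ n = expR (- (n%:R * l)).
Proof. by rewrite -mulrN opprK expRM_natl lnK. Qed.

Lemma msupport_gt0 (x r : R) : msupport nu x -> 0 < r -> (0 < nu (closed_ball x r))%E.
Proof.
move=> sx r0; rewrite lt_neqAle measure_ge0 andbT; apply/negP => /eqP nu0.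
have : (~` ball x r) x.
  apply: sx; split; first by apply: open_closedC; exact: ball_open.
  apply/eqP; rewrite eq_le measure_ge0 andbT nu0 setCK le_measure ?inE//.
  - exact: measurable_ball.
  - exact: measurable_closed_ball.
  - exact: subset_closed_ball.
by apply; exact: ballxx.
Qed.

(** Centres in [Theta] must lie in the support. The endpoint of the word that continues [d] by plus
    signs only does: each ball around it carries the mass of a sufficiently long finite
    continuation. *)
Lemma msupport_bpts m d : d \in bpts lam m -> msupport nu (d + L * lam ^+ m).
Proof.
move=> dm F [Fc F0]; apply: contrapT => xF; set x := d + _ in xF.
have [e /= e0 He] := open_subball (closed_openC Fc) xF.
have [k Hk] : exists k, 4 * L * lam ^+ (m + k) < e.
  have [N _ HN] : \forall n \near \oo, 4 * L * lam ^+ n < e.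
    have lamN : `|lam| < 1 by rewrite gtr0_norm.
    have /cvgrPdist_lt/(_ e e0) := cvg_geometric (4 * L) lamN.
    apply: filterS => n /=.
    have ln0 : 0 < 4 * L * lam ^+ n by rewrite !mulr_gt0 ?exprn_gt0.
    by rewrite sub0r normrN gtr0_norm.
  by exists N; apply: HN => /=; rewrite leq_addl.
have lk : 0 < lam ^+ (m + k) by rewrite exprn_gt0.
pose y := d + lam ^+ m * \sum_(i < k) lam ^+ i.
have yb : y \in bpts lam (m + k) by rewrite bpts_add// bpts_sum_mem.
pose r := 2 * L * lam ^+ (m + k).
have r0 : 0 < r by rewrite !mulr_gt0.
have xy : `|x - y| + L * lam ^+ (m + k) <= r.
  have -> : x - y = L * lam ^+ (m + k).
    have sumE : \sum_(i < k) lam ^+ i = L * (1 - lam ^+ k).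
      elim: k {Hk lk y yb r r0} => [|k IH]; first by rewrite big_ord0 expr0 subrr mulr0.
      rewrite big_ord_recr /= IH /L exprS; field.
      by rewrite subr_eq0 gt_eqF.
    by rewrite /x /y sumE exprD; ring.
  by rewrite gtr0_norm ?mulr_gt0// /r; lra.
have := bmass_le_ball lam_gt0 lam_lt1 nuE r0 xy.
apply/negP; rewrite -ltNge; apply: (@le_lt_trans _ _ 0%E); last by rewrite lte_fin bmass_gt0.
rewrite -F0; apply: le_measure; rewrite ?inE.
- exact: measurable_closed_ball.
- by apply: measurableC; exact: closed_measurable.
- apply: subset_trans (He (2 * r) _ _); last by rewrite mulr_gt0.
    by apply: closed_ball_subset => //; lra.
  by rewrite /ball_ /= sub0r normrN gtr0_norm ?mulr_gt0// /r; move: Hk; lra.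
Qed.

(** A separated selection of points, shifted into the support, carries the moment up to a window
    factor. The radius [2 * L * lam ^+ m] pays once for the shift and once for the tail; the [4 * L]
    in the factor comes from the required separation [2 * r]. *)
Lemma pmoment_le_Theta (q : R) m : 0 <= q ->
  ((pmoment lam m q)%:E <= ((2 * (4 * L) + 1) * m.+1%:R ^+ D)%:E *
     Theta nu q (2 * L * lam ^+ m))%E.
Proof.
move=> q0; have lm : 0 < lam ^+ m by rewrite exprn_gt0.
set r := 2 * L * lam ^+ m; set K := _ * _ ^+ D.
have r0 : 0 < r by rewrite !mulr_gt0.
have K0 : 0 <= K by rewrite mulr_ge0 ?exprn_ge0//; have := L_gt0; lra.
have [|||Y [Yb uY sepY sumY]] := @greedy_separated R (bpts lam m)
    (fun d => bmass lam m d `^ q) (2 * r) K _ K0 _ (bpts_uniq lam m).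
- by rewrite mulr_ge0// ltW.
- by move=> x; exact: powR_ge0.
- move=> x _; rewrite /r (_ : 2 * _ = 4 * L * lam ^+ m); last by ring.
  by apply: window; have := L_gt0; lra.
pose shift d := d + L * lam ^+ m.
have sepS : spaced r (map shift Y).
  split; first by rewrite map_inj_uniq//; exact: addIr.
  move=> _ _ /mapP[x xY ->] /mapP[y yY ->]; rewrite (inj_eq (addIr _)) => xy.
  by rewrite /shift opprD addrACA subrr addr0; exact: sepY.
have := @Theta_ge _ nu q r (map shift Y) r0 _ sepS.
have sup : forall x, x \in map shift Y -> msupport nu x.
  by move=> _ /mapP[x /Yb xb ->]; exact: msupport_bpts.
move=> /(_ sup); rewrite big_map => hT.
apply: le_trans (lee_wpmul2l _ hT); last by rewrite lee_fin.
apply: (@le_trans _ _ (K * \sum_(y <- Y) bmass lam m y `^ q)%:E); first by rewrite lee_fin.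
rewrite EFinM lee_wpmul2l ?lee_fin// -sumEFin.
rewrite big_seq [leRHS]big_seq; apply: lee_sum => y /Yb yb.
have xy : `|shift y - y| + L * lam ^+ m <= r.
  by rewrite /shift addrAC subrr add0r gtr0_norm ?mulr_gt0// /r; lra.
apply: fin_le_poweR => //; first exact: bmass_ge0.
exact: (bmass_le_ball lam_gt0 lam_lt1 nuE r0 xy).
Qed.

(** The mass of a ball is spread over at most one window of points of level [n]. Conversely each
    such point serves boundedly many balls, because the centres of disjoint balls are [r] apart and
    [r] is comparable to [lam ^+ n]. *)
Lemma Theta_le_pmoment (q r : R) n : 0 <= q -> lam ^+ n.+1 < r -> r <= lam ^+ n ->
  (Theta nu q r <= ((2 * (1 + L) / lam + 1) *
     ((2 * (1 + L) + 1) * n.+1%:R ^+ D) `^ q * pmoment lam n q)%:E)%E.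
Proof.
move=> q0 nr rn; have ln0 : 0 < lam ^+ n by rewrite exprn_gt0.
have r0 : 0 < r by apply: lt_trans nr; rewrite exprn_gt0.
set M := _ / lam + 1; set W := (2 * _ + 1) * _.
have W1 : 1 <= W by rewrite mulr_ege1 ?exprn_ege1 ?ler1n//; have := L_gt0; lra.
apply: ge_ereal_sup => _ [X [Xsup Xdisj] <-].
apply: ge_ereal_sup => _ [A [Afin AX] <-].
rewrite fsbig_finite//=; set t := fset_set A.
have tA x : x \in t -> A x by rewrite in_fset_set// inE.
pose P (x d : R) := `|d - x| <= (1 + L) * lam ^+ n.
have one x : x \in t -> (nu (closed_ball x r) `^ q <= (W `^ q * \sum_(d <- bpts lam n | P x d) bmass lam n d `^ q)%:E)%E.
  move=> /tA/AX/Xsup sx; have := msupport_gt0 sx r0.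
  have := ball_le_bmass lam_gt0 lam_lt1 nuE n x r0.
  move=> h1 h2.
  have {}h1 : (nu (closed_ball x r) <= (\sum_(y <- bpts lam n | P x y) bmass lam n y)%:E)%E.
    apply: le_trans h1 _; rewrite lee_fin big_mkcond [leRHS]big_mkcond; apply: ler_sum => y _.
    case: ifP => [h|_]; last by case: ifP => // _; exact: bmass_ge0.
    rewrite ifT// /P mulrDl mul1r (le_trans h)// lerD2r//.
  have hasP' : has (P x) (bpts lam n).
    apply: contraT => /hasPn hN; move: (lt_le_trans h2 h1).
    by rewrite big_seq_cond big1 ?ltxx// => y /andP[/hN /negP].
  apply: le_trans (poweR_le_fin q0 (measure_ge0 nu _) h1) _; rewrite lee_fin.
  apply: powR_sum_le => //; first by move=> y; exact: bmass_ge0.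
  by apply: window; have := L_gt0; lra.
apply: le_trans (_ : (\sum_(x <- t) (W `^ q * \sum_(d <- bpts lam n | P x d) bmass lam n d `^ q)%:E <= _)%E).
  by rewrite big_seq [leRHS]big_seq; apply: lee_sum => x; exact: one.
rewrite sumEFin lee_fin -mulr_sumr mulrAC [leRHS]mulrC ler_wpM2l ?powR_ge0//.
under eq_bigr do rewrite big_mkcond.
rewrite exchange_big /= /pmoment mulr_sumr big_seq [leRHS]big_seq; apply: ler_sum => d _.
rewrite -big_mkcond -big_filter big_const_seq count_predT iter_addr_0 -[leLHS]mulr_natl.
rewrite ler_wpM2r ?powR_ge0//.
have C0 : 0 <= (1 + L) * lam ^+ n by rewrite mulr_ge0// ?ltW//; have := L_gt0; lra.
apply: le_trans (@size_separated_le _ _ (d - (1 + L) * lam ^+ n) (d + (1 + L) * lam ^+ n) r _ r0 _ _ _) _.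
- by rewrite filter_uniq// fset_uniq.
- move=> x y; rewrite !mem_filter => /andP[_ /tA/AX xX] /andP[_ /tA/AX yX] xy.
  rewrite leNgt; apply/negP => xyr.
  have /trivIsetP/(_ x y xX yX xy) := Xdisj; rewrite -subset0 => /(_ x); apply.
  rewrite !closed_ballE// /closed_ball_ /= subrr normr0 distrC; split; exact: ltW.
- by move=> x; rewrite mem_filter /P distrC ler_distl => /andP[].
- by lra.
- rewrite /M lerD2r (_ : _ - _ = 2 * (1 + L) * lam ^+ n); last by ring.
  rewrite ler_pdivrMr// (_ : _ / lam * r = 2 * (1 + L) * (r / lam)); last by ring.
  rewrite ler_wpM2l//; first by have := L_gt0; lra.
  by rewrite ler_pdivlMr// -exprSr ltW.
Qed.

End Spectrum.

(** * Slopes of a concave function at zero and at infinity *)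

Section Slopes.
Context (R : realType) (F : R -> \bar R) (T : R -> R) (C : R).
Hypotheses (FE : forall q, 0 <= q -> F q = (T q)%:E)
  (T_concave : forall q th, 0 <= q -> 0 <= th <= 1 -> th * T q + (1 - th) * T 0 <= T (th * q))
  (T_ge : forall q, 0 <= q -> T 0 <= T q)
  (T_le : forall q, 0 <= q -> T q <= T 0 + C * q).

Let g q := (T q - T 0) / q.

Let g_dec x y : 0 < x -> x <= y -> g y <= g x.
Proof.
move=> x0 xy; have y0 : 0 < y by exact: lt_le_trans xy.
have := @T_concave y (x / y) (ltW y0).
rewrite divfK ?gt_eqF// => /(_ _)/wrap[].
  apply/andP; split; last by rewrite ler_pdivrMr// mul1r.
  by rewrite divr_ge0// ltW.
move=> h; rewrite /g ler_pdivlMr//.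
have -> : (T y - T 0) / y * x = x / y * T y + (1 - x / y) * T 0 - T 0.
  by field; rewrite gt_eqF.
by rewrite lerB.
Qed.

Let G := [set g q | q in [set q | 0 < q]].

Let G0 : G !=set0. Proof. by exists (g 1), 1 => /=. Qed.

Let G_lb : lbound G 0.
Proof. by move=> _ [q /= q0 <-]; rewrite divr_ge0 ?subr_ge0 ?T_ge// ltW. Qed.

Let G_ub : ubound G C.
Proof.
move=> _ [q /= q0 <-]; rewrite ler_pdivrMr// lerBlDl.
exact: T_le (ltW q0).
Qed.

(** The chord slopes [g] from 0 decrease, so the limit exists and is their infimum; the difference
    [T 0 / q] between [T q / q] and [g q] vanishes at infinity. *)
Lemma slope_infty_le (al : R) : (lim ((F q * (q^-1)%:E)%E @[q --> +oo%R]) <= al%:E)%E ->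
  forall e M, 0 < e -> exists2 q, M <= q & T q <= q * (al + e).
Proof.
have hi : has_inf G by split => //; exists 0.
have cv : (F q * (q^-1)%:E)%E @[q --> +oo] --> (inf G)%:E.
  apply/fine_cvgP; split.
    near=> q; have q0 : 0 < q by near: q; apply: nbhs_pinfty_gt; exact: num_real.
    by rewrite FE ?ltW.
  apply/cvgrPdist_le => e e0; have e2 : 0 < e / 2 by rewrite divr_gt0.
  have [_ [q1 /= q10 <-] hq1] := inf_adherent e2 hi.
  near=> q; have q0 : 0 < q by near: q; apply: nbhs_pinfty_gt; exact: num_real.
  rewrite /= FE ?(ltW q0)//=.
  have -> : T q / q = g q + T 0 / q by rewrite /g; field; rewrite gt_eqF.
  have q1q : q1 <= q by near: q; apply: nbhs_pinfty_ge; exact: num_real.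
  have h1 := g_dec q10 q1q.
  have h2 : inf G <= g q by apply: ge_inf; [exists 0|exists q].
  have h3 : `|T 0 / q| <= e / 2.
    rewrite normrM normfV (gtr0_norm q0) ler_pdivrMr// -ler_pdivrMl//.
  move: h3; rewrite ler_norml => /andP[h3 h4].
  by rewrite ler_norml; apply/andP; split; lra.
rewrite (cvg_lim _ cv)// lee_fin => Gal e M e0.
have [_ [q1 /= q10 <-] hq1] := @inf_adherent _ _ (e / 2) ltac:(by rewrite divr_gt0) hi.
pose q := Num.max q1 (Num.max M (T 0 / (e / 2))).
have q1q : q1 <= q by rewrite le_max lexx.
have q0 : 0 < q by exact: lt_le_trans q1q.
exists q; first by rewrite !le_max lexx orbT.
have h1 := g_dec q10 q1q.
have : T 0 / (e / 2) <= q by rewrite !le_max lexx !orbT.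
rewrite ler_pdivrMr ?divr_gt0// => h2.
have -> : T q = q * g q + T 0 by rewrite /g mulrC divfK ?gt_eqF// subrK.
have : q * g q <= q * (al + e / 2) by rewrite ler_pM2l//; lra.
by rewrite !mulrDr; lra.
Unshelve. all: by end_near. Qed.

(** By the same monotonicity the right derivative is the supremum of the chord slopes, and a slope
    within [de] of it provides [q]. *)
Lemma rderiv0_ge (al : R) :
  (al%:E <= lim (((F q - F 0%R) * (q^-1)%:E)%E @[q --> 0%R^'+]))%E ->
  forall de, 0 < de -> exists2 q, 0 < q & (al - de) * q < T q - T 0.
Proof.
have hs : has_sup G by split => //; exists C.
have cv : ((F q - F 0) * (q^-1)%:E)%E @[q --> 0^'+] --> (sup G)%:E.
  apply/fine_cvgP; split.
    near=> q; have q0 : 0 < q by near: q; exact: nbhs_right_gt.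
    by rewrite !FE ?(ltW q0).
  apply/cvgrPdist_le => e e0.
  have [_ [q1 /= q10 <-] hq1] := sup_adherent e0 hs.
  near=> q; have q0 : 0 < q by near: q; exact: nbhs_right_gt.
  rewrite /= !FE ?(ltW q0)//= -/(g q).
  have qq1 : q <= q1 by near: q; exact: nbhs_right_le.
  have h1 := g_dec q0 qq1.
  have h2 : g q <= sup G by apply: sup_upper_bound => //; exists q.
  by rewrite ler_norml; apply/andP; split; lra.
rewrite (cvg_lim _ cv)// lee_fin => alG de de0.
have [_ [q /= q0 <-] hq] := sup_adherent de0 hs.
exists q => //; rewrite -ltr_pdivlMr// -/(g q); lra.
Unshelve. all: by end_near. Qed.

End Slopes.

Lemma mul_expRN_le1 (R : realType) (x a : R) : x <= expR a -> x * expR (- a) <= 1.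
Proof. by rewrite expRN ler_pdivrMr ?expR_gt0// mul1r. Qed.

Lemma convex_le1 (R : realType) (th x y : R) : 0 <= th -> th <= 1 -> x <= 1 -> y <= 1 ->
  th * x + (1 - th) * y <= 1.
Proof. by nra. Qed.

(** * The spectrum as the growth rate of the moments *)

Section SpectrumMoments.
Context (R : realType) (lam : R) (nu : probability (measurableTypeR R) R).
Hypotheses (lam_gt0 : 0 < lam) (lam_lt1 : lam < 1).
Hypothesis nuE : bernoulli_convolution lam nu.
Let L : R := (1 - lam)^-1.
Variable D : nat.
Hypothesis window : bounded_overlap lam D.

Let L_gt0 : 0 < L. Proof. by rewrite invr_gt0 subr_gt0. Qed.
Let l : R := - ln lam.
Let l_gt0 : 0 < l. Proof. by rewrite oppr_gt0 ln_lt0// lam_gt0. Qed.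
Let lamE n : lam ^+ n = expR (- (n%:R * l)).
Proof. by rewrite -mulrN opprK expRM_natl lnK. Qed.

Lemma log_scale (r : R) : 0 < r < 1 -> exists k, lam ^+ k.+1 < r /\ r <= lam ^+ k.
Proof.
move=> /andP[r0 r1].
have ex : exists k, lam ^+ k < r.
  have lamN : `|lam| < 1 by rewrite gtr0_norm.
  have /cvgrPdist_lt/(_ r r0)[N _ HN] := cvg_geometric 1 lamN.
  exists N; have := HN N (leqnn N).
  by rewrite /= sub0r normrN mul1r gtr0_norm ?exprn_gt0.
case: (ex_minnP ex) => -[|k] hk mink; first by move: hk; rewrite expr0 ltNge ltW.
exists k; split => //; rewrite leNgt; apply/negP => /mink.
by rewrite ltnn.
Qed.

Lemma spectrum_ge q c e : 0 <= q -> 0 < e ->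
  (\forall n \near \oo, pmoment lam n q <= expR (- (n%:R * (l * c)))) ->
  ((c - e)%:E <= Lq_spectrum nu q)%E.
Proof.
move=> q0 e0 [N1 _ H1].
pose M := 2 * (1 + L) / lam + 1.
pose W n : R := (2 * (1 + L) + 1) * n.+1%:R ^+ D.
have M0 : 0 < M by rewrite ltr_wpDl// divr_ge0 ?(ltW lam_gt0)//; have := L_gt0; lra.
pose e' := l * e / 2 / (q + 1).
have e'0 : 0 < e' by rewrite !divr_gt0// ?mulr_gt0// ltr_wpDl.
have [N2 _ H2] : \forall n \near \oo, W n <= expR (n%:R * e') by exact: pow_le_expR.
(* The second term pays for replacing [ln r] by [- (n%:R * l)], an error of at most [l] whatever the
   sign of [c - e]. *)
pose B := ln M + `|c - e| * l.
have [N3 _ H3] : \forall n \near \oo, B / (l * e / 2) <= n%:R by exact: nbhs_infty_ger.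
pose N := maxn N1 (maxn N2 N3).
apply: (@Lq_spectrum_ge _ _ _ _ (lam ^+ N)); first by rewrite exprn_gt0.
move=> r /andP[r0 rN].
have [|n [nr rn]] := @log_scale r.
  by rewrite r0 (lt_le_trans rN)// exprn_ile1// ltW.
have Nn : (N <= n)%N.
  rewrite leqNgt; apply/negP => nN; move: (lt_trans nr rN).
  by rewrite ltr_iXn2l// ltnNge nN.
move: Nn; rewrite !geq_max => /and3P[/H1 /= h1 /H2 /= h2 /H3 /= h3].
apply: le_trans (Theta_le_pmoment lam_gt0 lam_lt1 nuE window q0 nr rn) _.
rewrite lee_fin -/M -/(W n).
have W0 : 0 <= W n by rewrite mulr_ge0 ?exprn_ge0//; have := L_gt0; lra.
have Wq : W n `^ q <= expR (n%:R * (l * e / 2)).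
  apply: (@le_trans _ _ (expR (n%:R * e') `^ q)).
    by rewrite ge0_ler_powR ?nnegrE ?expR_ge0.
  rewrite /powR gt_eqF ?expR_gt0// expRK ler_expR mulrCA ler_wpM2l//.
  rewrite /e' mulrCA; apply: ler_piMr; first by rewrite ltW// divr_gt0// mulr_gt0.
  have q1 : 0 < q + 1 by lra.
  by rewrite ler_pdivrMr//; lra.
apply: (@le_trans _ _ (M * expR (n%:R * (l * e / 2)) * expR (- (n%:R * (l * c))))).
  by apply: ler_pM; rewrite ?mulr_ge0 ?powR_ge0 ?ler_wpM2l ?(ltW M0)// sumr_ge0// => i _; exact: powR_ge0.
rewrite -[M]lnK ?posrE// -!expRD ler_expR.
move: h3; rewrite /B ler_pdivrMr ?divr_gt0 ?mulr_gt0// => h3.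
have lr1 : ln r <= - (n%:R * l) by rewrite -ler_expR lnK ?posrE// -lamE.
have lr2 : - (n%:R * l) - l <= ln r.
  rewrite -ler_expR lnK ?posrE// (le_trans _ (ltW nr))// lamE ler_expR -natr1; lra.
have : - (n%:R * l) * (c - e) - `|c - e| * l <= (c - e) * ln r.
  have [ce|ce] := lerP 0 (c - e).
    by have := ler_wpM2l ce lr2; rewrite (ger0_norm ce); lra.
  rewrite (ltr0_norm ce); have := ler_wnM2l (ltW ce) lr1; have : 0 <= - (c - e) * l by rewrite mulr_ge0 ?ltW// oppr_gt0.
  lra.
lra.
Qed.

Lemma spectrum_lt q c e : 0 <= q -> 0 < e -> (c%:E < Lq_spectrum nu q)%E ->
  \forall n \near \oo, pmoment lam n q <= expR (- (n%:R * (l * (c - e)))).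
Proof.
move=> q0 e0 /Lq_spectrum_lt[d d0 Hd].
pose A := ln (2 * L).
have le2 : 0 < l * e / 2 by rewrite divr_gt0// mulr_gt0.
near=> n.
have rE : 2 * L * lam ^+ n = expR (A - n%:R * l).
  by rewrite expRD -lamE lnK// posrE mulr_gt0.
have r0 : 0 < 2 * L * lam ^+ n by rewrite rE expR_gt0.
have rd : 2 * L * lam ^+ n < d.
  rewrite rE -[ltRHS]lnK ?posrE// ltr_expR.
  have : (A - ln d) / l < n%:R by near: n; exact: nbhs_infty_gtr.
  by rewrite ltr_pdivrMr//; lra.
have h1 : (2 * (4 * L) + 1) * n.+1%:R ^+ D <= expR (n%:R * (l * e / 2)).
  by near: n; exact: pow_le_expR.
have h2 : c * A / (l * e / 2) <= n%:R by near: n; exact: nbhs_infty_ger.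
rewrite ler_pdivrMr// in h2.
rewrite -lee_fin; apply: le_trans (pmoment_le_Theta lam_gt0 lam_lt1 nuE window n q0) _.
apply: le_trans (lee_wpmul2l _ (Hd _ _)) _.
- by rewrite lee_fin mulr_ge0 ?exprn_ge0//; rewrite -/L; have := L_gt0; lra.
- by rewrite r0.
rewrite rE expRK -EFinM lee_fin.
apply: le_trans (ler_wpM2r (expR_ge0 _) h1) _.
rewrite -expRD ler_expR; lra.
Unshelve. all: by end_near. Qed.

Lemma pmoment_ge n q : 0 <= q -> expR (- (n%:R * (q * ln 2))) <= pmoment lam n q.
Proof.
move=> q0; have b := bpts_sum_mem lam n; rewrite /pmoment (big_rem _ b) /=.
rewrite -[leLHS]addr0 lerD ?sumr_ge0// => [|i _]; last exact: powR_ge0.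
have p0 : 0 < bmass lam n (\sum_(i < n) lam ^+ i) by rewrite bmass_gt0.
rewrite /powR gt_eqF// ler_expR mulrCA -mulrN ler_wpM2l//.
rewrite -ler_expR lnK ?posrE// (le_trans _ (bmass_ge b))//.
by rewrite -mulrN expRM_natl expRN lnK ?posrE.
Qed.

Lemma pmoment_mono n q q' : 0 <= q -> q <= q' -> pmoment lam n q' <= pmoment lam n q.
Proof.
move=> q0 qq'; rewrite /pmoment big_seq [leRHS]big_seq; apply: ler_sum => d dn.
have p0 : 0 < bmass lam n d by rewrite bmass_gt0.
by rewrite ger_powR// p0 bmass_le1.
Qed.

Lemma pmoment_lipschitz n q : 0 <= q -> pmoment lam n 0 <= expR (n%:R * (q * ln 2)) * pmoment lam n q.
Proof.
move=> q0; rewrite /pmoment mulr_sumr big_seq [leRHS]big_seq; apply: ler_sum => d dn.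
have p0 : 0 < bmass lam n d by rewrite bmass_gt0.
rewrite powRr0 -ler_pdivrMl ?expR_gt0// mulr1 -expRN /powR gt_eqF// ler_expR.
rewrite mulrCA -mulrN ler_wpM2l// -ler_expR lnK ?posrE// (le_trans _ (bmass_ge dn))//.
by rewrite -mulrN expRM_natl expRN lnK ?posrE.
Qed.

Lemma spectrum_fin q : 0 <= q -> Lq_spectrum nu q \is a fin_num.
Proof.
move=> q0; rewrite fin_numE; apply/andP; split.
  have : ((- (ln 2 / l) - 1)%:E <= Lq_spectrum nu q)%E.
    apply: spectrum_ge => //; near=> n.
    apply: le_trans (pmoment_mono n (lexx 0) q0) _.
    rewrite (_ : - _ = n%:R * ln 2); last by field; rewrite gt_eqF.
    rewrite /pmoment; under eq_bigr do rewrite powRr0.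
    rewrite big_const_seq count_predT iter_addr_0.
    have := size_heavy_le lam n 0; rewrite /heavy (eq_in_filter (a2 := predT)) ?filter_predT//.
    by move=> d dn; rewrite bmass_ge0.
  by move=> h; apply/eqP => E; rewrite E in h.
apply/eqP => E.
have c1 : ((q * ln 2 / l + 2)%:E < Lq_spectrum nu q)%E by rewrite E ltry.
have H := spectrum_lt q0 ltr01 c1.
near \oo => n.
have n0 : 0 < n%:R :> R by near: n; exact: nbhs_infty_gtr.
have h : pmoment lam n q <= expR (- (n%:R * (l * (q * ln 2 / l + 2 - 1)))) by near: n.
have := le_trans (pmoment_ge n q0) h.
rewrite ler_expR lerN2 ler_pM2l// (_ : l * _ = q * ln 2 + l); last by field; rewrite gt_eqF.
by rewrite gerDl leNgt l_gt0.
Unshelve. all: by end_near. Qed.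

Definition spec q := fine (Lq_spectrum nu q).

Lemma specE q : 0 <= q -> Lq_spectrum nu q = (spec q)%:E.
Proof. by move=> q0; rewrite /spec fineK// spectrum_fin. Qed.

Lemma pmoment_up q e : 0 <= q -> 0 < e ->
  \forall n \near \oo, pmoment lam n q <= expR (n%:R * (- (l * spec q) + e)).
Proof.
move=> q0 e0; have e2 : 0 < e / (2 * l) by rewrite divr_gt0// mulr_gt0.
have h : ((spec q - e / (2 * l))%:E < Lq_spectrum nu q)%E.
  by rewrite specE// lte_fin; lra.
apply: filterS (spectrum_lt q0 e2 h) => n /le_trans; apply.
rewrite ler_expR -mulrN le_eqVlt; apply/orP; left; apply/eqP; field.
by rewrite gt_eqF.
Qed.

(** The spectrum is a lower limit of quotients by the negative [ln r], so its value guarantees large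
    moments at infinitely many levels only; this is the contrapositive of [spectrum_ge]. *)
Lemma pmoment_lo q : 0 <= q -> forall e, 0 < e -> forall N, exists2 n, (N <= n)%N &
  expR (n%:R * (- (l * spec q) - e)) <= pmoment lam n q.
Proof.
move=> q0 e e0 N; apply: contrapT => hN.
have e2 : 0 < e / (2 * l) by rewrite divr_gt0// mulr_gt0.
have : ((spec q + e / l - e / (2 * l))%:E <= Lq_spectrum nu q)%E.
  apply: spectrum_ge => //; exists N => // n /= Nn.
  rewrite leNgt; apply/negP => h; apply: hN; exists n => //.
  apply: le_trans (ltW h); rewrite ler_expR -mulrN.
  rewrite le_eqVlt; apply/orP; left; apply/eqP; field.
  by rewrite gt_eqF.
rewrite specE// lee_fin.
have -> : e / l = 2 * (e / (2 * l)) by field; rewrite gt_eqF.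
by lra.
Qed.

(** Log-convexity of the moments, that is Hölder's inequality: after normalising the moments at [q]
    and at 0 by [expR A] and [expR B], convexity of the exponential is applied to each term. *)
Lemma spec_concave q th : 0 <= q -> 0 <= th <= 1 ->
  th * spec q + (1 - th) * spec 0 <= spec (th * q).
Proof.
move=> q0 /andP[th0 th1].
suff : l * (th * spec q + (1 - th) * spec 0) <= l * spec (th * q) by rewrite ler_pM2l.
apply/ler_addgt0Pr => e e0; have e2 : 0 < e / 2 by rewrite divr_gt0.
have [N1 _ H1] := pmoment_up q0 e2.
have [N2 _ H2] := pmoment_up (lexx 0) e2.
have [n] := pmoment_lo (mulr_ge0 th0 q0) e2 (maxn 1 (maxn N1 N2)).
rewrite !geq_max => /and3P[n_gt0 /H1 /= h1 /H2 /= h2] h.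
have n0 : 0 < n%:R :> R by rewrite ltr0n.
set A := n%:R * (- (l * spec q) + e / 2) in h1.
set B := n%:R * (- (l * spec 0) + e / 2) in h2.
have conv (u v : R) : expR (th * u + (1 - th) * v) <= th * expR u + (1 - th) * expR v.
  set m := th * u + (1 - th) * v.
  have tangent (w : R) : expR m * (1 + (w - m)) <= expR w.
    by rewrite -ler_pdivlMl ?expR_gt0// -expRN -expRD (addrC (- m)) expR_ge1Dx.
  have := ler_wpM2l th0 (tangent u); have := @ler_wpM2l _ (1 - th) _ _ _ (tangent v).
  rewrite subr_ge0 => /(_ th1) k1 k2.
  have E : expR m = th * (expR m * (1 + (u - m))) + (1 - th) * (expR m * (1 + (v - m))).
    rewrite [RHS](_ : _ = expR m * (1 + (th * u + (1 - th) * v - m))); last by ring.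
    by rewrite -/m subrr addr0 mulr1.
  by rewrite E lerD.
have : pmoment lam n (th * q) <= expR (th * A + (1 - th) * B).
  have -> : pmoment lam n (th * q) = expR (th * A + (1 - th) * B) * \sum_(d <- bpts lam n)
      bmass lam n d `^ (th * q) * expR (- (th * A + (1 - th) * B)).
    rewrite -mulr_suml mulrCA -expRD subrr expR0 mulr1//.
  rewrite -[leRHS]mulr1 ler_wpM2l ?expR_ge0//.
  apply: (@le_trans _ _ (\sum_(d <- bpts lam n) (th * (bmass lam n d `^ q * expR (- A)) +
     (1 - th) * (bmass lam n d `^ 0 * expR (- B))))).
    rewrite big_seq [leRHS]big_seq; apply: ler_sum => d dn.
    have p0 : 0 < bmass lam n d by rewrite bmass_gt0.
    rewrite /powR !gt_eqF// -!expRD (le_trans _ (conv _ _))// ler_expR.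
    by rewrite le_eqVlt; apply/orP; left; apply/eqP; ring.
  rewrite (_ : \sum_(d <- _) _ = th * (pmoment lam n q * expR (- A)) +
      (1 - th) * (pmoment lam n 0 * expR (- B))); last first.
    rewrite /pmoment [_ * expR (- A)]mulr_suml [_ * expR (- B)]mulr_suml.
    by rewrite !mulr_sumr -big_split.
  have k1 : pmoment lam n q * expR (- A) <= 1.
    exact: mul_expRN_le1 h1.
  have k2 : pmoment lam n 0 * expR (- B) <= 1.
    exact: mul_expRN_le1 h2.
  exact: convex_le1.
move=> /(le_trans h); rewrite ler_expR /A /B.
move: (spec q) (spec 0) (spec (th * q)) => x y z.
rewrite (_ : th * _ + _ = n%:R * (th * (- (l * x) + e / 2) + (1 - th) * (- (l * y) + e / 2))); last by ring.
by rewrite ler_pM2l// => {h h1 h2} k; lra.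
Qed.

Lemma spec_ge0 q : 0 <= q -> spec 0 <= spec q.
Proof.
move=> q0; rewrite -(ler_pM2l l_gt0); apply/ler_addgt0Pr => e e0.
have e2 : 0 < e / 2 by rewrite divr_gt0.
have [N1 _ H1] := pmoment_up (lexx 0) e2.
have [n] := pmoment_lo q0 e2 (maxn 1 N1).
rewrite geq_max => /andP[n_gt0 /H1 /= h1] h2.
have n0 : 0 < n%:R :> R by rewrite ltr0n.
have := le_trans h2 (le_trans (pmoment_mono n (lexx 0) q0) h1).
rewrite ler_expR ler_pM2l// => {h1 h2} k.
by move: (spec q) (spec 0) k => x y; lra.
Qed.

Lemma spec_le q : 0 <= q -> spec q <= spec 0 + ln 2 / l * q.
Proof.
move=> q0; rewrite -(ler_pM2l l_gt0); apply/ler_addgt0Pr => e e0.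
have e2 : 0 < e / 2 by rewrite divr_gt0.
have [N1 _ H1] := pmoment_up q0 e2.
have [n] := pmoment_lo (lexx 0) e2 (maxn 1 N1).
rewrite geq_max => /andP[n_gt0 /H1 /= h1] h2.
have n0 : 0 < n%:R :> R by rewrite ltr0n.
have := le_trans h2 (le_trans (pmoment_lipschitz n q0) (ler_wpM2l (expR_ge0 _) h1)).
rewrite -expRD ler_expR -mulrDr ler_pM2l// => h.
rewrite (_ : l * (spec 0 + _) = l * spec 0 + q * ln 2); last by field; rewrite gt_eqF.
by clear h1 h2; move: (spec q) (spec 0) h => x y; lra.
Qed.

End SpectrumMoments.

(** * The level sets of the Bernoulli convolution *)

Section Final.
Context (R : realType) (lam : R) (nu : probability (measurableTypeR R) R).
Hypotheses (lam_gt0 : 0 < lam) (lam_lt1 : lam < 1).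
Hypothesis nuE : bernoulli_convolution lam nu.
Let L : R := (1 - lam)^-1.
Variable D : nat.
Hypothesis window : bounded_overlap lam D.

Let L_gt0 : 0 < L. Proof. by rewrite invr_gt0 subr_gt0. Qed.
Let l : R := - ln lam.
Let l_gt0 : 0 < l. Proof. by rewrite oppr_gt0 ln_lt0// lam_gt0. Qed.
Let lamE n : lam ^+ n = expR (- (n%:R * l)).
Proof. by rewrite -mulrN opprK expRM_natl lnK. Qed.

(** A radius [r] falls between [lam ^+ lev k.+1] and [lam ^+ lev k]. Points of level [lev k.+2]
    bound the mass of the ball from below and a window of level [lev k] bounds it from above; these
    levels differ by a negligible fraction of [lev k]. *)
Lemma tree_level_set (al x : R) : 0 <= al ->
  (forall e, 0 < e -> \forall k \near \oo,
    (exists d, [/\ d \in bpts lam (lev k), `|x - d| <= L * lam ^+ lev k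
        & expR (- ((lev k)%:R * (l * al + e))) <= bmass lam (lev k) d]) /\
    (forall d, d \in bpts lam (lev k) -> `|x - d| <= (1 + L) * lam ^+ lev k ->
       bmass lam (lev k) d <= expR (- ((lev k)%:R * (l * al - e))))) ->
  level_set nu al x.
Proof.
move=> al0 H; apply/level_setP => e e0.
pose e1 := l * e / 4; have le0 : 0 < l * e by rewrite mulr_gt0.
have e10 : 0 < e1 by rewrite divr_gt0.
pose W n : R := (2 * (1 + L) + 1) * n.+1%:R ^+ D.
have [N1 _ H1] := H _ e10.
have [N2 _ H2] : \forall k \near \oo, W (lev k) <= expR ((lev k)%:R * e1).
  exact: (@near_lev (fun n => W n <= expR (n%:R * e1)) (pow_le_expR _ _ e10)).
have le2 : 0 < l * e / 2 by rewrite divr_gt0.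
have [N3 _ H3] := lev_small (l * al - l * e) le2.
(* [lev k.+2] exceeds [lev k] by [2 * k.+1 + 1], which is at most [3 * k.+1]. *)
have [N4 _ H4] := lev_small (3 * (l * al + e1)) le2.
have [N5 _ H5] : \forall k \near \oo, 2 * L * lam ^+ k <= 1.
  have lamN : `|lam| < 1 by rewrite gtr0_norm.
  have /cvgrPdist_lt/(_ 1 ltr01) := cvg_geometric (2 * L) lamN.
  apply: filterS => n /=.
  have ln0 : 0 < 2 * L * lam ^+ n by rewrite !mulr_gt0 ?exprn_gt0.
  by rewrite sub0r normrN gtr0_norm// => /ltW.
pose N := maxn (maxn N1 N2) (maxn N3 (maxn N4 N5)).
exists (lam ^+ lev N); first by rewrite exprn_gt0.
move=> r /andP[r0 rN].
have ex : exists k, lam ^+ lev k < r.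
  have r1 : r < 1 by rewrite (lt_le_trans rN)// exprn_ile1// ltW.
  have [|k [kr _]] := @log_scale _ _ lam_gt0 lam_lt1 r; first by rewrite r0.
  exists k.+1; apply: le_lt_trans kr; rewrite ler_iXn2l//.
  exact: lev_ge.
case: (ex_minnP ex) => -[|k] hk mink.
  by move: (lt_trans hk rN); rewrite ltNge ler_iXn2l//= ?lev_homo.
have rk : r <= lam ^+ lev k.
  by rewrite leNgt; apply/negP => /mink; rewrite ltnn.
have Nk : (N <= k)%N.
  rewrite leqNgt; apply/negP => kN; move: (lt_trans hk rN).
  by rewrite ltNge ler_iXn2l// lev_homo.
move: (Nk); rewrite !geq_max => /andP[/andP[n1 n2] /and3P[n3 n4 n5]].
have lr1 : ln r <= - ((lev k)%:R * l) by rewrite -ler_expR lnK ?posrE// -lamE.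
have lr2 : - ((lev k.+1)%:R * l) <= ln r.
  by rewrite -ler_expR lnK ?posrE// -lamE ltW.
have levS : (lev k.+1)%:R = (lev k)%:R + k.+1%:R :> R by rewrite /= natrD.
have levSS : (lev k.+2)%:R = (lev k)%:R + 2 * k.+1%:R + 1 :> R.
  by rewrite /= !natrD -(natr1 k.+1); lra.
have lev0 : 0 <= (lev k)%:R :> R by [].
have k1 : 1 <= k.+1%:R :> R by rewrite ler1n.
apply/andP; split.
(* Two levels deeper, since the ball must contain the distance from [x] to [d] plus the tail at [d]:
   their sum is [2 * L * lam ^+ k.+2] times [lam ^+ lev k.+1], and the first factor is at most 1. *)
- have [[d [dn xd hd]] _] := H1 k.+2 (leqW (leqW n1)).
  apply: le_trans (bmass_le_ball lam_gt0 lam_lt1 nuE (n := lev k.+2) (y := d) r0 _); last first.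
    have := H5 k.+2 (leqW (leqW n5)) => /= h5.
    apply: le_trans (ltW hk); apply: le_trans (lerD xd (lexx _)) _.
    rewrite -/L [lev k.+2]/= exprD.
    have lk : 0 < lam ^+ lev k.+1 by rewrite exprn_gt0.
    rewrite (_ : _ + _ = (2 * L * lam ^+ k.+2) * lam ^+ lev k.+1); last by ring.
    by rewrite ler_piMl// ltW.
  rewrite lee_fin; apply: le_trans hd; rewrite ler_expR levSS.
  have := H4 k n4; rewrite /= => h4.
  have := ler_wpM2l (addr_ge0 al0 (ltW e0)) lr1.
  have := mulr_ge0 lev0 (ltW le0).
  have : (2 * k.+1%:R + 1) * (l * al + e1) <= k.+1%:R * (3 * (l * al + e1)).
    rewrite mulrA ler_wpM2r//; last by lra.
    by rewrite addr_ge0 ?mulr_ge0 ?(ltW e10)// ltW.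
  move: h4; rewrite /e1 => *; lra.
- have h2 := H2 k n2; have [_ h1] := H1 k n1; have h3 := H3 k n3.
  rewrite /= in h1 h2 h3.
  have [ae|ae] := ltP (al - e) 0.
    apply: (@le_trans _ _ 1%E).
      by apply: probability_le1; exact: measurable_closed_ball.
    rewrite lee_fin -expR0 ler_expR mulr_le0 ?(ltW ae)// ln_le0//.
    by rewrite (le_trans rk)// exprn_ile1// ltW.
  apply: le_trans (ball_le_bmass lam_gt0 lam_lt1 nuE (lev k) x r0) _.
  rewrite lee_fin -/L.
  apply: (@le_trans _ _ (\sum_(y <- bpts lam (lev k) | `|y - x| <= (1 + L) * lam ^+ lev k)
     expR (- ((lev k)%:R * (l * al - e1))))).
    rewrite big_seq_cond [leRHS]big_seq_cond big_mkcond [leRHS]big_mkcond.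
    apply: ler_sum => y _; case: ifP => [/andP[yb yx]|_]; last by case: ifP => // _; exact: expR_ge0.
    have yx' : `|y - x| <= (1 + L) * lam ^+ lev k.
      by rewrite mulrDl mul1r (le_trans yx)// lerD2r.
    by rewrite yb yx' /= h1// distrC.
  rewrite -big_filter big_const_seq count_predT iter_addr_0 size_filter -[leLHS]mulr_natl.
  apply: (@le_trans _ _ (expR ((lev k)%:R * e1) * expR (- ((lev k)%:R * (l * al - e1))))).
    rewrite ler_wpM2r ?expR_ge0// (le_trans _ h2)// /W window//.
    by have := L_gt0; lra.
  rewrite -expRD ler_expR.
  have := ler_wpM2l ae lr2; rewrite levS /e1 => h4.
  have : k.+1%:R * (l * al - l * e) <= (lev k)%:R * (l * e / 2) by [].
  lra.
Qed.

Lemma tree_hausdorff (h s : R) (K E : set R) (psi : nat -> R) :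
  K `<=` E -> 0 <= s -> l * s < h ->
  (forall (m : nat -> nat) (x : nat -> R),
      K `<=` \bigcup_i ball (x i) (lam ^+ lev (m i)) ->
      exists N, 2^-1 <= \sum_(i < N) psi (m i)) ->
  (forall s, s < h -> \forall k \near \oo, psi k <= expR (- ((lev k)%:R * s))) ->
  (0 < hausdorff_measure s E)%E.
Proof.
move=> KE s0 sh cov psile.
(* A rate strictly between leaves room for [psi] at level [k] to be compared with the scale of level
   [k.+1]. *)
pose s' := (l * s + h) / 2.
have s'h : s' < h by rewrite /s'; lra.
have ss' : l * s < s' by rewrite /s'; lra.
have ls0 : 0 <= l * s by rewrite mulr_ge0// ltW.
have s'0 : 0 < s' by lra.
have tendsto0 (c e : R) : 0 < c -> 0 < e -> \forall k \near \oo, expR (- ((lev k)%:R * c)) <= e.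
  move=> c0 e0; near=> k; rewrite -[leRHS]lnK ?posrE// ler_expR.
  have : - ln e / c <= k%:R by near: k; exact: nbhs_infty_ger.
  rewrite ler_pdivrMr// => h1.
  have : k%:R * c <= (lev k)%:R * c by rewrite ler_pM2r// ler_nat lev_ge.
  lra.
apply: (@hausdorff_measure_gt0 _ E K (fun m => lam ^+ lev m) psi s s0 KE cov).
- by move=> m; rewrite exprn_gt0.
- by move=> m n mn; rewrite ler_iXn2l// lev_homo.
- by move=> e e0; apply: filterS (tendsto0 _ _ l_gt0 e0) => k; rewrite -lamE.
- move=> e e0; have := tendsto0 _ _ s'0 e0; have := psile _ s'h.
  by apply: filterS2 => k; exact: le_trans.
- have h2 : 0 < s' - l * s by lra.
  have := lev_small (l * s) h2; have := psile _ s'h.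
  apply: filterS2 => k /le_trans hk h3; apply: hk.
  rewrite lamE /powR gt_eqF ?expR_gt0// expRK ler_expR /= natrD; lra.
Unshelve. all: by end_near. Qed.

(** Here [h / l] is the Legendre transform restricted to [q >= 0]. The Moran set gives dimension at
    least [h / l]; the covering bound over all real [q] is at most [h / l], so equality holds
    throughout. *)
Lemma bernoulli_level_set (al : R) :
  (Lq_slope_infty nu <= al%:E)%E -> (al%:E <= Lq_rderiv0 nu)%E ->
  level_set nu al !=set0 /\ hausdorff_dim (level_set nu al) = Lq_legendre nu al.
Proof.
move=> slope deriv.
pose T := spec nu; pose t q := l * T q.
have FE q : 0 <= q -> Lq_spectrum nu q = (T q)%:E by exact: (specE lam_gt0 lam_lt1 nuE window).
have Tconc := spec_concave lam_gt0 lam_lt1 nuE window.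
have Tge := spec_ge0 lam_gt0 lam_lt1 nuE window.
have Tle : forall q, 0 <= q -> T q <= T 0 + ln 2 / l * q.
  exact (spec_le lam_gt0 lam_lt1 nuE window).
have slope' := slope_infty_le FE Tconc Tge slope.
have deriv' := rderiv0_ge FE Tconc Tle deriv.
have lo : forall q, 0 <= q -> forall e, 0 < e -> forall N, exists2 n, (N <= n)%N &
    expR (n%:R * (- t q - e)) <= pmoment lam n q.
  exact (pmoment_lo lam_gt0 lam_lt1 nuE window).
have up q (q0 : 0 <= q) : forall e, 0 < e -> \forall n \near \oo,
    pmoment lam n q <= expR (n%:R * (- t q + e)).
  by move=> e; exact (pmoment_up lam_gt0 lam_lt1 nuE window q0).
have tE q : t q = l * T q by [].
clearbody t; clearbody T.
have exg : forall e, 0 < e -> exists g, Phi lam (l * al + e) g.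
  apply: (Phi_of_slope lam_gt0 lam_lt1 window (t := t)); first exact: lo.
  move=> e M e0; have el : 0 < e / l by rewrite divr_gt0.
  have [q Mq hq] := slope' _ M el; exists q => //.
  have := ler_wpM2l (ltW l_gt0) hq; rewrite -tE => /le_trans; apply.
  by rewrite le_eqVlt; apply/orP; left; apply/eqP; field; rewrite gt_eqF.
have al0 : 0 <= al.
  rewrite -(pmulr_rge0 _ l_gt0); apply/ler_addgt0Pr => e e0.
  by have [g /Phi_ge0[]] := exg e e0.
pose S := [set l * al * q - t q | q in [set q | 0 <= q]].
have Slb : lbound S 0.
  move=> _ [q /= q0 <-]; rewrite subr_ge0.
  exact: (@le_of_Phi _ lam t (l * al) q q0 (up q q0) exg).
have hS : has_inf S by split; [exists (l * al * 0 - t 0), 0 => /=|exists 0].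
pose h := inf S.
have hle q : 0 <= q -> h <= l * al * q - t q.
  by move=> q0; apply: ge_inf; [exists 0|exists q].
have HA : forall e, 0 < e -> Phi lam (l * al + e) (h - e).
  by apply: (Phi_legendre lam_gt0 lam_lt1 window (t := t)) => //; exact: lo.
have HB : forall de, 0 < de -> exists2 eta, 0 < eta & \forall n \near \oo,
    (size (heavy lam n (expR (- (n%:R * (l * al - de))))))%:R <= expR (n%:R * (h - eta)).
  move=> de de0.
  suff [q q0 hq] : exists2 q, 0 < q & (l * al - de) * q - t q < h.
    exact: (@heavy_chebyshev _ lam t (l * al) h de q q0 (up q (ltW q0)) hq).
  (* If no such [q] existed, near-minimisers of [h] would be confined to small [q], since lowering
     [al] gains [de * q]. Then [h] would be at least [- t 0], and the slope condition at 0 would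
     produce a [q] that contradicts this. *)
  apply: contrapT => hN.
  have big q : 0 < q -> h <= (l * al - de) * q - t q.
    by move=> q0; rewrite leNgt; apply/negP => hq; apply: hN; exists q.
  have hT0 : - t 0 <= h.
    apply/ler_addgt0Pr => e e0.
    (* A near-minimiser satisfies [de * q <= e']; the second bound then makes
       [(ln 2 + l * al + 1) * q] at most [e / 2], and [ln 2] is the Lipschitz constant of [t] at
       0. *)
    pose e' := Num.min (e / 2) (e * de / (2 * (ln 2 + l * al + 1))).
    have ln2 : 0 < ln 2 :> R by rewrite ln_gt0// ltr1n.
    have lal : 0 <= l * al by rewrite mulr_ge0// ltW.
    have den : 0 < 2 * (ln 2 + l * al + 1) by lra.
    have e'0 : 0 < e' by rewrite lt_min divr_gt0//= divr_gt0// mulr_gt0.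
    have [_ [q /= q0 <-] hq] := inf_adherent e'0 hS.
    have := q0; rewrite le_eqVlt => /predU1P[q00|q_gt0].
      move: hq; rewrite -{}q00 mulr0 sub0r -/h => hq.
      have : e' <= e / 2 by rewrite ge_min lexx.
      lra.
    have := big q q_gt0; rewrite -/h in hq => hbig.
    have hde : de * q <= e' by lra.
    have e'2 : e' <= e * de / (2 * (ln 2 + l * al + 1)) by rewrite ge_min lexx orbT.
    have e'1 : e' <= e / 2 by rewrite ge_min lexx.
    have qle : (ln 2 + l * al + 1) * q <= e / 2.
      have : de * q <= e * de / (2 * (ln 2 + l * al + 1)) by lra.
      rewrite ler_pdivlMr// => hh.
      have : de * ((ln 2 + l * al + 1) * q) <= de * (e / 2) by lra.
      by rewrite ler_pM2l.
    have : t q <= t 0 + ln 2 * q.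
      have := ler_wpM2l (ltW l_gt0) (Tle q q0).
      by rewrite mulrDr -!tE mulrA mulrCA divff ?gt_eqF// mulr1.
    have : 0 <= l * al * q by rewrite mulr_ge0.
    lra.
  have [|q q0 hq] := deriv' (de / l); first by rewrite divr_gt0.
  have := big q q0; have : l * ((al - de / l) * q) < l * (T q - T 0) by rewrite ltr_pM2l.
  have -> : l * ((al - de / l) * q) = (l * al - de) * q by field; rewrite gt_eqF.
  rewrite mulrBr -!tE; lra.
(* The level [lev k] points that matter for a ball of radius at most [lam ^+ lev k] lie within
   [1 + L] times this scale. *)
have C0 : 0 <= 1 + L by have := L_gt0; lra.
have [K [psi [[x0 Kx0] Kpt Kcov psile]]] := moran_set lam_gt0 lam_lt1 window C0 HA HB.
have KE : K `<=` level_set nu al by move=> x /Kpt; exact: tree_level_set.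
have ne : level_set nu al !=set0 by exists x0; exact: KE.
split => //; apply/eqP; rewrite eq_le; apply/andP; split.
  by apply: le_ereal_inf_tmp => _ [q _ <-]; exact: hausdorff_dim_level_set_le.
(* The infimum over all real [q] is compared with [h / l] through near-minimisers [q >= 0], where
   the spectrum is known to be finite. *)
apply: (@le_trans _ _ (h / l)%:E).
  apply/lee_addgt0Pr => e e0; have le0 : 0 < l * e by rewrite mulr_gt0.
  have [_ [q /= q0 <-] hq] := inf_adherent le0 hS.
  apply: le_trans (ereal_inf_lbound _) _; first by exists q.
  rewrite FE// -EFinB -EFinD lee_fin -/h in hq *.
  have : l * (al * q - T q) <= l * (h / l + e).
    rewrite (_ : l * (h / l + e) = h + l * e); last by field; rewrite gt_eqF.
    by rewrite mulrBr mulrA -tE; exact: ltW.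
  by rewrite ler_pM2l.
apply: le_ereal_inf_tmp => _ [s /= [s0 Hs] <-].
rewrite lee_fin ler_pdivrMr// mulrC leNgt; apply/negP => sh.
have := tree_hausdorff KE s0 sh Kcov psile.
by rewrite Hs ltxx.
Qed.

End Final.

Theorem theorem1p1 (R : realType) (lambda : R)
    (nu : probability (measurableTypeR R) R)
    (lambda_gt : 2^-1 < lambda) (lambda_lt : lambda < 1)
    (salem_lambdaV : salem_number lambda^-1)
    (nuE : bernoulli_convolution lambda nu) :
  (forall alpha : R,
     (Lq_slope_infty nu <= alpha%:E)%E -> (alpha%:E <= Lq_rderiv0 nu)%E ->
     level_set nu alpha !=set0) /\
  (forall alpha : R,
     (Lq_slope_infty nu <= alpha%:E)%E -> (alpha%:E <= Lq_rderiv0 nu)%E ->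
     hausdorff_dim (level_set nu alpha) = Lq_legendre nu alpha).
Proof.
have lambda_gt0 : 0 < lambda by apply: lt_trans lambda_gt; rewrite invr_gt0.
have [D window] := bpts_window lambda_gt0 lambda_lt salem_lambdaV.
by split=> alpha h1 h2; have [] := bernoulli_level_set lambda_gt0 lambda_lt nuE window h1 h2.
Qed.
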